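(* Let $M,N$ be networks of the calculus CaIT with $M\cong N$. Then $M\approx N$.
   Context: The calculus CaIT. Fix a set of locations with a distance $d(h,k)\in\mathbb N$ between locations, a constant $\delta\in\mathbb N$, and a function $\mathrm{rng}$ giving each channel $c$ a range $\mathrm{rng}(c)\in\mathbb N\cup\{-1,\infty\}$. Values $v,w$ include basic values, sensor/actuator values and locations; boolean guards $b$ are decidable. Processes: $P,Q::=\mathsf{nil}\mid \rho.P\mid P\parallel Q\mid \lfloor\pi.P\rfloor Q\mid [b]P;Q\mid X\mid \mathsf{fix}\,X.P$ with $\rho\in\{\sigma,\ @(x),\ s?(x),\ a!v\}$ ($s$ a sensor, $a$ an actuator) and $\pi\in\{\overline{c}\langle v\rangle,\ c(x)\}$. The variable $x$ is bound in $c(x).P$, $s?(x).P$, $@(x).P$ and $X$ in $\mathsf{fix}X.P$; in $\sigma.Q$ and $\lfloor\pi.P\rfloor Q$ the occurrence of $Q$ is time-guarded, and in $\mathsf{fix}X.P$ all occurrences of $X$ must be time-guarded. Networks: $M,N::=\mathbf 0\mid n[\mathcal I\bowtie P]^{\mu}_{h}\mid M\mid N\mid (\nu c)M$, where $n$ is a node name, $\mathcal I$ a partial map from sensor and actuator names to values (physical interface), $\mu\in\{\mathsf s,\mathsf m\}$ (stationary/mobile) and $h$ a location. Sensors are node-dependent or location-dependent. Networks are closed and well-formed: node names are distinct; distinct nodes have distinct actuators and distinct node-dependent sensors; if $P$ in $n[\mathcal I\bowtie P]^\mu_h$ contains $s?(x)$ (resp. $a!v$) then $\mathcal I(s)$ (resp.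 $\mathcal I(a)$) is defined; a node whose interface defines a location-dependent sensor is stationary. $\prod$ denotes iterated parallel composition, with empty product $\mathsf{nil}$ or $\mathbf 0$; $T\{v/x\}$ is substitution. Structural congruence $\equiv$ is the least congruence with: $\parallel$ commutative, associative, unit $\mathsf{nil}$; $[b]P;Q\equiv P$ if $b$ true, $\equiv Q$ if $b$ false; $\mathsf{fix}X.P\equiv P\{\mathsf{fix}X.P/X\}$; $P\equiv Q$ implies $n[\mathcal I\bowtie P]^\mu_h\equiv n[\mathcal I\bowtie Q]^\mu_h$; network $\mid$ commutative, associative, unit $\mathbf 0$; $(\nu c)\mathbf 0\equiv\mathbf 0$; $(\nu c)(\nu d)M\equiv(\nu d)(\nu c)M$; $(\nu c)(M\mid N)\equiv M\mid(\nu c)N$ if $c$ not in $M$. Reduction relations $\to_\tau$, $\to_a$ ($a$ an actuator), $\to_\sigma$ are the least relations closed under: (pos) $n[\mathcal I\bowtie @(x).P]^\mu_h\to_\tau n[\mathcal I\bowtie P\{h/x\}]^\mu_h$; (sensread) if $\mathcal I(s)=v$, $n[\mathcal I\bowtie s?(x).P]^\mu_h\to_\tau n[\mathcal I\bowtie P\{v/x\}]^\mu_h$; (actunchg) if $\mathcal I(a)=v$, $n[\mathcal I\bowtie a!v.P]^\mu_h\to_\tau n[\mathcal I\bowtie P]^\mu_h$; (actchg) if $\mathcal I(a)\ne v$, $n[\mathcal I\bowtie a!v.P]^\mu_h\to_a n[\mathcal I[a\mapsto v]\bowtie P]^\mu_h$; (loccom) if $\mathrm{rng}(c)=-1$, $n[\mathcal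 I\bowtie \lfloor\overline c\langle v\rangle.P\rfloor R\parallel\lfloor c(x).Q\rfloor S]^\mu_h\to_\tau n[\mathcal I\bowtie P\parallel Q\{v/x\}]^\mu_h$; (timestat) if $N=n[\mathcal I\bowtie \prod_i\lfloor\pi_i.P_i\rfloor Q_i\parallel\prod_j\sigma.R_j]^{\mathsf s}_h$ has no $\to_\tau$ reduction then $N\to_\sigma n[\mathcal I\bowtie\prod_iQ_i\parallel\prod_jR_j]^{\mathsf s}_h$; (timemob) likewise for $\mu=\mathsf m$, with result located at any $k$ with $d(h,k)\le\delta$; (glbcom) if $d(h,k)\le\mathrm{rng}(c)$, $n[\mathcal I\bowtie\lfloor\overline c\langle v\rangle.P\rfloor R]^{\mu_1}_h\mid m[\mathcal J\bowtie\lfloor c(x).Q\rfloor S]^{\mu_2}_k\to_\tau n[\mathcal I\bowtie P]^{\mu_1}_h\mid m[\mathcal J\bowtie Q\{v/x\}]^{\mu_2}_k$; (parp) for $\omega\in\{\tau,a\}$, if $\prod_i n_i[\mathcal I_i\bowtie P_i]^{\mu_i}_{h_i}\to_\omega\prod_i n_i[\mathcal I'_i\bowtie P'_i]^{\mu'_i}_{h'_i}$ then $\prod_i n_i[\mathcal I_i\bowtie P_i\parallel Q_i]^{\mu_i}_{h_i}\to_\omega\prod_i n_i[\mathcal I'_i\bowtie P'_i\parallel Q_i]^{\mu'_i}_{h'_i}$; (parn) for $\omega\in\{\tau,a\}$, $M\to_\omega M'$ implies $M\mid N\to_\omega M'\mid N$; (timepar) $M\to_\sigma M'$, $N\to_\sigma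 N'$ and $M\mid N$ has no $\to_\tau$ reduction imply $M\mid N\to_\sigma M'\mid N'$; (timezero) $\mathbf 0\to_\sigma\mathbf 0$; (res) $M\to_\omega N$ implies $(\nu c)M\to_\omega(\nu c)N$ for $\omega\in\{\tau,a,\sigma\}$; (struct) $M\equiv N\to_\omega N'\equiv M'$ implies $M\to_\omega M'$. Let $\to\;=\;\to_\tau\cup\to_\sigma$, with reflexive–transitive closure $\to^*$. Reduction barbed congruence. Barb: $M\downarrow_{a!v@h}$ iff $M\equiv(\nu\tilde g)(n[\mathcal I\bowtie P]^\mu_h\mid M')$ with $\mathcal I(a)=v$; $M\Downarrow_{a!v@h}$ iff $M\to^* M''$ with $M''\downarrow_{a!v@h}$. Sensor update: $n[\mathcal I\bowtie P]^\mu_h[s@h\mapsto v]=n[\mathcal I[s\mapsto v]\bowtie P]^\mu_h$ if $\mathcal I(s)$ is defined; a node is unchanged if $\mathcal I(s)$ is undefined or it is located at $k\ne h$; the update distributes over $\mid$ and $(\nu c)$, and $\mathbf 0[s@h\mapsto v]=\mathbf 0$. A relation $\mathcal R$ on networks is barb preserving if $M\,\mathcal R\,N$ and $M\downarrow_{a!v@h}$ imply $N\Downarrow_{a!v@h}$; reduction closed if $M\,\mathcal R\,N$ implies (i) $M\to M'$ gives $N\to^*N'$ with $M'\,\mathcal R\,N'$ and (ii) $M\to_a M'$ gives $N\to^*\to_a\to^*N'$ with $M'\,\mathcal R\,N'$; contextual if $M\,\mathcal R\,N$ implies $M\mid O\;\mathcal R\;N\mid O$ for all networks $O$, $(\nu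 c)M\;\mathcal R\;(\nu c)N$ for all channels $c$, and $M[s@h\mapsto v]\;\mathcal R\;N[s@h\mapsto v]$ for all sensors $s$, locations $h$ and values $v$ in the domain of $s$. $\cong$ is the largest symmetric relation on networks that is reduction closed, barb preserving and contextual. Labelled (intensional) semantics. Process transitions $P\xrightarrow{\lambda}P'$, $\lambda\in\{\sigma,\tau,\overline cv,cv,@h,s?v,a!v\}$, with $[b]P;Q$ identified with $P$ if $b$ is true and with $Q$ otherwise, are the least relation closed under: $\lfloor\overline c\langle v\rangle.P\rfloor Q\xrightarrow{\overline cv}P$; $\lfloor c(x).P\rfloor Q\xrightarrow{cv}P\{v/x\}$ (any $v$); $s?(x).P\xrightarrow{s?v}P\{v/x\}$ (any $v$); $a!v.P\xrightarrow{a!v}P$; $@(x).P\xrightarrow{@h}P\{h/x\}$ (any $h$); if $P\xrightarrow{\overline cv}P'$, $Q\xrightarrow{cv}Q'$ and $\mathrm{rng}(c)=-1$ then $P\parallel Q\xrightarrow{\tau}P'\parallel Q'$ and $Q\parallel P\xrightarrow{\tau}Q'\parallel P'$; if $P\xrightarrow{\lambda}P'$ with $\lambda\ne\sigma$ then $P\parallel Q\xrightarrow{\lambda}P'\parallel Q$ and $Q\parallel P\xrightarrow{\lambda}Q\parallel P'$; if $P\{\mathsf{fix}X.P/X\}\xrightarrow{\lambda}Q$ then $\mathsf{fix}X.P\xrightarrow{\lambda}Q$; $\mathsf{nil}\xrightarrow{\sigma}\mathsf{nil}$; $\sigma.P\xrightarrow{\sigma}P$; $\lfloor\pi.P\rfloor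 Q\xrightarrow{\sigma}Q$; if $P\xrightarrow{\sigma}P'$, $Q\xrightarrow{\sigma}Q'$ and $P\parallel Q$ has no $\tau$-transition then $P\parallel Q\xrightarrow{\sigma}P'\parallel Q'$. Network transitions $M\xrightarrow{\nu}M'$, $\nu\in\{\sigma,\tau,a,\overline cv@h,cv@h\}$, are the least relation closed under (for a node $n[\mathcal I\bowtie P]^\mu_h$): if $P\xrightarrow{@h}P'$ then node $\xrightarrow{\tau}n[\mathcal I\bowtie P']^\mu_h$; if $\mathcal I(s)=v$ and $P\xrightarrow{s?v}P'$ then node $\xrightarrow{\tau}n[\mathcal I\bowtie P']^\mu_h$; if $\mathcal I(a)=v$ and $P\xrightarrow{a!v}P'$ then node $\xrightarrow{\tau}n[\mathcal I\bowtie P']^\mu_h$; if $\mathcal I(a)\ne v$ and $P\xrightarrow{a!v}P'$ then node $\xrightarrow{a}n[\mathcal I[a\mapsto v]\bowtie P']^\mu_h$; if $P\xrightarrow{\tau}P'$ then node $\xrightarrow{\tau}n[\mathcal I\bowtie P']^\mu_h$; if $P\xrightarrow{\sigma}P'$ and the node has no $\tau$-transition then $n[\mathcal I\bowtie P]^{\mathsf s}_h\xrightarrow{\sigma}n[\mathcal I\bowtie P']^{\mathsf s}_h$ and $n[\mathcal I\bowtie P]^{\mathsf m}_h\xrightarrow{\sigma}n[\mathcal I\bowtie P']^{\mathsf m}_k$ for every $k$ with $d(h,k)\le\delta$; if $P\xrightarrow{\overline cv}P'$ (resp. $\xrightarrow{cv}$) and $\mathrm{rng}(c)\ge0$ then node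 $\xrightarrow{\overline cv@h}$ (resp. $\xrightarrow{cv@h}$) $n[\mathcal I\bowtie P']^\mu_h$; if $M\xrightarrow{\overline cv@k}M'$, $N\xrightarrow{cv@h}N'$ and $d(h,k)\le\mathrm{rng}(c)$ then $M\mid N\xrightarrow{\tau}M'\mid N'$ and $N\mid M\xrightarrow{\tau}N'\mid M'$; if $M\xrightarrow{\nu}M'$, $\nu\ne\sigma$, then $M\mid N\xrightarrow{\nu}M'\mid N$ and $N\mid M\xrightarrow{\nu}N\mid M'$; if $M\xrightarrow{\sigma}M'$, $N\xrightarrow{\sigma}N'$ and $M\mid N$ has no $\tau$-transition then $M\mid N\xrightarrow{\sigma}M'\mid N'$; $\mathbf 0\xrightarrow{\sigma}\mathbf 0$; if $M\xrightarrow{\nu}N$ and $\nu$ is not of the form $\overline cv@h$ or $cv@h$ then $(\nu c)M\xrightarrow{\nu}(\nu c)N$. Extensional semantics: the transitions labelled $\tau,\sigma,a$ are those above; in addition (i) if $M\xrightarrow{\overline cv@h}M'$ and $d(h,k)\le\mathrm{rng}(c)$ then $M\xrightarrow{\overline cv\triangleright k}M'$; (ii) if $M\xrightarrow{cv@h}M'$ and $d(k,h)\le\mathrm{rng}(c)$ then $M\xrightarrow{cv\triangleleft k}M'$; (iii) for every sensor $s$, location $h$ and $v$ in the domain of $s$, $M\xrightarrow{s?v@h}M[s@h\mapsto v]$; (iv) if $M\downarrow_{a!v@h}$ then $M\xrightarrow{a!v@h}M$. Let $\alpha$ range over extensional labels. $\Rightarrow$ is $(\xrightarrow{\tau})^*$,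 $\xRightarrow{\alpha}$ is $\Rightarrow\xrightarrow{\alpha}\Rightarrow$, and $\xRightarrow{\hat\alpha}$ is $\Rightarrow$ if $\alpha=\tau$ and $\xRightarrow{\alpha}$ otherwise. A symmetric relation $\mathcal R$ is a bisimulation if $M\,\mathcal R\,N$ and $M\xrightarrow{\alpha}M'$ imply $N\xRightarrow{\hat\alpha}N'$ with $M'\,\mathcal R\,N'$; $\approx$ is the union of all bisimulations.
   Formalization: Assumed in addition: physical interfaces are finite partial maps; node names, actuators and channels of each occurring range are inexhaustible; d is a metric; values include two booleans; guards may be any decidable predicate. With an interface defined on all actuators the claim fails. *)

(* Defs.v *)
From HB Require Import structures.
From mathcomp Require Import all_boot finmap.
From Stdlib Require Import Relation_Operators.

Set Implicit Arguments.
Unset Strict Implicit.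
Unset Printing Implicit Defensive.

Local Open Scope fset_scope.
Local Open Scope fmap_scope.

(* Local, Within m and Unbounded stand for the ranges -1, m and infinity. *)
Inductive range := Local | Within of nat | Unbounded.

Definition in_range (n : nat) (r : range) : bool :=
  match r with Local => false | Within m => n <= m | Unbounded => true end.

Definition range_ge0 (r : range) : bool := if r is Local then false else true.

(* The freshness fields are the usual convention that finitely many names never
   exhaust the supply; for channels the fresh name has a prescribed range, since
   alpha-conversion of a restricted channel must not change its range. *)
Record cait_sig := CaitSig {
  loc : eqType;
  dist : loc -> loc -> nat;
  dist_eq0 : forall h k, (dist h k == 0) = (h == k);
  dist_sym : forall h k, dist h k = dist k h;
  dist_triangle : forall h k l, dist h l <= dist h k + dist k l;
  delta : nat;
  chan : eqType;
  rng : chan -> range;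
  chan_fresh : forall (c : chan) (s : seq chan),
    exists2 d, d \notin s & rng d = rng c;
  node : eqType;
  node_fresh : forall s : seq node, exists n, n \notin s;
  actuator : choiceType;
  actuator_fresh : forall s : seq actuator, exists a, a \notin s;
  sensor : choiceType;
  loc_dependent : pred sensor;
  value : eqType;
  vloc : loc -> value;
  vloc_inj : injective vloc;
  vbool : bool -> value;
  vbool_inj : injective vbool;
  sensor_dom : sensor -> pred value }.

Section Calculus.

Variable S : cait_sig.

(** Processes.  Value variables and process variables are two separate kinds of
    de Bruijn indices. *)

Inductive term := Val of value S | Var of nat.

Definition eval_term (t : term) : option (value S) :=
  if t is Val v then Some v else None.

(* A guard is a decidable predicate applied to a list of terms; it has a truth
   value once all these terms are values. *)
Inductive guard := Guard of pred (seq (value S)) & seq term.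

Definition eval_guard (b : guard) : option bool :=
  let: Guard p ts := b in
  if all (fun t => isSome (eval_term t)) ts then Some (p (pmap eval_term ts))
  else None.

Inductive rho :=
  | Sigma
  | GetLoc
  | Sense of sensor S
  | Actuate of actuator S & term.

Inductive pi := Send of chan S & term | Recv of chan S.

(* Number of value variables bound in the continuation. *)
Definition rho_bind (r : rho) : nat :=
  match r with GetLoc | Sense _ => 1 | Sigma | Actuate _ _ => 0 end.

Definition pi_bind (p : pi) : nat :=
  match p with Recv _ => 1 | Send _ _ => 0 end.

Inductive proc :=
  | Nil
  | Pre of rho & proc
  | Par of proc & proc
  | Timeout of pi & proc & proc
  | Cond of guard & proc & proc
  | PVar of nat
  | Fix of proc.

Definition map_guard (f : term -> term) (b : guard) : guard :=
  let: Guard p ts := b in Guard p (map f ts).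

Definition map_rho (f : term -> term) (r : rho) : rho :=
  if r is Actuate a t then Actuate a (f t) else r.

Definition map_pi (f : term -> term) (p : pi) : pi :=
  if p is Send c t then Send c (f t) else p.

Definition shift_term (k : nat) (t : term) : term :=
  if t is Var i then Var (if i < k then i else i.+1) else t.

Fixpoint shiftv (k : nat) (P : proc) : proc :=
  match P with
  | Nil => Nil
  | Pre r P => Pre (map_rho (shift_term k) r) (shiftv (rho_bind r + k) P)
  | Par P Q => Par (shiftv k P) (shiftv k Q)
  | Timeout p P Q =>
      Timeout (map_pi (shift_term k) p) (shiftv (pi_bind p + k) P) (shiftv k Q)
  | Cond b P Q => Cond (map_guard (shift_term k) b) (shiftv k P) (shiftv k Q)
  | PVar i => PVar i
  | Fix P => Fix (shiftv k P)
  end.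

Fixpoint shiftp (k : nat) (P : proc) : proc :=
  match P with
  | Nil => Nil
  | Pre r P => Pre r (shiftp k P)
  | Par P Q => Par (shiftp k P) (shiftp k Q)
  | Timeout p P Q => Timeout p (shiftp k P) (shiftp k Q)
  | Cond b P Q => Cond b (shiftp k P) (shiftp k Q)
  | PVar i => PVar (if i < k then i else i.+1)
  | Fix P => Fix (shiftp k.+1 P)
  end.

Definition subst_term (k : nat) (v : value S) (t : term) : term :=
  if t is Var i then
    if i < k then Var i else if i == k then Val v else Var i.-1
  else t.

(* Value variable k is replaced by v; the variables above k are lowered. *)
Fixpoint substv (k : nat) (v : value S) (P : proc) : proc :=
  match P with
  | Nil => Nil
  | Pre r P => Pre (map_rho (subst_term k v) r) (substv (rho_bind r + k) v P)
  | Par P Q => Par (substv k v P) (substv k v Q)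
  | Timeout p P Q =>
      Timeout (map_pi (subst_term k v) p) (substv (pi_bind p + k) v P)
        (substv k v Q)
  | Cond b P Q =>
      Cond (map_guard (subst_term k v) b) (substv k v P) (substv k v Q)
  | PVar i => PVar i
  | Fix P => Fix (substv k v P)
  end.

(* Process variable k is replaced by R; the variables above k are lowered. *)
Fixpoint substp (k : nat) (R : proc) (P : proc) : proc :=
  match P with
  | Nil => Nil
  | Pre r P => Pre r (substp k (iter (rho_bind r) (shiftv 0) R) P)
  | Par P Q => Par (substp k R P) (substp k R Q)
  | Timeout p P Q =>
      Timeout p (substp k (iter (pi_bind p) (shiftv 0) R) P) (substp k R Q)
  | Cond b P Q => Cond b (substp k R P) (substp k R Q)
  | PVar i => if i < k then PVar i else if i == k then R else PVar i.-1
  | Fix P => Fix (substp k.+1 (shiftp 0 R) P)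
  end.

Definition instv (v : value S) (P : proc) : proc := substv 0 v P.
Definition unfold_fix (P : proc) : proc := substp 0 (Fix P) P.

(** Well-formed processes. *)

Definition scoped_term (n : nat) (t : term) : bool :=
  if t is Var i then i < n else true.

(* No free value variable >= n and no free process variable >= m. *)
Fixpoint scoped (n m : nat) (P : proc) : bool :=
  match P with
  | Nil => true
  | Pre r P =>
      (if r is Actuate _ t then scoped_term n t else true)
      && scoped (rho_bind r + n) m P
  | Par P Q => scoped n m P && scoped n m Q
  | Timeout p P Q =>
      [&& (if p is Send _ t then scoped_term n t else true),
          scoped (pi_bind p + n) m P & scoped n m Q]
  | Cond (Guard _ ts) P Q =>
      [&& all (scoped_term n) ts, scoped n m P & scoped n m Q]
  | PVar i => i < m
  | Fix P => scoped n m.+1 P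
  end.

(* Every occurrence of process variable k in P is time-guarded. *)
Fixpoint var_guarded (k : nat) (P : proc) : bool :=
  match P with
  | Nil => true
  | Pre Sigma _ => true
  | Pre _ P => var_guarded k P
  | Par P Q => var_guarded k P && var_guarded k Q
  | Timeout _ P _ => var_guarded k P
  | Cond _ P Q => var_guarded k P && var_guarded k Q
  | PVar i => i != k
  | Fix P => var_guarded k.+1 P
  end.

Fixpoint time_guarded (P : proc) : bool :=
  match P with
  | Nil | PVar _ => true
  | Pre _ P => time_guarded P
  | Par P Q | Timeout _ P Q | Cond _ P Q => time_guarded P && time_guarded Q
  | Fix P => var_guarded 0 P && time_guarded P
  end.

Definition device : Type := (sensor S + actuator S)%type.

Fixpoint devices (P : proc) : seq device :=
  match P with
  | Nil | PVar _ => [::]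
  | Pre (Sense s) P => inl s :: devices P
  | Pre (Actuate a _) P => inr a :: devices P
  | Pre _ P | Fix P => devices P
  | Par P Q | Timeout _ P Q | Cond _ P Q => devices P ++ devices Q
  end.

Definition pi_chan (p : pi) : chan S :=
  match p with Send c _ => c | Recv c => c end.

Fixpoint pchans (P : proc) : seq (chan S) :=
  match P with
  | Nil | PVar _ => [::]
  | Pre _ P | Fix P => pchans P
  | Timeout p P Q => pi_chan p :: pchans P ++ pchans Q
  | Par P Q | Cond _ P Q => pchans P ++ pchans Q
  end.

Definition ren_chan (c d e : chan S) : chan S := if e == c then d else e.

Definition ren_pi (c d : chan S) (p : pi) : pi :=
  match p with
  | Send e t => Send (ren_chan c d e) t
  | Recv e => Recv (ren_chan c d e)
  end.

Fixpoint ren_proc (c d : chan S) (P : proc) : proc :=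
  match P with
  | Nil => Nil
  | Pre r P => Pre r (ren_proc c d P)
  | Par P Q => Par (ren_proc c d P) (ren_proc c d Q)
  | Timeout p P Q => Timeout (ren_pi c d p) (ren_proc c d P) (ren_proc c d Q)
  | Cond b P Q => Cond b (ren_proc c d P) (ren_proc c d Q)
  | PVar i => PVar i
  | Fix P => Fix (ren_proc c d P)
  end.

(** Networks. *)

Inductive mobility := Stationary | Mobile.

Definition interface : Type := {fmap (sensor S + actuator S)%type -> value S}.

Inductive net :=
  | Zero
  | Node of node S & interface & proc & mobility & loc S
  | NPar of net & net
  | Res of chan S & net.

Fixpoint nodes (M : net) : seq (node S * interface * proc * mobility) :=
  match M with
  | Zero => [::]
  | Node n J P mu _ => [:: (n, J, P, mu)]
  | NPar M N => nodes M ++ nodes N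
  | Res _ M => nodes M
  end.

Definition wf_node (x : node S * interface * proc * mobility) : bool :=
  let: (_, J, P, mu) := x in
  [&& scoped 0 0 P,
      time_guarded P,
      all (fun k => k \in domf J) (devices P) &
      if mu is Stationary then true else
        all (fun k => if k is inl s then ~~ loc_dependent s else true)
            (enum_fset (domf J))].

(* Devices that only one node may own: all but location-dependent sensors. *)
Definition exclusive (k : device) : bool :=
  if k is inl s then ~~ loc_dependent s else true.

Definition disjoint_devices (x y : node S * interface * proc * mobility) : bool :=
  let: (_, J, _, _) := x in let: (_, K, _, _) := y in
  all (fun k => exclusive k ==> (k \notin domf K)) (enum_fset (domf J)).

Definition wf (M : net) : bool :=
  [&& all wf_node (nodes M),
      uniq [seq x.1.1.1 | x <- nodes M] &
      pairwise disjoint_devices (nodes M)].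

(* All channel names of M, bound ones included. *)
Fixpoint nchans (M : net) : seq (chan S) :=
  match M with
  | Zero => [::]
  | Node _ _ P _ _ => pchans P
  | NPar M N => nchans M ++ nchans N
  | Res c M => c :: nchans M
  end.

Fixpoint free_chans (M : net) : seq (chan S) :=
  match M with
  | Zero => [::]
  | Node _ _ P _ _ => pchans P
  | NPar M N => free_chans M ++ free_chans N
  | Res c M => [seq d <- free_chans M | d != c]
  end.

(* Replaces the free occurrences of c by d; used only when d is not in nchans M,
   so that nothing is captured. *)
Fixpoint ren_net (c d : chan S) (M : net) : net :=
  match M with
  | Zero => Zero
  | Node n J P mu h => Node n J (ren_proc c d P) mu h
  | NPar M N => NPar (ren_net c d M) (ren_net c d N)
  | Res e M => if e == c then Res e M else Res e (ren_net c d M)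
  end.

(** Structural congruence, as the equivalence closure of the contextual closure
    of its axioms. *)

Inductive pstruct : proc -> proc -> Prop :=
  | ps_comm P Q : pstruct (Par P Q) (Par Q P)
  | ps_assoc P Q R : pstruct (Par (Par P Q) R) (Par P (Par Q R))
  | ps_unit P : pstruct (Par P Nil) P
  | ps_true b P Q : eval_guard b = Some true -> pstruct (Cond b P Q) P
  | ps_false b P Q : eval_guard b = Some false -> pstruct (Cond b P Q) Q
  | ps_fix P : pstruct (Fix P) (unfold_fix P)
  | ps_ctx_pre r P P' : pstruct P P' -> pstruct (Pre r P) (Pre r P')
  | ps_ctx_parl P P' Q : pstruct P P' -> pstruct (Par P Q) (Par P' Q)
  | ps_ctx_parr P P' Q : pstruct P P' -> pstruct (Par Q P) (Par Q P')
  | ps_ctx_timeoutl p P P' Q :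
      pstruct P P' -> pstruct (Timeout p P Q) (Timeout p P' Q)
  | ps_ctx_timeoutr p P P' Q :
      pstruct P P' -> pstruct (Timeout p Q P) (Timeout p Q P')
  | ps_ctx_condl b P P' Q : pstruct P P' -> pstruct (Cond b P Q) (Cond b P' Q)
  | ps_ctx_condr b P P' Q : pstruct P P' -> pstruct (Cond b Q P) (Cond b Q P')
  | ps_ctx_fix P P' : pstruct P P' -> pstruct (Fix P) (Fix P').

(* ns_alpha: terms are usually identified up to renaming of restricted
   channels. *)
Inductive nstruct : net -> net -> Prop :=
  | ns_node n J P P' mu h :
      pstruct P P' -> nstruct (Node n J P mu h) (Node n J P' mu h)
  | ns_comm M N : nstruct (NPar M N) (NPar N M)
  | ns_assoc M N O : nstruct (NPar (NPar M N) O) (NPar M (NPar N O))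
  | ns_unit M : nstruct (NPar M Zero) M
  | ns_res_zero c : nstruct (Res c Zero) Zero
  | ns_res_swap c d M : nstruct (Res c (Res d M)) (Res d (Res c M))
  | ns_extrude c M N :
      c \notin free_chans M -> nstruct (Res c (NPar M N)) (NPar M (Res c N))
  | ns_alpha c d M :
      d \notin nchans M -> rng d = rng c ->
      nstruct (Res c M) (Res d (ren_net c d M))
  | ns_ctx_parl M M' N : nstruct M M' -> nstruct (NPar M N) (NPar M' N)
  | ns_ctx_parr M M' N : nstruct M M' -> nstruct (NPar N M) (NPar N M')
  | ns_ctx_res c M M' : nstruct M M' -> nstruct (Res c M) (Res c M').

(* Every step of a chain relates well-formed networks: from right to left, the
   axioms for guards could otherwise introduce an arbitrary discarded branch. *)
Definition scong : net -> net -> Prop :=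
  clos_refl_sym_trans net (fun M N => [/\ wf M, wf N & nstruct M N]).

(** Reduction semantics.  The timed relation is defined after the untimed ones,
    on which its negative premises depend. *)

Inductive rlabel := RTau | RAct of actuator S.

Inductive red : rlabel -> net -> net -> Prop :=
  | red_pos n (J : interface) P mu h :
      red RTau (Node n J (Pre GetLoc P) mu h) (Node n J (instv (vloc h) P) mu h)
  | red_sensread n (J : interface) s v P mu h :
      J.[? inl s] = Some v ->
      red RTau (Node n J (Pre (Sense s) P) mu h) (Node n J (instv v P) mu h)
  | red_actunchg n (J : interface) a v P mu h :
      J.[? inr a] = Some v ->
      red RTau (Node n J (Pre (Actuate a (Val v)) P) mu h) (Node n J P mu h)
  | red_actchg n (J : interface) a v P mu h :
      J.[? inr a] <> Some v ->
      red (RAct a) (Node n J (Pre (Actuate a (Val v)) P) mu h)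
                   (Node n J.[inr a <- v] P mu h)
  | red_loccom n (J : interface) c v P Q R R' mu h :
      rng c = Local ->
      red RTau
        (Node n J (Par (Timeout (Send c (Val v)) P R) (Timeout (Recv c) Q R')) mu h)
        (Node n J (Par P (instv v Q)) mu h)
  | red_glbcom n (J : interface) P R mu1 h m K Q R' mu2 k c v :
      in_range (dist h k) (rng c) ->
      red RTau
        (NPar (Node n J (Timeout (Send c (Val v)) P R) mu1 h)
              (Node m K (Timeout (Recv c) Q R') mu2 k))
        (NPar (Node n J P mu1 h) (Node m K (instv v Q) mu2 k))
  | red_parp w k (n : 'I_k -> node S) (J J' : 'I_k -> interface)
      (P P' Q : 'I_k -> proc) (mu mu' : 'I_k -> mobility) (h h' : 'I_k -> loc S) :
      red w (\big[NPar/Zero]_(i < k) Node (n i) (J i) (P i) (mu i) (h i))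
            (\big[NPar/Zero]_(i < k) Node (n i) (J' i) (P' i) (mu' i) (h' i)) ->
      red w
        (\big[NPar/Zero]_(i < k) Node (n i) (J i) (Par (P i) (Q i)) (mu i) (h i))
        (\big[NPar/Zero]_(i < k)
            Node (n i) (J' i) (Par (P' i) (Q i)) (mu' i) (h' i))
  | red_parn w M M' N : red w M M' -> red w (NPar M N) (NPar M' N)
  | red_res w c M M' : red w M M' -> red w (Res c M) (Res c M')
  | red_struct w M N N' M' :
      scong M N -> red w N N' -> scong N' M' -> red w M M'.

Definition no_red_tau (M : net) : Prop := ~ exists M', red RTau M M'.

Definition waiting k l (p : 'I_k -> pi) (P Q : 'I_k -> proc) (R : 'I_l -> proc) :
    proc :=
  Par (\big[Par/Nil]_(i < k) Timeout (p i) (P i) (Q i))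
      (\big[Par/Nil]_(j < l) Pre Sigma (R j)).

Definition elapsed k l (Q : 'I_k -> proc) (R : 'I_l -> proc) : proc :=
  Par (\big[Par/Nil]_(i < k) Q i) (\big[Par/Nil]_(j < l) R j).

Inductive red_sigma : net -> net -> Prop :=
  | red_timestat n (J : interface) h k l (p : 'I_k -> pi) (P Q : 'I_k -> proc)
      (R : 'I_l -> proc) :
      no_red_tau (Node n J (waiting p P Q R) Stationary h) ->
      red_sigma (Node n J (waiting p P Q R) Stationary h)
                (Node n J (elapsed Q R) Stationary h)
  | red_timemob n (J : interface) h h' k l (p : 'I_k -> pi) (P Q : 'I_k -> proc)
      (R : 'I_l -> proc) :
      no_red_tau (Node n J (waiting p P Q R) Mobile h) ->
      dist h h' <= delta S ->
      red_sigma (Node n J (waiting p P Q R) Mobile h)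
                (Node n J (elapsed Q R) Mobile h')
  | red_timepar M M' N N' :
      red_sigma M M' -> red_sigma N N' -> no_red_tau (NPar M N) ->
      red_sigma (NPar M N) (NPar M' N')
  | red_timezero : red_sigma Zero Zero
  | red_sigma_res c M M' : red_sigma M M' -> red_sigma (Res c M) (Res c M')
  | red_sigma_struct M N N' M' :
      scong M N -> red_sigma N N' -> scong N' M' -> red_sigma M M'.

Definition step (M N : net) : Prop := red RTau M N \/ red_sigma M N.
Definition steps : net -> net -> Prop := clos_refl_trans net step.

(** Reduction barbed congruence. *)

Definition barb (a : actuator S) (v : value S) (h : loc S) (M : net) : Prop :=
  exists (g : seq (chan S)) n (J : interface) P mu M',
    scong M (foldr Res (NPar (Node n J P mu h) M') g) /\ J.[? inr a] = Some v.

Definition weak_barb (a : actuator S) (v : value S) (h : loc S) (M : net) : Prop :=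
  exists2 M', steps M M' & barb a v h M'.

Fixpoint sensor_update (s : sensor S) (h : loc S) (v : value S) (M : net) : net :=
  match M with
  | Zero => Zero
  | Node n J P mu k =>
      if (k == h) && (inl s \in domf J) then Node n J.[inl s <- v] P mu k
      else Node n J P mu k
  | NPar M N => NPar (sensor_update s h v M) (sensor_update s h v N)
  | Res c M => Res c (sensor_update s h v M)
  end.

Definition network_rel (R : net -> net -> Prop) : Prop :=
  forall M N, R M N -> wf M /\ wf N.

Definition symmetric_rel (R : net -> net -> Prop) : Prop :=
  forall M N, R M N -> R N M.

Definition barb_preserving (R : net -> net -> Prop) : Prop :=
  forall M N, R M N -> forall a v h, barb a v h M -> weak_barb a v h N.

Definition reduction_closed (R : net -> net -> Prop) : Prop :=
  forall M N, R M N ->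
    (forall M', step M M' -> exists2 N', steps N N' & R M' N') /\
    (forall a M', red (RAct a) M M' ->
       exists N1 N2 N',
         [/\ steps N N1, red (RAct a) N1 N2, steps N2 N' & R M' N']).

(* M | O is a network only if it is well-formed. *)
Definition contextual (R : net -> net -> Prop) : Prop :=
  forall M N, R M N ->
    [/\ forall O, wf (NPar M O) -> wf (NPar N O) -> R (NPar M O) (NPar N O),
        forall c, R (Res c M) (Res c N) &
        forall s h v, sensor_dom s v ->
          R (sensor_update s h v M) (sensor_update s h v N)].

Definition barbed_cong (M N : net) : Prop :=
  exists R : net -> net -> Prop,
    [/\ network_rel R, symmetric_rel R, reduction_closed R, barb_preserving R
      & contextual R] /\ R M N.

(** Intensional labelled semantics, with the same separation of the timed
    transitions. *)

Inductive plabel :=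
  | PTau
  | POut of chan S & value S
  | PIn of chan S & value S
  | PLoc of loc S
  | PSense of sensor S & value S
  | PActuate of actuator S & value S.

Inductive ptrans : plabel -> proc -> proc -> Prop :=
  | pt_out c v P Q : ptrans (POut c v) (Timeout (Send c (Val v)) P Q) P
  | pt_in c v P Q : ptrans (PIn c v) (Timeout (Recv c) P Q) (instv v P)
  | pt_sense s v P : ptrans (PSense s v) (Pre (Sense s) P) (instv v P)
  | pt_actuate a v P : ptrans (PActuate a v) (Pre (Actuate a (Val v)) P) P
  | pt_loc h P : ptrans (PLoc h) (Pre GetLoc P) (instv (vloc h) P)
  | pt_coml c v P P' Q Q' :
      ptrans (POut c v) P P' -> ptrans (PIn c v) Q Q' -> rng c = Local ->
      ptrans PTau (Par P Q) (Par P' Q')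
  | pt_comr c v P P' Q Q' :
      ptrans (POut c v) P P' -> ptrans (PIn c v) Q Q' -> rng c = Local ->
      ptrans PTau (Par Q P) (Par Q' P')
  | pt_parl l P P' Q : ptrans l P P' -> ptrans l (Par P Q) (Par P' Q)
  | pt_parr l P P' Q : ptrans l P P' -> ptrans l (Par Q P) (Par Q P')
  | pt_fix l P Q : ptrans l (unfold_fix P) Q -> ptrans l (Fix P) Q
  | pt_true l b P Q P' :
      eval_guard b = Some true -> ptrans l P P' -> ptrans l (Cond b P Q) P'
  | pt_false l b P Q Q' :
      eval_guard b = Some false -> ptrans l Q Q' -> ptrans l (Cond b P Q) Q'.

Inductive ptrans_sigma : proc -> proc -> Prop :=
  | pts_nil : ptrans_sigma Nil Nil
  | pts_sigma P : ptrans_sigma (Pre Sigma P) P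
  | pts_timeout p P Q : ptrans_sigma (Timeout p P Q) Q
  | pts_par P P' Q Q' :
      ptrans_sigma P P' -> ptrans_sigma Q Q' ->
      ~ (exists R, ptrans PTau (Par P Q) R) ->
      ptrans_sigma (Par P Q) (Par P' Q')
  | pts_sigma_fix P Q : ptrans_sigma (unfold_fix P) Q -> ptrans_sigma (Fix P) Q
  | pts_sigma_true b P Q P' :
      eval_guard b = Some true -> ptrans_sigma P P' -> ptrans_sigma (Cond b P Q) P'
  | pts_sigma_false b P Q Q' :
      eval_guard b = Some false -> ptrans_sigma Q Q' -> ptrans_sigma (Cond b P Q) Q'.

Inductive nlabel :=
  | NTau
  | NAct of actuator S
  | NOut of chan S & value S & loc S
  | NIn of chan S & value S & loc S.

Definition on_chan (c : chan S) (l : nlabel) : bool :=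
  match l with NOut d _ _ | NIn d _ _ => d == c | _ => false end.

Inductive ntrans : nlabel -> net -> net -> Prop :=
  | nt_pos n (J : interface) P P' mu h :
      ptrans (PLoc h) P P' -> ntrans NTau (Node n J P mu h) (Node n J P' mu h)
  | nt_sensread n (J : interface) s v P P' mu h :
      J.[? inl s] = Some v -> ptrans (PSense s v) P P' ->
      ntrans NTau (Node n J P mu h) (Node n J P' mu h)
  | nt_actunchg n (J : interface) a v P P' mu h :
      J.[? inr a] = Some v -> ptrans (PActuate a v) P P' ->
      ntrans NTau (Node n J P mu h) (Node n J P' mu h)
  | nt_actchg n (J : interface) a v P P' mu h :
      J.[? inr a] <> Some v -> ptrans (PActuate a v) P P' ->
      ntrans (NAct a) (Node n J P mu h) (Node n J.[inr a <- v] P' mu h)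
  | nt_loccom n (J : interface) P P' mu h :
      ptrans PTau P P' -> ntrans NTau (Node n J P mu h) (Node n J P' mu h)
  | nt_out n (J : interface) c v P P' mu h :
      ptrans (POut c v) P P' -> range_ge0 (rng c) ->
      ntrans (NOut c v h) (Node n J P mu h) (Node n J P' mu h)
  | nt_in n (J : interface) c v P P' mu h :
      ptrans (PIn c v) P P' -> range_ge0 (rng c) ->
      ntrans (NIn c v h) (Node n J P mu h) (Node n J P' mu h)
  | nt_glbcoml c v h k M M' N N' :
      ntrans (NOut c v k) M M' -> ntrans (NIn c v h) N N' ->
      in_range (dist h k) (rng c) ->
      ntrans NTau (NPar M N) (NPar M' N')
  | nt_glbcomr c v h k M M' N N' :
      ntrans (NOut c v k) M M' -> ntrans (NIn c v h) N N' ->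
      in_range (dist h k) (rng c) ->
      ntrans NTau (NPar N M) (NPar N' M')
  | nt_parl l M M' N : ntrans l M M' -> ntrans l (NPar M N) (NPar M' N)
  | nt_parr l M M' N : ntrans l M M' -> ntrans l (NPar N M) (NPar N M')
  | nt_res l c M M' :
      ntrans l M M' -> ~~ on_chan c l -> ntrans l (Res c M) (Res c M').

Definition no_tau (M : net) : Prop := ~ exists M', ntrans NTau M M'.

Inductive ntrans_sigma : net -> net -> Prop :=
  | nt_timestat n (J : interface) P P' h :
      ptrans_sigma P P' -> no_tau (Node n J P Stationary h) ->
      ntrans_sigma (Node n J P Stationary h) (Node n J P' Stationary h)
  | nt_timemob n (J : interface) P P' h k :
      ptrans_sigma P P' -> no_tau (Node n J P Mobile h) ->
      dist h k <= delta S ->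
      ntrans_sigma (Node n J P Mobile h) (Node n J P' Mobile k)
  | nt_timepar M M' N N' :
      ntrans_sigma M M' -> ntrans_sigma N N' -> no_tau (NPar M N) ->
      ntrans_sigma (NPar M N) (NPar M' N')
  | nt_timezero : ntrans_sigma Zero Zero
  | nt_sigma_res c M M' :
      ntrans_sigma M M' -> ntrans_sigma (Res c M) (Res c M').

(** Extensional semantics and bisimilarity. *)

(* EOut c v k and EIn c v k are the labels of output observable at k and of input
   from k. *)
Inductive elabel :=
  | ETau
  | ESigma
  | EAct of actuator S
  | EOut of chan S & value S & loc S
  | EIn of chan S & value S & loc S
  | ESense of sensor S & value S & loc S
  | EBarb of actuator S & value S & loc S.

Inductive etrans : elabel -> net -> net -> Prop :=
  | et_tau M M' : ntrans NTau M M' -> etrans ETau M M'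
  | et_sigma M M' : ntrans_sigma M M' -> etrans ESigma M M'
  | et_act a M M' : ntrans (NAct a) M M' -> etrans (EAct a) M M'
  | et_out c v h k M M' :
      ntrans (NOut c v h) M M' -> in_range (dist h k) (rng c) ->
      etrans (EOut c v k) M M'
  | et_in c v h k M M' :
      ntrans (NIn c v h) M M' -> in_range (dist k h) (rng c) ->
      etrans (EIn c v k) M M'
  | et_sense s v h M :
      sensor_dom s v -> etrans (ESense s v h) M (sensor_update s h v M)
  | et_barb a v h M : barb a v h M -> etrans (EBarb a v h) M M.

Definition taus : net -> net -> Prop := clos_refl_trans net (etrans ETau).

Definition weak_etrans (l : elabel) (M N : net) : Prop :=
  exists M1 M2, [/\ taus M M1, etrans l M1 M2 & taus M2 N].

Definition hat_etrans (l : elabel) (M N : net) : Prop :=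
  if l is ETau then taus M N else weak_etrans l M N.

Definition bisimulation (R : net -> net -> Prop) : Prop :=
  [/\ network_rel R, symmetric_rel R &
      forall M N, R M N -> forall l M', etrans l M M' ->
        exists2 N', hat_etrans l N N' & R M' N'].

Definition bisimilar (M N : net) : Prop :=
  exists2 R : net -> net -> Prop, bisimulation R & R M N.

End Calculus.

(* Main.v *)
From mathcomp Require Import all_boot finmap zify.
From Stdlib Require Import Relation_Operators Operators_Properties Classical.
Require Import Defs.

(** The contextual equivalence is turned into a bisimulation in two steps.

    Reductions and labelled transitions agree up to structural congruence, because
    congruent networks have the same transitions up to congruence.  Under [Fix] the
    latter needs time-guardedness: an unfolding does not expose the recursion variable,
    so the depth inspected by a transition does not grow.

    Then every label of a transition [M --> M'] is recognised by a context.  The only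
    difficulty is that a weak reduction may silently let time pass.  A node that must
    perform a fresh actuation [a!v] before time can pass blocks time; running the
    networks beside a timer that actuates once per time slot makes each time step
    visible: a network whose timer is due can actuate at once, and if its partner has
    an idle timer, adding a blocker prevents the partner from following.  Hence the two
    sides let time pass simultaneously.  An output or input on a channel is recognised
    by a node that performs the complementary communication and reports it on a fresh
    actuator.  Used test nodes are inert, so it is enough to relate networks that are
    equivalent beside some inert network and a fresh timer.  Without any location there
    are no nodes, and all networks are bisimilar. *)

Set Implicit Arguments.
Unset Strict Implicit.
Unset Printing Implicit Defensive.

(** * Substitution *)

(** Two obstacles shape the agreement of reductions and transitions. Rule [red_parp] adds components
    [Q i] to products of bare nodes, but the derivation of its premise may regroup nodes and rename
    or move restrictions, so its result is known only up to congruence. The components can be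
    carried along because a congruence acts on the process of each node separately and node names
    are distinct. Besides, the rules for time have negative premises: simulating time steps needs a
    simulation of internal steps in the reverse direction, and a renaming that merges channels may
    stop time.

    In the recognition of labels, a communication is internal and says nothing about the value; the
    value must be turned into an actuation or its absence, so the test for an output compares the
    received value before it reports. An actuation is visible only if it changes a value, which is
    why the timer alternates between two values. Contexts can be added to a contextual relation but
    never removed, so each test must be harmless once used, not only for transitions but also for
    time and for sensor updates. *)

Section Processes.

Variable S : cait_sig.

Implicit Types (P Q R : proc S) (v : value S) (t : term S) (b : guard S).

Lemma eq_map_guard (f g : term S -> term S) b :
  f =1 g -> map_guard f b = map_guard g b.
Proof. by case: b => p ts /= fg; rewrite (eq_map fg). Qed.

Lemma map_guard_comp (f g : term S -> term S) b :
  map_guard f (map_guard g b) = map_guard (f \o g) b.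
Proof. by case: b => p ts /=; rewrite -map_comp. Qed.

Lemma map_guard_comm (f g f' g' : term S -> term S) b :
  (forall t, f (g t) = f' (g' t)) ->
  map_guard f (map_guard g b) = map_guard f' (map_guard g' b).
Proof. by move=> fg; rewrite !map_guard_comp; apply: eq_map_guard. Qed.

Lemma shift_shift_term j k t : j <= k ->
  shift_term j (shift_term k t) = shift_term k.+1 (shift_term j t).
Proof.
case: t => //= i le_jk; congr Var.
by repeat case: ifP => //; lia.
Qed.

Lemma subst_shift_term j k v t : j <= k ->
  subst_term k.+1 v (shift_term j t) = shift_term j (subst_term k v t).
Proof.
case: t => //= i le_jk.
case: (ltngtP i k) => [lt|gt|->] /=.
- by have -> : (if i < j then i else i.+1) < k.+1 by case: ifP; lia.
- have -> : (i < j) = false by lia.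
  have -> : (i.-1 < j) = false by lia.
  have -> : (i.+1 < k.+1) = false by lia.
  have -> : (i.+1 == k.+1) = false by lia.
  by congr Var; lia.
- have -> : (k < j) = false by lia.
  by rewrite ltnn eqxx.
Qed.

Lemma shiftv_shiftv j k P : j <= k ->
  shiftv j (shiftv k P) = shiftv k.+1 (shiftv j P).
Proof.
elim: P j k => //=.
- move=> r P IH j k le_jk.
  case: r => [||s|a t] /=; rewrite ?add0n ?add1n; rewrite IH ?ltnS //.
  by rewrite shift_shift_term.
- by move=> P IP Q IQ j k le_jk; rewrite IP // IQ.
- move=> p P IP Q IQ j k le_jk; rewrite IQ //.
  by case: p => [c t|c] /=; rewrite ?add0n ?add1n IP ?ltnS // shift_shift_term.
- move=> b P IP Q IQ j k le_jk; rewrite IP // IQ //; congr Cond.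
  by apply: map_guard_comm => t; apply: shift_shift_term.
- by move=> P IH j k le_jk; rewrite IH.
Qed.

Lemma shiftv_shiftp j k P : shiftv j (shiftp k P) = shiftp k (shiftv j P).
Proof.
by elim: P j k => //= [r P IH|P IP Q IQ|p P IP Q IQ|b P IP Q IQ|P IH] j k;
  rewrite ?IH ?IP ?IQ.
Qed.

Lemma shiftp_shiftp j k P : j <= k ->
  shiftp j (shiftp k P) = shiftp k.+1 (shiftp j P).
Proof.
elim: P j k => //=.
- by move=> r P IH j k le_jk; rewrite IH.
- by move=> P IP Q IQ j k le_jk; rewrite IP // IQ.
- by move=> p P IP Q IQ j k le_jk; rewrite IP // IQ.
- by move=> b P IP Q IQ j k le_jk; rewrite IP // IQ.
- move=> i j k le_jk; congr PVar.
  by repeat case: ifP => //; lia.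
- by move=> P IH j k le_jk; rewrite IH.
Qed.

Lemma substv_shiftv j k v P : j <= k ->
  substv k.+1 v (shiftv j P) = shiftv j (substv k v P).
Proof.
elim: P j k => //=.
- move=> r P IH j k le_jk.
  case: r => [||s|a t] /=; rewrite ?add0n ?add1n; rewrite IH ?ltnS //.
  by rewrite subst_shift_term.
- by move=> P IP Q IQ j k le_jk; rewrite IP // IQ.
- move=> p P IP Q IQ j k le_jk; rewrite IQ //.
  by case: p => [c t|c] /=; rewrite ?add0n ?add1n IP ?ltnS // subst_shift_term.
- move=> b P IP Q IQ j k le_jk; rewrite IP // IQ //; congr Cond.
  by apply: map_guard_comm => t; apply: subst_shift_term.
- by move=> P IH j k le_jk; rewrite IH.
Qed.

Lemma substv_shiftp j k v P : substv j v (shiftp k P) = shiftp k (substv j v P).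
Proof.
by elim: P j k => //= [r P IH|P IP Q IQ|p P IP Q IQ|b P IP Q IQ|P IH] j k;
  rewrite ?IH ?IP ?IQ.
Qed.

Lemma shiftv_substp k j R P :
  shiftv k (substp j R P) = substp j (shiftv k R) (shiftv k P).
Proof.
elim: P k j R => //=.
- move=> r P IH k j R; congr Pre; rewrite IH.
  by case: r => [||s|a t] //=; rewrite add1n -shiftv_shiftv.
- by move=> P IP Q IQ k j R; rewrite IP IQ.
- move=> p P IP Q IQ k j R; rewrite IP IQ.
  by case: p => [c t|c] //=; rewrite add1n -shiftv_shiftv.
- by move=> b P IP Q IQ k j R; rewrite IP IQ.
- by move=> i k j R; case: ifP => // _; case: ifP.
- by move=> P IH k j R; rewrite IH shiftv_shiftp.
Qed.

Lemma substv_substp k v j R P :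
  substv k v (substp j R P) = substp j (substv k v R) (substv k v P).
Proof.
elim: P k j R => //=.
- move=> r P IH k j R; congr Pre; rewrite IH.
  by case: r => [||s|a t] //=; rewrite add1n substv_shiftv.
- by move=> P IP Q IQ k j R; rewrite IP IQ.
- move=> p P IP Q IQ k j R; rewrite IP IQ.
  by case: p => [c t|c] //=; rewrite add1n substv_shiftv.
- by move=> b P IP Q IQ k j R; rewrite IP IQ.
- by move=> i k j R; case: ifP => // _; case: ifP.
- by move=> P IH k j R; rewrite IH substv_shiftp.
Qed.

Lemma shiftp_iter_shiftv k n P :
  shiftp k (iter n (shiftv 0) P) = iter n (shiftv 0) (shiftp k P).
Proof. by elim: n => //= n IH; rewrite -shiftv_shiftp IH. Qed.

Lemma substp_iter_shiftv k n R P :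
  substp k (iter n (shiftv 0) R) (iter n (shiftv 0) P)
  = iter n (shiftv 0) (substp k R P).
Proof. by elim: n => //= n IH; rewrite -shiftv_substp IH. Qed.

Lemma shiftp_substp j k R P : j <= k ->
  shiftp k (substp j R P) = substp j (shiftp k R) (shiftp k.+1 P).
Proof.
elim: P j k R => //=.
- by move=> r P IH j k R le_jk; rewrite IH // shiftp_iter_shiftv.
- by move=> P IP Q IQ j k R le_jk; rewrite IP // IQ.
- by move=> p P IP Q IQ j k R le_jk; rewrite IP // IQ // shiftp_iter_shiftv.
- by move=> b P IP Q IQ j k R le_jk; rewrite IP // IQ.
- move=> i j k R le_jk; case: (ltngtP i j) => [lt|gt|->] /=.
  + have -> : i < k by lia.
    have -> : i < k.+1 by lia.
    by rewrite lt.
  + case: ifP => lt1.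
    * have -> : i < k.+1 by lia.
      have -> : (i < j) = false by lia.
      by have -> : (i == j) = false by lia.
    * have -> : (i < k.+1) = false by lia.
      have -> : (i.+1 < j) = false by lia.
      have -> : (i.+1 == j) = false by lia.
      by congr PVar; lia.
  + have -> : j < k.+1 by lia.
    by rewrite ltnn eqxx.
- by move=> P IH j k R le_jk; rewrite IH // (shiftp_shiftp R (leq0n k)).
Qed.

Lemma substp_shiftp j R P : substp j R (shiftp j P) = P.
Proof.
elim: P j R => //=.
- by move=> r P IH j R; rewrite IH.
- by move=> P IP Q IQ j R; rewrite IP IQ.
- by move=> p P IP Q IQ j R; rewrite IP IQ.
- by move=> b P IP Q IQ j R; rewrite IP IQ.
- move=> i j R; case: (ltnP i j) => [->//|le_ji].
  have -> : (i.+1 < j) = false by lia.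
  by have -> : (i.+1 == j) = false by lia.
- by move=> P IH j R; rewrite IH.
Qed.

Lemma substp_shiftp_comm j k R P : j <= k ->
  substp k.+1 (shiftp j R) (shiftp j P) = shiftp j (substp k R P).
Proof.
elim: P j k R => //=.
- by move=> r P IH j k R le_jk; rewrite -IH // shiftp_iter_shiftv.
- by move=> P IP Q IQ j k R le_jk; rewrite IP // IQ.
- by move=> p P IP Q IQ j k R le_jk; rewrite -IP // IQ // shiftp_iter_shiftv.
- by move=> b P IP Q IQ j k R le_jk; rewrite IP // IQ.
- move=> i j k R le_jk; case: (ltngtP i k) => [lt|gt|->] /=.
  + have -> : (if i < j then i else i.+1) < k.+1 by case: ifP; lia.
    by [].
  + have -> : (i < j) = false by lia.
    have -> : (i.-1 < j) = false by lia.
    have -> : (i.+1 < k.+1) = false by lia.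
    have -> : (i.+1 == k.+1) = false by lia.
    by congr PVar; lia.
  + have -> : (k < j) = false by lia.
    by rewrite ltnn eqxx.
- by move=> P IH j k R le_jk; rewrite -IH // (shiftp_shiftp R (leq0n j)).
Qed.

(** The substitution lemma for process variables; with [Q] the recursive process itself it shows
    that unfolding commutes with substitution ([substp_unfold]). *)
Lemma substp_substp j k R Q P : j <= k ->
  substp k R (substp j Q P) =
  substp j (substp k R Q) (substp k.+1 (shiftp j R) P).
Proof.
elim: P j k R Q => //=.
- move=> r P IH j k R Q le_jk.
  by rewrite IH // substp_iter_shiftv shiftp_iter_shiftv.
- by move=> P IP P' IP' j k R Q le_jk; rewrite IP // IP'.
- move=> p P IP P' IP' j k R Q le_jk.
  by rewrite IP // IP' // substp_iter_shiftv shiftp_iter_shiftv.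
- by move=> b P IP P' IP' j k R Q le_jk; rewrite IP // IP'.
- move=> i j k R Q le_jk; case: (ltngtP i j) => [lt|gt|->] /=.
  + have -> : i < k.+1 by lia.
    have -> : i < k by lia.
    by rewrite /= lt.
  + case: (ltngtP i k.+1) => [lt1|gt1|->] /=.
    * have -> : i.-1 < k by lia.
      have -> : (i < j) = false by lia.
      by have -> : (i == j) = false by lia.
    * have -> : (i.-1 < k) = false by lia.
      have -> : (i.-1 == k) = false by lia.
      have -> : (i.-1 < j) = false by lia.
      by have -> : (i.-1 == j) = false by lia.
    * by rewrite ltnn eqxx substp_shiftp.
  + have -> : j < k.+1 by lia.
    by rewrite /= ltnn eqxx.
- move=> P IH j k R Q le_jk.
  by rewrite IH // substp_shiftp_comm // (shiftp_shiftp R (leq0n j)).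
Qed.

Lemma shiftv_unfold k P : shiftv k (unfold_fix P) = unfold_fix (shiftv k P).
Proof. exact: shiftv_substp. Qed.

Lemma substv_unfold k v P :
  substv k v (unfold_fix P) = unfold_fix (substv k v P).
Proof. exact: substv_substp. Qed.

Lemma shiftp_unfold k P :
  shiftp k (unfold_fix P) = unfold_fix (shiftp k.+1 P).
Proof. exact: shiftp_substp. Qed.

Lemma substp_unfold k R P :
  substp k R (unfold_fix P) = unfold_fix (substp k.+1 (shiftp 0 R) P).
Proof. exact: substp_substp. Qed.

(** A guard that has a truth value contains no variables, and shifts and substitutions fix values;
    so the guard axioms of [pstruct] survive them. *)
Lemma eval_map_guard (f : term S -> term S) b x :
  (forall v, f (Val v) = Val v) -> eval_guard b = Some x ->
  eval_guard (map_guard f b) = Some x.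
Proof.
move=> fV; case: b => p ts /=.
have eqf : all isSome (map (@eval_term S) ts) -> map f ts = ts.
  by elim: ts => //= -[v|i] ts IH //= /IH ->; rewrite fV.
by case: ifP => // all_ts; rewrite eqf ?all_map // all_ts.
Qed.

Lemma pstruct_shiftv k P P' :
  pstruct P P' -> pstruct (shiftv k P) (shiftv k P').
Proof.
move=> h; elim: h k => /=; intros; try by constructor; auto.
- by apply: ps_true; apply: eval_map_guard.
- by apply: ps_false; apply: eval_map_guard.
- by rewrite shiftv_unfold; constructor.
Qed.

Lemma pstruct_shiftp k P P' :
  pstruct P P' -> pstruct (shiftp k P) (shiftp k P').
Proof.
move=> h; elim: h k => /=; intros; try by constructor; auto.
by rewrite shiftp_unfold; constructor.
Qed.

Lemma pstruct_substv k v P P' :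
  pstruct P P' -> pstruct (substv k v P) (substv k v P').
Proof.
move=> h; elim: h k => /=; intros; try by constructor; auto.
- by apply: ps_true; apply: eval_map_guard.
- by apply: ps_false; apply: eval_map_guard.
- by rewrite substv_unfold; constructor.
Qed.

Lemma pstruct_substp k R P P' :
  pstruct P P' -> pstruct (substp k R P) (substp k R P').
Proof.
move=> h; elim: h k R => /=; intros; try by constructor; auto.
by rewrite substp_unfold; constructor.
Qed.

(** * Well-formed processes *)

(** With [n = m = 0] and [D] the domain of the hosting interface, this is the part of [wf_node] that
    concerns the process; open processes occur in inductions under binders. *)
Definition pwf (D : pred (device S)) n m P : bool :=
  [&& scoped n m P, time_guarded P & all D (devices P)].

Lemma rho_bind_map (f : term S -> term S) r : rho_bind (map_rho f r) = rho_bind r.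
Proof. by case: r. Qed.

Lemma pi_bind_map (f : term S -> term S) p : pi_bind (map_pi f p) = pi_bind p.
Proof. by case: p. Qed.

Lemma scoped_shiftv n m k P : scoped n m P -> scoped n.+1 m (shiftv k P).
Proof.
have st n' k' t : scoped_term n' t -> scoped_term n'.+1 (shift_term k' t).
  by case: t => //= i; case: ifP; lia.
elim: P n m k => //=.
- move=> r P IH n m k /andP[h /IH {}IH]; rewrite rho_bind_map addnS IH andbT.
  by case: r h {IH} => //= a t; apply: st.
- by move=> P IP Q IQ n m k /andP[/IP -> /IQ ->].
- move=> p P IP Q IQ n m k /and3P[h /IP {}IP /IQ ->]; rewrite pi_bind_map addnS.
  by rewrite IP !andbT; case: p h {IP} => //= a t; apply: st.
- case=> p ts P IP Q IQ n m k /and3P[h /IP -> /IQ ->]; rewrite /= !andbT.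
  by rewrite all_map; move: h; apply: sub_all => t; apply: st.
- by move=> P IH n m k; apply: IH.
Qed.

Lemma scoped_shiftp n m k P : scoped n m P -> scoped n m.+1 (shiftp k P).
Proof.
elim: P n m k => //= [r P IH|P IP Q IQ|p P IP Q IQ|[p ts] P IP Q IQ|i|P IH] n m k.
- by move=> /andP[-> /IH ->].
- by move=> /andP[/IP -> /IQ ->].
- by move=> /and3P[-> /IP -> /IQ ->].
- by move=> /and3P[-> /IP -> /IQ ->].
- by case: ifP; lia.
- by move=> /IH ->.
Qed.

Lemma scoped_substv n m k v P : k <= n -> scoped n.+1 m P ->
  scoped n m (substv k v P).
Proof.
have st n' k' t : k' <= n' -> scoped_term n'.+1 t ->
    scoped_term n' (subst_term k' v t).
  by case: t => //= i le; case: (ltngtP i k') => //=; lia.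
elim: P n m k => //=.
- move=> r P IH n m k le /andP[h].
  rewrite rho_bind_map addnS => /IH -> ; last by rewrite leq_add2l.
  by rewrite andbT; case: r h => //= a t; apply: st.
- by move=> P IP Q IQ n m k le /andP[/(IP _ _ _ le) -> /(IQ _ _ _ le) ->].
- move=> p P IP Q IQ n m k le /and3P[h + /(IQ _ _ _ le) ->].
  rewrite pi_bind_map addnS => /IP -> ; last by rewrite leq_add2l.
  by rewrite !andbT; case: p h => //= a t; apply: st.
- case=> p ts P IP Q IQ n m k le /and3P[h /(IP _ _ _ le) -> /(IQ _ _ _ le) ->].
  by rewrite /= !andbT all_map; move: h; apply: sub_all => t; apply: st.
- by move=> P IH n m k; apply: IH.
Qed.

Lemma scoped_substp n m k R P : k <= m -> scoped n m.+1 P -> scoped n m R ->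
  scoped n m (substp k R P).
Proof.
have si n' m' i R' : scoped n' m' R' -> scoped (i + n') m' (iter i (shiftv 0) R').
  by elim: i => //= i IH /IH; rewrite addSn; apply: scoped_shiftv.
elim: P n m k R => //=.
- by move=> r P IH n m k R le /andP[-> sP] sR; rewrite IH //; apply: si.
- by move=> P IP Q IQ n m k R le /andP[sP sQ] sR; rewrite IP ?IQ.
- move=> p P IP Q IQ n m k R le /and3P[-> sP sQ] sR.
  by rewrite IQ // IP //; apply: si.
- by case=> p ts P IP Q IQ n m k R le /and3P[-> sP sQ] sR; rewrite IP ?IQ.
- by move=> i n m k R le lt sR; case: (ltngtP i k) => //=; lia.
- by move=> P IH n m k R le sP sR; apply: IH => //; apply: scoped_shiftp.
Qed.

Lemma var_guarded_shiftv j k P : var_guarded j (shiftv k P) = var_guarded j P.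
Proof.
by elim: P j k => //= [[||s|a t] P IH|P IP Q IQ|b P IP Q IQ] j k;
  rewrite ?IH ?IP ?IQ.
Qed.

Lemma var_guarded_substv j k v P :
  var_guarded j (substv k v P) = var_guarded j P.
Proof.
by elim: P j k => //= [[||s|a t] P IH|P IP Q IQ|b P IP Q IQ] j k;
  rewrite ?IH ?IP ?IQ.
Qed.

Lemma var_guarded_shiftp_eq j P : var_guarded j (shiftp j P).
Proof.
elim: P j => //=.
- by case=> [||s|a t] P IH j //=.
- by move=> P IP Q IQ j; rewrite IP IQ.
- by move=> b P IP Q IQ j; rewrite IP IQ.
- by move=> i j; case: ifP; lia.
Qed.

Lemma var_guarded_shiftp j k P : var_guarded j P -> j < k ->
  var_guarded j (shiftp k P).
Proof.
elim: P j k => //=.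
- by case=> [||s|a t] P IH j k //=; apply: IH.
- by move=> P IP Q IQ j k /andP[/IP hP /IQ hQ] lt; rewrite hP ?hQ.
- by move=> b P IP Q IQ j k /andP[/IP hP /IQ hQ] lt; rewrite hP ?hQ.
- by move=> i j k; case: ifP; lia.
- by move=> P IH j k hP lt; apply: IH.
Qed.

Lemma var_guarded_shiftp_le j k P : var_guarded j P -> k <= j ->
  var_guarded j.+1 (shiftp k P).
Proof.
elim: P j k => //=.
- by case=> [||s|a t] P IH j k //=; apply: IH.
- by move=> P IP Q IQ j k /andP[/IP hP /IQ hQ] lt; rewrite hP ?hQ.
- by move=> b P IP Q IQ j k /andP[/IP hP /IQ hQ] lt; rewrite hP ?hQ.
- by move=> i j k; case: ifP; lia.
- by move=> P IH j k hP lt; apply: IH.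
Qed.

Lemma var_guarded_iter_shiftv j n P :
  var_guarded j (iter n (shiftv 0) P) = var_guarded j P.
Proof. by elim: n => //= n IH; rewrite var_guarded_shiftv. Qed.

Lemma var_guarded_substp j k R P : j < k -> var_guarded j P -> var_guarded j R ->
  var_guarded j (substp k R P).
Proof.
elim: P j k R => //=.
- by case=> [||s|a t] P IH j k R lt hP hR //=; apply: IH;
    rewrite ?var_guarded_shiftv.
- by move=> P IP Q IQ j k R lt /andP[hP hQ] hR; rewrite IP ?IQ.
- by move=> p P IP Q IQ j k R lt hP hR; apply: IP;
    rewrite ?var_guarded_iter_shiftv.
- by move=> b P IP Q IQ j k R lt /andP[hP hQ] hR; rewrite IP ?IQ.
- by move=> i j k R lt hi hR; case: (ltngtP i k) => //=; lia.
- by move=> P IH j k R lt hP hR; apply: IH => //; apply: var_guarded_shiftp_le.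
Qed.

Lemma time_guarded_shiftv k P : time_guarded (shiftv k P) = time_guarded P.
Proof.
by elim: P k => //= [P IP Q IQ|p P IP Q IQ|b P IP Q IQ|P IH] k;
  rewrite ?var_guarded_shiftv ?IH ?IP ?IQ.
Qed.

Lemma time_guarded_substv k v P : time_guarded (substv k v P) = time_guarded P.
Proof.
by elim: P k => //= [P IP Q IQ|p P IP Q IQ|b P IP Q IQ|P IH] k;
  rewrite ?var_guarded_substv ?IH ?IP ?IQ.
Qed.

Lemma time_guarded_shiftp k P : time_guarded P -> time_guarded (shiftp k P).
Proof.
elim: P k => //=.
- by move=> P IP Q IQ k /andP[/IP -> /IQ ->].
- by move=> p P IP Q IQ k /andP[/IP -> /IQ ->].
- by move=> b P IP Q IQ k /andP[/IP -> /IQ ->].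
- by move=> P IH k /andP[h /IH ->]; rewrite var_guarded_shiftp.
Qed.

Lemma time_guarded_substp k R P : time_guarded P -> time_guarded R ->
  time_guarded (substp k R P).
Proof.
have si n R' : time_guarded (iter n (shiftv 0) R') = time_guarded R'.
  by elim: n => //= n IH; rewrite time_guarded_shiftv.
elim: P k R => //=.
- by move=> r P IH k R hP hR; apply: IH; rewrite ?si.
- by move=> P IP Q IQ k R /andP[hP hQ] hR; rewrite IP ?IQ.
- by move=> p P IP Q IQ k R /andP[hP hQ] hR; rewrite IP ?IQ ?si.
- by move=> b P IP Q IQ k R /andP[hP hQ] hR; rewrite IP ?IQ.
- by move=> i k R _ hR; case: ltngtP.
- move=> P IH k R /andP[hg hP] hR.
  (* The substituted process is shifted past index 0, so it brings no new occurrence of the variable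
     bound by this [Fix]. *)
  rewrite var_guarded_substp ?var_guarded_shiftp_eq //=.
  by apply: IH => //; apply: time_guarded_shiftp.
Qed.

Lemma devices_shiftv k P : devices (shiftv k P) = devices P.
Proof.
by elim: P k => //= [[||s|a t] P IH|P IP Q IQ|p P IP Q IQ|b P IP Q IQ] k;
  rewrite ?IH ?IP ?IQ.
Qed.

Lemma devices_substv k v P : devices (substv k v P) = devices P.
Proof.
by elim: P k => //= [[||s|a t] P IH|P IP Q IQ|p P IP Q IQ|b P IP Q IQ] k;
  rewrite ?IH ?IP ?IQ.
Qed.

Lemma devices_shiftp k P : devices (shiftp k P) = devices P.
Proof.
by elim: P k => //= [[||s|a t] P IH|P IP Q IQ|p P IP Q IQ|b P IP Q IQ] k;
  rewrite ?IH ?IP ?IQ.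
Qed.

Lemma all_devices_substp (D : pred (device S)) k R P :
  all D (devices P) -> all D (devices R) -> all D (devices (substp k R P)).
Proof.
have si n R' : devices (iter n (shiftv 0) R') = devices R'.
  by elim: n => //= n IH; rewrite devices_shiftv.
elim: P k R => //=.
- case=> [||s|a t] P IH k R //= hP hR; first by apply: IH.
  + by apply: IH; rewrite ?devices_shiftv.
  + by case/andP: hP => -> hP; apply: IH; rewrite ?devices_shiftv.
  + by case/andP: hP => -> hP; apply: IH; rewrite ?devices_shiftv.
- by move=> P IP Q IQ k R; rewrite !all_cat => /andP[hP hQ] hR; rewrite IP ?IQ.
- move=> p P IP Q IQ k R; rewrite !all_cat => /andP[hP hQ] hR.
  by rewrite IP ?IQ ?si.
- by move=> b P IP Q IQ k R; rewrite !all_cat => /andP[hP hQ] hR; rewrite IP ?IQ.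
- by move=> i k R _ hR; case: ltngtP.
- by move=> P IH k R hP hR; apply: IH => //; rewrite devices_shiftp.
Qed.

Lemma pwf_substp D n m k R P : k <= m -> pwf D n m.+1 P -> pwf D n m R ->
  pwf D n m (substp k R P).
Proof.
move=> le /and3P[sP gP dP] /and3P[sR gR dR]; apply/and3P; split.
- exact: scoped_substp.
- exact: time_guarded_substp.
- exact: all_devices_substp.
Qed.

Lemma pwf_shiftv D n m k R : pwf D n m R -> pwf D n.+1 m (shiftv k R).
Proof.
case/and3P=> sR gR dR; apply/and3P; split.
- exact: scoped_shiftv.
- by rewrite time_guarded_shiftv.
- by rewrite devices_shiftv.
Qed.

Lemma pwf_shiftp D n m k R : pwf D n m R -> pwf D n m.+1 (shiftp k R).
Proof.
case/and3P=> sR gR dR; apply/and3P; split.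
- exact: scoped_shiftp.
- exact: time_guarded_shiftp.
- by rewrite devices_shiftp.
Qed.

Lemma pwf_instv D n m v P : pwf D n.+1 m P -> pwf D n m (instv v P).
Proof.
case/and3P=> sR gR dR; apply/and3P; split.
- exact: scoped_substv.
- by rewrite time_guarded_substv.
- by rewrite devices_substv.
Qed.

Lemma pwf_par D n m P Q : pwf D n m (Par P Q) = pwf D n m P && pwf D n m Q.
Proof.
rewrite /pwf /= all_cat.
by case: (scoped n m P); case: (scoped n m Q); case: (time_guarded P);
  case: (time_guarded Q); case: (all D (devices P)) => //=; rewrite ?andbF.
Qed.

Definition rho_wf (D : pred (device S)) n (r : rho S) :=
  match r with
  | Sigma | GetLoc => true
  | Sense s => D (inl s)
  | Actuate a t => scoped_term n t && D (inr a)
  end.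

Definition pi_wf n (p : pi S) := if p is Send _ t then scoped_term n t else true.

Lemma pwf_pre D n m (r : rho S) P :
  pwf D n m (Pre r P) = rho_wf D n r && pwf D (rho_bind r + n) m P.
Proof.
rewrite /pwf /=; case: r => [||s|a t] //=; first by do ?bool_congr.
by case: (scoped_term n t) => //=; do ?bool_congr.
Qed.

Lemma pwf_timeout D n m (p : pi S) P Q :
  pwf D n m (Timeout p P Q) =
  [&& pi_wf n p, pwf D (pi_bind p + n) m P & pwf D n m Q].
Proof.
rewrite /pwf /= all_cat /pi_wf; set x := (if p is Send _ _ then _ else _).
case: x => //=; case: (scoped n m Q); case: (time_guarded P);
  case: (time_guarded Q); case: (all D (devices P)); case: (scoped _ m P) => //=;
  by rewrite ?andbF.
Qed.

Definition guard_wf n b := let: Guard _ ts := b in all (scoped_term n) ts.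

Lemma pwf_cond D n m b P Q :
  pwf D n m (Cond b P Q) = [&& guard_wf n b, pwf D n m P & pwf D n m Q].
Proof.
rewrite /pwf /=; case: b => p ts /=; rewrite all_cat.
case: (all (scoped_term n) ts) => //=; case: (scoped n m Q); case: (time_guarded P);
  case: (time_guarded Q); case: (all D (devices P)); case: (scoped _ m P) => //=;
  by rewrite ?andbF.
Qed.

Lemma pwf_fix D n m P :
  pwf D n m (Fix P) = var_guarded 0 P && pwf D n m.+1 P.
Proof. by rewrite /pwf /=; case: (var_guarded 0 P) => //=; rewrite andbF. Qed.

Lemma pwf_unfold D n m P : pwf D n m (Fix P) -> pwf D n m (unfold_fix P).
Proof.
by move=> h; apply: pwf_substp => //; move: h; rewrite pwf_fix => /andP[].
Qed.

Lemma pwf_ptrans D l P P' : ptrans l P P' -> pwf D 0 0 P -> pwf D 0 0 P'.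
Proof.
elim=> {l P P'} //.
- by move=> c v P Q; rewrite pwf_timeout => /and3P[].
- by move=> c v P Q; rewrite pwf_timeout => /and3P[_ h _]; apply: pwf_instv.
- by move=> s v P; rewrite pwf_pre => /andP[_ h]; apply: pwf_instv.
- by move=> a v P; rewrite pwf_pre => /andP[].
- by move=> h P; rewrite pwf_pre => /andP[_ ?]; apply: pwf_instv.
- by move=> c v P P' Q Q' _ IP _ IQ _; rewrite !pwf_par => /andP[/IP -> /IQ ->].
- by move=> c v P P' Q Q' _ IP _ IQ _; rewrite !pwf_par => /andP[/IQ -> /IP ->].
- by move=> l P P' Q _ IP; rewrite !pwf_par => /andP[/IP -> ->].
- by move=> l P P' Q _ IP; rewrite !pwf_par => /andP[-> /IP ->].
- by move=> l P Q _ IP /pwf_unfold.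
- by move=> l b P Q P' _ _ IP; rewrite pwf_cond => /and3P[_ ? ?]; apply: IP.
- by move=> l b P Q P' _ _ IP; rewrite pwf_cond => /and3P[_ ? ?]; apply: IP.
Qed.

Lemma pwf_ptrans_sigma D P P' : ptrans_sigma P P' -> pwf D 0 0 P -> pwf D 0 0 P'.
Proof.
elim=> {P P'} //.
- by move=> p P Q; rewrite pwf_timeout => /and3P[].
- by move=> P P' Q Q' _ IP _ IQ _; rewrite !pwf_par => /andP[/IP -> /IQ ->].
- by move=> P Q _ IP /pwf_unfold.
- by move=> b P Q P' _ _ IP; rewrite pwf_cond => /and3P[_ ? ?]; apply: IP.
- by move=> b P Q P' _ _ IP; rewrite pwf_cond => /and3P[_ ? ?]; apply: IP.
Qed.

End Processes.

(** * Chains of congruent processes *)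

Section Congruence.

Variable S : cait_sig.

Implicit Types (P Q R : proc S) (v : value S) (t : term S) (b : guard S).

Lemma rst_map (A B : Type) (f : A -> B) (r : A -> A -> Prop) (r' : B -> B -> Prop) :
  (forall x y, r x y -> clos_refl_sym_trans B r' (f x) (f y)) ->
  forall x y, clos_refl_sym_trans A r x y -> clos_refl_sym_trans B r' (f x) (f y).
Proof.
move=> h x y; elim=> {x y} [x y /h|x|x y _|x y z _ h1 _ h2] //.
- exact: rst_refl.
- exact: rst_sym.
- exact: rst_trans h1 h2.
Qed.

(* Depth of the part of P that is inspected to derive a transition of P: a
   time-guarded variable does not contribute, so unfolding preserves it. *)
Fixpoint wt P : nat :=
  match P with
  | Nil | Pre _ _ | Timeout _ _ _ | PVar _ => 0
  | Par P Q | Cond _ P Q => (maxn (wt P) (wt Q)).+1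
  | Fix P => (wt P).+1
  end.

Lemma wt_substp k R P : var_guarded k P -> wt (substp k R P) = wt P.
Proof.
elim: P k R => //=.
- by move=> P IP Q IQ k R /andP[/IP-> /IQ->].
- by move=> b P IP Q IQ k R /andP[/IP-> /IQ->].
- by move=> i k R; case: ltngtP.
- by move=> P IH k R /IH->.
Qed.

(** Invariant of the intermediate processes of a rewriting. [G] lists the variables of the enclosing
    [Fix] binders, which must stay guarded for the binders to be put back; it is emptied where
    occurrences are time-guarded. The bound on the depth is dropped below a prefix, where no
    transition looks. *)
Definition pok D n m (G : seq nat) (u : bool) w P : bool :=
  [&& pwf D n m P, all (fun j => var_guarded j P) G & u ==> (wt P <= w)].

(* The bound w on wt is in force only when u holds. *)
Definition chain D n m G u w : proc S -> proc S -> Prop :=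
  clos_refl_sym_trans _ (fun P Q =>
    [/\ pok D n m G u w P, pok D n m G u w Q & pstruct P Q]).

Definition pcong D : proc S -> proc S -> Prop :=
  clos_refl_sym_trans _ (fun P Q => [/\ pwf D 0 0 P, pwf D 0 0 Q & pstruct P Q]).

Lemma pok_pre D n m G u w r P :
  pok D n m G u w (Pre r P) =
  rho_wf D n r && pok D (rho_bind r + n) m (if r is Sigma then [::] else G) false 0 P.
Proof.
rewrite /pok pwf_pre /= implybT !andbT.
by case: r => [||s|a t] /=; rewrite ?all_predT ?andbT ?andbA.
Qed.

Lemma pok_timeout D n m G u w p P Q :
  pok D n m G u w (Timeout p P Q) =
  [&& pi_wf n p, pok D (pi_bind p + n) m G false 0 P & pok D n m [::] false 0 Q].
Proof.
rewrite /pok pwf_timeout /= implybT !andbT.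
case: (pi_wf n p) => //=; case: (pwf D _ m P) => //=.
by case: (pwf D n m Q) => //=; rewrite ?andbT ?andbF.
Qed.

Lemma pok_par D n m G (u : bool) w P Q :
  pok D n m G u w (Par P Q) =
  [&& pok D n m G u w.-1 P, pok D n m G u w.-1 Q & u ==> (0 < w)].
Proof.
rewrite /pok pwf_par /=.
have -> : all (fun j => var_guarded j P && var_guarded j Q) G =
          all (fun j => var_guarded j P) G && all (fun j => var_guarded j Q) G.
  by rewrite -all_predI.
have -> : (maxn (wt P) (wt Q) < w) = [&& wt P <= w.-1, wt Q <= w.-1 & 0 < w].
  case: w => [|w] /=; first by rewrite !andbF.
  by rewrite ltnS geq_max andbT.
case: (pwf D n m P); case: (pwf D n m Q); case: (all _ G); case: (all _ G);
 by case: u; case: (wt P <= _); case: (wt Q <= _); case: (0 < w).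
Qed.

Lemma pok_cond D n m G (u : bool) w b P Q :
  pok D n m G u w (Cond b P Q) = guard_wf n b && pok D n m G u w (Par P Q).
Proof. by rewrite /pok pwf_cond pwf_par /= !andbA. Qed.

Lemma pok_fix D n m G (u : bool) w P :
  pok D n m G u w (Fix P) =
  pok D n m.+1 (0 :: map succn G) u w.-1 P && (u ==> (0 < w)).
Proof.
rewrite /pok pwf_fix /= all_map.
have -> : (wt P < w) = (wt P <= w.-1) && (0 < w).
  by case: w => [|w] /=; rewrite ?andbT ?andbF.
case: (pwf D n m.+1 P); case: (var_guarded 0 P); rewrite ?andbF //=.
by rewrite -andbA; congr andb; case: u.
Qed.

Lemma chain_lift D n m G u w D' n' m' G' u' w' (F : proc S -> proc S) P P' :
  (forall Q Q', pstruct Q Q' -> pstruct (F Q) (F Q')) ->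
  (forall Q, pok D n m G u w Q -> pok D' n' m' G' u' w' (F Q)) ->
  chain D n m G u w P P' -> chain D' n' m' G' u' w' (F P) (F P').
Proof.
by move=> sF oF; apply: rst_map => {}P {}P' [hP hP' h]; apply: rst_step; split; auto.
Qed.

(** The indices in [G] lie below [k], hence are not renumbered when [substp k] lowers the variables
    above [k]; being guarded in [R], they stay guarded after the substitution. *)
Definition guards k (G : seq nat) R : bool :=
  all (fun j => (j < k) && var_guarded j R) G.

Lemma guards_shiftp k G R :
  guards k G R -> guards k.+1 (0 :: map succn G) (shiftp 0 R).
Proof.
move=> h; rewrite /guards /= var_guarded_shiftp_eq /= all_map.
move: h; apply: sub_all => j /= /andP[lt hR].
by rewrite ltnS lt var_guarded_shiftp_le.
Qed.

Lemma guards_iter_shiftv k G n R : guards k G (iter n (shiftv 0) R) = guards k G R.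
Proof. by apply: eq_all => j; rewrite var_guarded_iter_shiftv. Qed.

Lemma pwf_iter_shiftv D n m i R :
  pwf D n m R -> pwf D (i + n) m (iter i (shiftv 0) R).
Proof. by elim: i => //= i IH /IH; rewrite addSn; apply: pwf_shiftv. Qed.

Lemma pstruct_iter_shiftv i R R' :
  pstruct R R' -> pstruct (iter i (shiftv 0) R) (iter i (shiftv 0) R').
Proof. by elim: i => //= i IH /IH; apply: pstruct_shiftv. Qed.

Lemma pok_substp D n m k R P (u : bool) w G : k <= m -> pwf D n m R ->
  guards k G R -> pok D n m.+1 G u w P -> (u -> var_guarded k P) ->
  pok D n m G u w (substp k R P).
Proof.
move=> le hR gR /and3P[hP gP wP] kP; apply/and3P; split.
- exact: pwf_substp.
- apply/allP => j jG; have /andP[lt hj] := allP gR j jG.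
  by apply: var_guarded_substp => //; apply: (allP gP).
- by case: u wP kP => //= wP kP; rewrite wt_substp ?kP.
Qed.

(** A single step from [R] to [R'] turns into one step for each occurrence of variable [k] in [P].
    The occurrences are rewritten one after the other, and the invariant must hold for all the mixed
    processes in between; this is why the result is a chain. *)
Lemma chain_substp D n m k R R' P u w G : k <= m ->
  pstruct R R' -> pwf D n m R -> pwf D n m R' -> guards k G R -> guards k G R' ->
  pok D n m.+1 G u w P -> (u -> var_guarded k P) ->
  chain D n m G u w (substp k R P) (substp k R' P).
Proof.
elim: P n m k R R' u w G => /=.
- by move=> *; apply: rst_refl.
- move=> r P IH n m k R R' u w G le h hR hR' gR gR'.
  rewrite pok_pre => /andP[hr hP] _.
  apply: (@chain_lift D (rho_bind r + n) m (if r is Sigma then [::] else G) false 0).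
  + by move=> *; constructor.
  + by move=> Q hQ; rewrite pok_pre hr.
  apply: IH => //; try exact: pwf_iter_shiftv; first exact: pstruct_iter_shiftv.
  + by rewrite guards_iter_shiftv; case: r {hr hP}.
  + by rewrite guards_iter_shiftv; case: r {hr hP}.
- move=> P IP Q IQ n m k R R' u w G le h hR hR' gR gR'.
  rewrite pok_par => /and3P[hP hQ hw] kPQ.
  have kP : u -> var_guarded k P by move/kPQ/andP=> [].
  have kQ : u -> var_guarded k Q by move/kPQ/andP=> [].
  apply: rst_trans (_ : chain _ _ _ _ _ _ _ (Par (substp k R' P) (substp k R Q))) _.
    apply: (chain_lift (F := fun P => Par P (substp k R Q)) _ _
      (IP _ _ _ _ _ _ _ _ le h hR hR' gR gR' hP kP)).
      by move=> *; constructor.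
    by move=> P0 hP0; rewrite pok_par hP0 hw pok_substp.
  apply: (chain_lift (F := Par (substp k R' P)) _ _
    (IQ _ _ _ _ _ _ _ _ le h hR hR' gR gR' hQ kQ)).
    by move=> *; constructor.
  by move=> Q0 hQ0; rewrite pok_par hQ0 hw pok_substp.
- move=> p P IP Q IQ n m k R R' u w G le h hR hR' gR gR'.
  rewrite pok_timeout => /and3P[hp hP hQ] _.
  apply: rst_trans (_ : chain _ _ _ _ _ _ _
     (Timeout p (substp k (iter (pi_bind p) (shiftv 0) R') P) (substp k R Q))) _.
    apply: (@chain_lift D (pi_bind p + n) m G false 0 _ _ _ _ _ _
      (fun P => Timeout p P (substp k R Q))).
    - by move=> *; constructor.
    - by move=> P0 hP0; rewrite pok_timeout hp hP0 pok_substp.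
    apply: IP; rewrite ?guards_iter_shiftv //; try exact: pwf_iter_shiftv.
    exact: pstruct_iter_shiftv.
  apply: (@chain_lift D n m [::] false 0).
  - by move=> *; constructor.
  - move=> Q0 hQ0; rewrite pok_timeout hp hQ0 pok_substp ?guards_iter_shiftv //.
    exact: pwf_iter_shiftv.
  exact: IQ.
- move=> b P IP Q IQ n m k R R' u w G le h hR hR' gR gR'.
  rewrite pok_cond pok_par => /and4P[hb hP hQ hw] kPQ.
  have kP : u -> var_guarded k P by move/kPQ/andP=> [].
  have kQ : u -> var_guarded k Q by move/kPQ/andP=> [].
  apply: rst_trans (_ : chain _ _ _ _ _ _ _ (Cond b (substp k R' P) (substp k R Q))) _.
    apply: (chain_lift (F := fun P => Cond b P (substp k R Q)) _ _
      (IP _ _ _ _ _ _ _ _ le h hR hR' gR gR' hP kP)).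
      by move=> *; constructor.
    by move=> P0 hP0; rewrite pok_cond hb pok_par hP0 hw pok_substp.
  apply: (chain_lift (F := Cond b (substp k R' P)) _ _
    (IQ _ _ _ _ _ _ _ _ le h hR hR' gR gR' hQ kQ)).
    by move=> *; constructor.
  by move=> Q0 hQ0; rewrite pok_cond hb pok_par hQ0 hw pok_substp.
- move=> i n m k R R' u w G le h hR hR' gR gR' _.
  case: ltngtP => [lt|gt|eik] kP; try exact: rst_refl.
  (* With the depth bound in force variable [k] would be guarded, which fails at an occurrence of
     [k] itself; so the bound is off and nothing is asked of the depths of [R] and [R']. *)
  case: u kP => [/(_ isT)//|_].
  have gd R0 : guards k G R0 -> all (fun j => var_guarded j R0) G.
    by apply: sub_all => j /andP[].
  by apply: rst_step; split; rewrite // /pok ?hR ?hR' ?gd.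
- move=> P IH n m k R R' u w G le h hR hR' gR gR'.
  rewrite pok_fix => /andP[hP hw] kP.
  apply: (@chain_lift D n m.+1 (0 :: map succn G) u w.-1).
  + by move=> *; constructor.
  + by move=> P0 hP0; rewrite pok_fix hP0.
  apply: IH => //; try exact: pwf_shiftp;
    try exact: guards_shiftp.
  exact: pstruct_shiftp.
Qed.

(** The unfolding contains the body twice over, as the body and inside the copies of the recursive
    process; the body is rewritten first, then the copies. As the recursion variable is guarded, the
    unfolding is no deeper than the body, which is strictly less deep than the [Fix]; so the bound
    falls from [w.+1] to [w]. *)
Lemma chain_unfold D w P P' :
  pok D 0 0 [::] true w.+1 (Fix P) -> pok D 0 0 [::] true w.+1 (Fix P') ->
  pstruct P P' -> chain D 0 0 [::] true w (unfold_fix P) (unfold_fix P').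
Proof.
move=> hP hP' h.
have := hP; rewrite pok_fix andbT /= => /and3P[oP /andP[gP _] wP].
have := hP'; rewrite pok_fix andbT /= => /and3P[oP' /andP[gP' _] wP'].
have [fP _ _] := and3P hP; have [fP' _ _] := and3P hP'.
apply: rst_trans (_ : chain _ _ _ _ _ _ _ (substp 0 (Fix P) P')) _.
  apply: rst_step; split; last exact: pstruct_substp.
  - by apply: pok_substp => //; apply/and3P.
  - by apply: pok_substp => //; apply/and3P.
apply: chain_substp => //; last by apply/and3P.
by constructor.
Qed.

End Congruence.

(** * Congruent processes have the same transitions *)

Ltac inv H := inversion H; subst; clear H.

Ltac inv_par := match goal with H : ptrans _ (Par _ _) _ |- _ => inv H end.

Section ProcessSimulation.

Variables (S : cait_sig) (D : pred (device S)).

Implicit Types (P Q R : proc S) (v : value S) (b : guard S) (l : plabel S).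

Notation pwf0 := (pwf D 0 0).
Notation "P =p= Q" := (pcong D P Q) (at level 70).

Lemma pcong_refl P : P =p= P. Proof. exact: rst_refl. Qed.
Lemma pcong_sym P Q : P =p= Q -> Q =p= P. Proof. exact: rst_sym. Qed.
Lemma pcong_trans P Q R : P =p= Q -> Q =p= R -> P =p= R.
Proof. exact: rst_trans. Qed.

Lemma pcong_step P Q : pwf0 P -> pwf0 Q -> pstruct P Q -> P =p= Q.
Proof. by move=> *; apply: rst_step. Qed.

Lemma pcong_pwf P Q : P =p= Q -> pwf0 P = pwf0 Q.
Proof.
elim=> {P Q} [P Q [-> -> _]|P|P Q _|P Q R _ -> _] //.
Qed.

Lemma pcong_parl P P' Q : pwf0 Q -> P =p= P' -> Par P Q =p= Par P' Q.
Proof.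
move=> hQ; apply: (rst_map (f := fun P => Par P Q)) => {}P {}P' [hP hP' h].
by apply: rst_step; split; rewrite ?pwf_par ?hP ?hP' //; constructor.
Qed.

Lemma pcong_parr P Q Q' : pwf0 P -> Q =p= Q' -> Par P Q =p= Par P Q'.
Proof.
move=> hP; apply: (rst_map (f := fun Q => Par P Q)) => {}Q {}Q' [hQ hQ' h].
by apply: rst_step; split; rewrite ?pwf_par ?hP ?hQ ?hQ' //; constructor.
Qed.

Lemma pcong_par P P' Q Q' : pwf0 P -> pwf0 Q ->
  P =p= P' -> Q =p= Q' -> Par P Q =p= Par P' Q'.
Proof.
move=> hP hQ hPP' hQQ'; apply: pcong_trans (pcong_parl hQ hPP') _.
by apply: pcong_parr => //; rewrite -(pcong_pwf hPP').
Qed.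

Lemma pcong_comm P Q : pwf0 P -> pwf0 Q -> Par P Q =p= Par Q P.
Proof. by move=> hP hQ; apply: pcong_step; rewrite ?pwf_par ?hP ?hQ //; constructor. Qed.

Lemma pcong_assoc P Q R : pwf0 P -> pwf0 Q -> pwf0 R ->
  Par (Par P Q) R =p= Par P (Par Q R).
Proof.
by move=> hP hQ hR; apply: pcong_step; rewrite ?pwf_par ?hP ?hQ ?hR //; constructor.
Qed.

Lemma pcong_unit P : pwf0 P -> Par P (Nil S) =p= P.
Proof. by move=> hP; apply: pcong_step; rewrite ?pwf_par ?hP //; constructor. Qed.

Definition tsim P Q := forall l P', ptrans l P P' ->
  exists2 Q', ptrans l Q Q' & P' =p= Q'.
Definition ssim P Q := forall P', ptrans_sigma P P' ->
  exists2 Q', ptrans_sigma Q Q' & P' =p= Q'.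
(** The four simulations are proved together: because of its negative premise, a time step of [P] is
    matched by [Q] only if the internal steps of [Q] are matched by [P]. *)
Definition psim P Q := [/\ P =p= Q, tsim P Q, tsim Q P, ssim P Q & ssim Q P].

Lemma psim_refl P : psim P P.
Proof.
by split=> [|l P' h|l P' h|P' h|P' h]; try exists P' => //; apply: pcong_refl.
Qed.

Lemma psim_sym P Q : psim P Q -> psim Q P.
Proof. by case=> e *; split=> //; apply: pcong_sym. Qed.

Lemma tsim_trans P Q R : tsim P Q -> tsim Q R -> tsim P R.
Proof.
move=> h1 h2 l P' /h1[Q' /h2[R' h e'] e].
by exists R' => //; apply: pcong_trans e'.
Qed.

Lemma ssim_trans P Q R : ssim P Q -> ssim Q R -> ssim P R.
Proof.
move=> h1 h2 P' /h1[Q' /h2[R' h e'] e].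
by exists R' => //; apply: pcong_trans e'.
Qed.

Lemma psim_trans P Q R : psim P Q -> psim Q R -> psim P R.
Proof.
move=> [e t1 t2 s1 s2] [e' t1' t2' s1' s2']; split.
- exact: pcong_trans e e'.
- exact: tsim_trans t1 t1'.
- exact: tsim_trans t2' t2.
- exact: ssim_trans s1 s1'.
- exact: ssim_trans s2' s2.
Qed.

Lemma tsim_notau P Q : tsim P Q ->
  ~ (exists R, ptrans (PTau S) Q R) -> ~ (exists R, ptrans (PTau S) P R).
Proof. by move=> h nQ [R /h[R' hR' _]]; apply: nQ; exists R'. Qed.

Lemma sigma_notau P P' : ptrans_sigma P P' -> ~ (exists R, ptrans (PTau S) P R).
Proof.
elim=> {P P'} //.
- by case=> R h; inv h.
- by move=> P [R h]; inv h.
- by move=> p P Q [R h]; inv h.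
- by move=> P Q _ IH [R h]; inv h; apply: IH; exists R.
- by move=> b P Q P' e _ IH [R h]; inv h; [apply: IH; exists R|congruence].
- by move=> b P Q P' e _ IH [R h]; inv h; [congruence|apply: IH; exists R].
Qed.

Lemma tsim_comm P Q : pwf0 P -> pwf0 Q -> tsim (Par P Q) (Par Q P).
Proof.
move=> hP hQ l X h; inv h.
- exists (Par Q' P'); first by apply: pt_comr; eauto.
  by apply: pcong_comm; apply: pwf_ptrans; eauto.
- exists (Par P' Q'); first by apply: pt_coml; eauto.
  by apply: pcong_comm; apply: pwf_ptrans; eauto.
- exists (Par Q P'); first by apply: pt_parr.
  by apply: pcong_comm => //; apply: pwf_ptrans; eauto.
- exists (Par P' P); first by apply: pt_parl.
  by apply: pcong_comm => //; apply: pwf_ptrans; eauto.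
Qed.

Lemma psim_comm P Q : pwf0 P -> pwf0 Q -> psim (Par P Q) (Par Q P).
Proof.
have ss P0 Q0 : pwf0 P0 -> pwf0 Q0 -> ssim (Par P0 Q0) (Par Q0 P0).
  move=> hP hQ X h; inv h; exists (Par Q' P').
    by constructor => //; apply: tsim_notau H4; apply: tsim_comm.
  by apply: pcong_comm; apply: pwf_ptrans_sigma; eauto.
move=> hP hQ.
by split; [apply: pcong_comm|apply: tsim_comm|apply: tsim_comm|apply: ss|apply: ss].
Qed.

Lemma tsim_assocr P Q R : pwf0 P -> pwf0 Q -> pwf0 R ->
  tsim (Par (Par P Q) R) (Par P (Par Q R)).
Proof.
move=> hP hQ hR l X h.
have wf l0 P0 P1 : ptrans l0 P0 P1 -> pwf0 P0 -> pwf0 P1 by apply: pwf_ptrans.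
inv h.
- inv_par; eexists.
  + by eapply pt_coml; [eassumption|apply: pt_parr; eassumption|eassumption].
  + by apply: pcong_assoc; eauto.
  + by apply: pt_parr; eapply pt_coml; eassumption.
  + by apply: pcong_assoc; eauto.
- inv_par; eexists.
  + by eapply pt_comr; [apply: pt_parr; eassumption|eassumption|eassumption].
  + by apply: pcong_assoc; eauto.
  + by apply: pt_parr; eapply pt_comr; eassumption.
  + by apply: pcong_assoc; eauto.
- inv_par; eexists.
  + by eapply pt_coml; [eassumption|apply: pt_parl; eassumption|eassumption].
  + by apply: pcong_assoc; eauto.
  + by eapply pt_comr; [apply: pt_parl; eassumption|eassumption|eassumption].
  + by apply: pcong_assoc; eauto.
  + by apply: pt_parl; eassumption.
  + by apply: pcong_assoc; eauto.
  + by apply: pt_parr; apply: pt_parl; eassumption.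
  + by apply: pcong_assoc; eauto.
- eexists; first by apply: pt_parr; apply: pt_parr; eassumption.
  by apply: pcong_assoc; eauto.
Qed.

Lemma psim_assoc P Q R : pwf0 P -> pwf0 Q -> pwf0 R ->
  psim (Par (Par P Q) R) (Par P (Par Q R)).
Proof.
have par X Y : pwf0 X -> pwf0 Y -> pwf0 (Par X Y) by rewrite pwf_par => -> ->.
(* The reverse direction follows from [tsim_assocr] itself, used twice between three commutations
   that rotate the components. *)
have tl P0 Q0 R0 : pwf0 P0 -> pwf0 Q0 -> pwf0 R0 ->
    tsim (Par P0 (Par Q0 R0)) (Par (Par P0 Q0) R0).
  move=> hP hQ hR.
  apply: tsim_trans (tsim_comm hP (par _ _ hQ hR)) _.
  apply: tsim_trans (tsim_assocr hQ hR hP) _.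
  apply: tsim_trans (tsim_comm hQ (par _ _ hR hP)) _.
  apply: tsim_trans (tsim_assocr hR hP hQ) _.
  exact: tsim_comm hR (par _ _ hP hQ).
have sr P0 Q0 R0 : pwf0 P0 -> pwf0 Q0 -> pwf0 R0 ->
    ssim (Par (Par P0 Q0) R0) (Par P0 (Par Q0 R0)).
  have wf X Y : ptrans_sigma X Y -> pwf0 X -> pwf0 Y by apply: pwf_ptrans_sigma.
  move=> hP hQ hR X h; inv h; inv H1.
  exists (Par P'0 (Par Q'0 Q')); last by apply: pcong_assoc; eauto.
  have nt := tsim_notau (tl _ _ _ hP hQ hR) H4.
  constructor => //; constructor => //.
  by case=> Y hY; apply: nt; eexists; apply: pt_parr hY.
have sc P0 Q0 : pwf0 P0 -> pwf0 Q0 -> ssim (Par P0 Q0) (Par Q0 P0).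
  by move=> hP hQ; case: (psim_comm hP hQ).
move=> hP hQ hR; split.
- exact: pcong_assoc.
- exact: tsim_assocr.
- exact: tl.
- exact: sr.
apply: ssim_trans (sc _ _ hP (par _ _ hQ hR)) _.
apply: ssim_trans (sr _ _ _ hQ hR hP) _.
apply: ssim_trans (sc _ _ hQ (par _ _ hR hP)) _.
apply: ssim_trans (sr _ _ _ hR hP hQ) _.
exact: sc hR (par _ _ hP hQ).
Qed.

Lemma psim_unit P : pwf0 P -> psim (Par P (Nil S)) P.
Proof.
move=> hP.
have t1 : tsim (Par P (Nil S)) P.
  move=> l X h; inv h; try by match goal with H : ptrans _ (Nil S) _ |- _ => inv H end.
  by exists P' => //; apply: pcong_unit; apply: pwf_ptrans; eauto.
split=> // [|l X h|X h|X h]; first exact: pcong_unit.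
- exists (Par X (Nil S)); first by apply: pt_parl.
  by apply: pcong_sym; apply: pcong_unit; apply: pwf_ptrans; eauto.
- inv h; inv H2; exists P' => //.
  by apply: pcong_unit; apply: pwf_ptrans_sigma; eauto.
- exists (Par X (Nil S)).
    constructor => //; first by constructor.
    by apply: tsim_notau t1 _; apply: sigma_notau h.
  by apply: pcong_sym; apply: pcong_unit; apply: pwf_ptrans_sigma; eauto.
Qed.

Lemma psim_fix P : pwf0 (Fix P) -> psim (Fix P) (unfold_fix P).
Proof.
move=> hP; split=> [|l X h|l X h|X h|X h]; try exists X; try exact: pcong_refl.
- by apply: pcong_step; [|apply: pwf_unfold|constructor].
- by inv h.
- by constructor.
- by inv h.
- by constructor.
Qed.

Lemma psim_true b P Q : pwf0 (Cond b P Q) -> eval_guard b = Some true ->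
  psim (Cond b P Q) P.
Proof.
move=> hP e; split=> [|l X h|l X h|X h|X h]; try exists X; try exact: pcong_refl.
- apply: pcong_step => //; last exact: ps_true.
  by move: hP; rewrite pwf_cond => /and3P[].
- by inv h; congruence.
- exact: pt_true.
- by inv h; congruence.
- exact: pts_sigma_true.
Qed.

Lemma psim_false b P Q : pwf0 (Cond b P Q) -> eval_guard b = Some false ->
  psim (Cond b P Q) Q.
Proof.
move=> hP e; split=> [|l X h|l X h|X h|X h]; try exists X; try exact: pcong_refl.
- apply: pcong_step => //; last exact: ps_false.
  by move: hP; rewrite pwf_cond => /and3P[].
- by inv h; congruence.
- exact: pt_false.
- by inv h; congruence.
- exact: pts_sigma_false.
Qed.

Lemma psim_parl P P' Q : pwf0 Q -> psim P P' -> psim (Par P Q) (Par P' Q).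
Proof.
move=> hQ; have tl P0 P1 : P0 =p= P1 -> tsim P0 P1 -> tsim (Par P0 Q) (Par P1 Q).
  move=> e t l X h; inv h.
  - match goal with H : ptrans _ P0 _ |- _ => case: (t _ _ H) => Y hY e' end.
    eexists; first by eapply pt_coml; eassumption.
    by apply: pcong_parl => //; apply: pwf_ptrans; eauto.
  - match goal with H : ptrans _ P0 _ |- _ => case: (t _ _ H) => Y hY e' end.
    eexists; first by eapply pt_comr; eassumption.
    by apply: pcong_parl => //; apply: pwf_ptrans; eauto.
  - match goal with H : ptrans _ P0 _ |- _ => case: (t _ _ H) => Y hY e' end.
    eexists; first by apply: pt_parl; eassumption.
    exact: pcong_parl.
  - eexists; first by apply: pt_parr; eassumption.
    by apply: pcong_parl => //; apply: pwf_ptrans; eauto.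
have sl P0 P1 : P0 =p= P1 -> tsim P1 P0 -> ssim P0 P1 -> ssim (Par P0 Q) (Par P1 Q).
  move=> e t s X h; inv h; case: (s _ H1) => Y hY e'.
  exists (Par Y Q').
    by constructor => //; apply: tsim_notau H4; apply: tl => //; apply: pcong_sym.
  by apply: pcong_parl => //; apply: pwf_ptrans_sigma; eauto.
case=> e t1 t2 s1 s2; have e' := pcong_sym e.
by split; [apply: pcong_parl|apply: tl|apply: tl|apply: sl|apply: sl].
Qed.

Lemma psim_parr P Q Q' : pwf0 P -> pwf0 Q -> pwf0 Q' ->
  psim Q Q' -> psim (Par P Q) (Par P Q').
Proof.
move=> hP hQ hQ' h; apply: psim_trans (psim_comm hP hQ) _.
by apply: psim_trans (psim_parl hP h) _; apply: psim_comm.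
Qed.

Lemma eval_closed b : guard_wf 0 b -> exists x, eval_guard b = Some x.
Proof.
case: b => p ts /= h; exists (p (pmap (@eval_term S) ts)).
by have -> : all (fun t => eval_term t) ts by apply: sub_all h => -[].
Qed.

Lemma psim_cond b P P' Q Q' : pwf0 (Cond b P Q) -> pwf0 (Cond b P' Q') ->
  psim P P' -> psim Q Q' -> psim (Cond b P Q) (Cond b P' Q').
Proof.
move=> hC hC' sP sQ; have := hC; rewrite pwf_cond => /andP[/eval_closed[[] e] _].
  apply: psim_trans (psim_true hC e) _; apply: psim_trans sP _.
  exact: psim_sym (psim_true hC' e).
apply: psim_trans (psim_false hC e) _; apply: psim_trans sQ _.
exact: psim_sym (psim_false hC' e).
Qed.

Lemma pcong_instv v P P' : pwf D 1 0 P -> pwf D 1 0 P' -> pstruct P P' ->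
  instv v P =p= instv v P'.
Proof.
by move=> hP hP' h; apply: pcong_step; rewrite ?pwf_instv //; apply: pstruct_substv.
Qed.

(** A transition of a prefix exposes the continuation without looking into it, so congruence of the
    continuations is enough and no simulation between them is required. *)
Lemma psim_pre r P P' : pwf0 (Pre r P) -> pwf0 (Pre r P') -> pstruct P P' ->
  psim (Pre r P) (Pre r P').
Proof.
move=> hP hP' h; have := hP; have := hP'; rewrite !pwf_pre.
move=> /andP[_ oP'] /andP[_ oP].
split; first by apply: pcong_step => //; constructor.
- move=> l X hX; inv hX; (eexists; first by constructor); try exact: pcong_instv.
  exact: pcong_step.
- move=> l X hX; inv hX; (eexists; first by constructor);
    try by apply: pcong_sym; apply: pcong_instv.
  by apply: pcong_sym; apply: pcong_step.
- by move=> X hX; inv hX; (eexists; first by constructor); apply: pcong_step.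
- move=> X hX; inv hX; (eexists; first by constructor).
  by apply: pcong_sym; apply: pcong_step.
Qed.

Lemma psim_timeoutl p P P' Q : pwf0 (Timeout p P Q) -> pwf0 (Timeout p P' Q) ->
  pstruct P P' -> psim (Timeout p P Q) (Timeout p P' Q).
Proof.
move=> hP hP' h; have := hP; have := hP'; rewrite !pwf_timeout.
move=> /and3P[_ oP' _] /and3P[_ oP _].
split; first by apply: pcong_step => //; constructor.
- move=> l X hX; inv hX; (eexists; first by constructor); try exact: pcong_instv.
  exact: pcong_step.
- move=> l X hX; inv hX; (eexists; first by constructor);
    try by apply: pcong_sym; apply: pcong_instv.
  by apply: pcong_sym; apply: pcong_step.
- by move=> X hX; inv hX; (eexists; first by constructor); apply: pcong_refl.
- by move=> X hX; inv hX; (eexists; first by constructor); apply: pcong_refl.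
Qed.

Lemma psim_timeoutr p P Q Q' : pwf0 (Timeout p P Q) -> pwf0 (Timeout p P Q') ->
  pstruct Q Q' -> psim (Timeout p P Q) (Timeout p P Q').
Proof.
move=> hP hP' h; have := hP; have := hP'; rewrite !pwf_timeout.
move=> /and3P[_ _ oP'] /and3P[_ _ oP].
split; first by apply: pcong_step => //; constructor.
- by move=> l X hX; inv hX; (eexists; first by constructor); apply: pcong_refl.
- by move=> l X hX; inv hX; (eexists; first by constructor); apply: pcong_refl.
- by move=> X hX; inv hX; (eexists; first by constructor); apply: pcong_step.
- move=> X hX; inv hX; (eexists; first by constructor).
  by apply: pcong_sym; apply: pcong_step.
Qed.

(** Induction on the bound for the inspected depth, not on the derivation: for a step below [Fix],
    the hypothesis is applied to the steps of the chain between the two unfoldings, which are not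
    subderivations but have smaller depth. *)
Lemma psim_step w P Q : pok D 0 0 [::] true w P -> pok D 0 0 [::] true w Q ->
  pstruct P Q -> psim P Q.
Proof.
elim: w P Q => [|w IH] P Q hP hQ h.
  (* At bound 0 only steps inside a prefix or a timeout remain; in all other cases one side is a
     [Par], [Cond] or [Fix], whose depth is positive. *)
  move: hP hQ; case: h => //=; intros; try by rewrite /pok /= ?andbF in hP, hQ.
  - by case/and3P: hP => hP _ _; case/and3P: hQ => hQ _ _; apply: psim_pre.
  - by case/and3P: hP => hP _ _; case/and3P: hQ => hQ _ _; apply: psim_timeoutl.
  - by case/and3P: hP => hP _ _; case/and3P: hQ => hQ _ _; apply: psim_timeoutr.
have wP : pwf0 P by case/and3P: hP.
have wQ : pwf0 Q by case/and3P: hQ.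
case: h hP hQ wP wQ => {P Q}.
- by move=> P Q _ _; rewrite !pwf_par => /andP[? ?] _; apply: psim_comm.
- move=> P Q R _ _; rewrite !pwf_par => /andP[/andP[? ?] ?] _.
  exact: psim_assoc.
- by move=> P _ _ _ ?; apply: psim_unit.
- by move=> b P Q e _ _ wP _; apply: psim_true.
- by move=> b P Q e _ _ wP _; apply: psim_false.
- by move=> P _ _ ? _; apply: psim_fix.
- by move=> r P P' h _ _ wP wQ; apply: psim_pre.
- move=> P P' Q h; rewrite !pok_par !pwf_par => /and3P[hP _ _] /and3P[hP' _ _].
  by move=> /andP[_ wQ] _; apply: psim_parl => //; apply: IH.
- move=> P P' Q h; rewrite !pok_par !pwf_par => /and3P[_ hP _] /and3P[_ hP' _].
  by move=> /andP[wQ wP] /andP[_ wP']; apply: psim_parr => //; apply: IH.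
- by move=> p P P' Q h _ _ wP wQ; apply: psim_timeoutl.
- by move=> p P P' Q h _ _ wP wQ; apply: psim_timeoutr.
- move=> b P P' Q h; rewrite !pok_cond !pok_par => /and4P[_ hP _ _] /and4P[_ hP' _ _].
  by move=> wQ wQ'; apply: psim_cond => //; [apply: IH|apply: psim_refl].
- move=> b P P' Q h; rewrite !pok_cond !pok_par => /and4P[_ _ hP _] /and4P[_ _ hP' _].
  by move=> wQ wQ'; apply: psim_cond => //; [apply: psim_refl|apply: IH].
- move=> P P' h hP hP' wP wP'.
  apply: psim_trans (psim_fix wP) _; apply: psim_sym.
  apply: psim_trans (psim_fix wP') _; apply: psim_sym.
  elim: (chain_unfold hP hP' h) => {wP wP' hP hP' h P P'}.
  + by move=> P P' [hP hP' h]; apply: IH.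
  + by move=> P; apply: psim_refl.
  + by move=> P P' _; apply: psim_sym.
  + by move=> P Q R _ + _; apply: psim_trans.
Qed.

Theorem pcong_psim P Q : P =p= Q -> psim P Q.
Proof.
elim=> {P Q} [P Q [hP hQ h]|P|P Q _|P Q R _ + _]; last exact: psim_trans.
- apply: (@psim_step (maxn (wt P) (wt Q))) => //; apply/and3P; split=> //.
  + by rewrite leq_maxl.
  + by rewrite leq_maxr.
- exact: psim_refl.
- exact: psim_sym.
Qed.

End ProcessSimulation.

(** * Normal forms and channel renaming *)

Section NormalForms.

Variables (S : cait_sig) (D : pred (device S)).

Implicit Types (P Q R : proc S) (v : value S) (b : guard S) (l : plabel S).

Notation pwf0 := (pwf D 0 0).
Notation "P =p= Q" := (pcong D P Q) (at level 70).

Definition prefixed P :=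
  match P with Pre _ _ | Timeout _ _ _ => true | _ => false end.

Lemma head_out c v P C : prefixed P -> ptrans (POut c v) P C ->
  exists B, P = Timeout (Send c (Val v)) C B.
Proof. by case: P => //= [r P|p P Q] _ t; inv t; exists Q. Qed.

Lemma head_in c v P C : prefixed P -> ptrans (PIn c v) P C ->
  exists A B, P = Timeout (Recv c) A B /\ C = instv v A.
Proof. by case: P => //= [r P|p P Q] _ t; inv t; exists P, Q. Qed.

Lemma pcong_shuffle P Q P' Q' : pwf0 P -> pwf0 Q -> pwf0 P' -> pwf0 Q' ->
  Par (Par P Q) (Par P' Q') =p= Par (Par P P') (Par Q Q').
Proof.
move=> wP wQ wP' wQ'.
have wp X Y : pwf0 X -> pwf0 Y -> pwf0 (Par X Y) by rewrite pwf_par => -> ->.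
apply: pcong_trans (pcong_assoc wP wQ (wp _ _ wP' wQ')) _.
apply: pcong_sym; apply: pcong_trans (pcong_assoc wP wP' (wp _ _ wQ wQ')) _.
apply: pcong_parr => //.
apply: pcong_trans (pcong_sym (pcong_assoc wP' wQ wQ')) _.
apply: pcong_trans (pcong_parl wQ' (pcong_comm wP' wQ)) _.
exact: pcong_assoc.
Qed.

(** The shape of the left-hand sides of the reduction axioms: two partners side by side for a local
    communication, a single prefix otherwise. [ptrans_redex] brings every transition into this shape
    beside an untouched rest, as [red_parp] requires. *)
Definition redex l P C : Prop :=
  match l with
  | PTau => exists c v A B A' B',
      [/\ rng c = Local,
          P = Par (Timeout (Send c (Val v)) A B) (Timeout (Recv c) A' B') &
          C = Par A (instv v A')]
  | _ => prefixed P /\ ptrans l P C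
  end.

Lemma pcong_unfold P : pwf0 (Fix P) -> Fix P =p= unfold_fix P.
Proof. by move=> w; apply: pcong_step; [|apply: pwf_unfold|constructor]. Qed.

Lemma pcong_cond b x P Q : eval_guard b = Some x -> pwf0 (Cond b P Q) ->
  Cond b P Q =p= (if x then P else Q) /\ pwf0 (if x then P else Q).
Proof.
move=> e w; have := w; rewrite pwf_cond => /and3P[_ wP wQ].
by case: x e => e; split=> //; apply: pcong_step; try constructor.
Qed.

Lemma ptrans_redex l P P' : ptrans l P P' -> pwf0 P ->
  exists H C Q, [/\ redex l H C, P =p= Par H Q & P' =p= Par C Q].
Proof.
have base l0 H C : redex l0 H C -> ptrans l0 H C -> pwf0 H ->
    exists H0 C0 Q, [/\ redex l0 H0 C0, H =p= Par H0 Q & C =p= Par C0 Q].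
  move=> rH tH wH; exists H, C, (Nil S); split=> //.
    by apply: pcong_sym; apply: pcong_unit.
  by apply: pcong_sym; apply: pcong_unit; apply: pwf_ptrans tH wH.
have com c v P0 P0' Q0 Q0' : rng c = Local ->
    ptrans (POut c v) P0 P0' -> ptrans (PIn c v) Q0 Q0' -> pwf0 P0 -> pwf0 Q0 ->
    (exists H C Q, [/\ redex (POut c v) H C, P0 =p= Par H Q & P0' =p= Par C Q]) ->
    (exists H C Q, [/\ redex (PIn c v) H C, Q0 =p= Par H Q & Q0' =p= Par C Q]) ->
    exists H C Q, [/\ redex (PTau S) H C, Par P0 Q0 =p= Par H Q &
                      Par P0' Q0' =p= Par C Q].
  move=> rc tP tQ wP wQ [H [C [R [[pH tH] e e']]]] [H1 [C1 [R1 [[pH1 tH1] e1 e1']]]].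
  have wP' := pwf_ptrans tP wP; have wQ' := pwf_ptrans tQ wQ.
  have := wP; have := wQ; have := wP'; have := wQ'.
  rewrite (pcong_pwf e) (pcong_pwf e') (pcong_pwf e1) (pcong_pwf e1') !pwf_par.
  move=> /andP[wC1 _] /andP[wC _] /andP[wH1 wR1] /andP[wH wR].
  have [B EH] := head_out pH tH; have [A1 [B1 [EH1 EC1]]] := head_in pH1 tH1.
  exists (Par H H1), (Par C C1), (Par R R1); split.
  - by subst; exists c, v, C, B, A1, B1.
  - by apply: pcong_trans (pcong_par wP wQ e e1) _; apply: pcong_shuffle.
  - by apply: pcong_trans (pcong_par wP' wQ' e' e1') _; apply: pcong_shuffle.
have par l0 P0 P0' Q0 : ptrans l0 P0 P0' -> pwf0 P0 -> pwf0 Q0 ->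
    (exists H C Q, [/\ redex l0 H C, P0 =p= Par H Q & P0' =p= Par C Q]) ->
    exists H C Q, [/\ redex l0 H C, Par P0 Q0 =p= Par H Q & Par P0' Q0 =p= Par C Q].
  move=> t wP wQ [H [C [R [rH e e']]]].
  have := wP; have := pwf_ptrans t wP; rewrite (pcong_pwf e) (pcong_pwf e') !pwf_par.
  move=> /andP[wC _] /andP[wH wR].
  exists H, C, (Par R Q0); split=> //.
  - by apply: pcong_trans (pcong_parl wQ e) _; apply: pcong_assoc.
  - by apply: pcong_trans (pcong_parl wQ e') _; apply: pcong_assoc.
have swap l0 P0 P0' Q0 Q0' : pwf0 P0 -> pwf0 P0' -> pwf0 Q0 -> pwf0 Q0' ->
    (exists H C Q, [/\ redex l0 H C, Par P0 Q0 =p= Par H Q & Par P0' Q0' =p= Par C Q]) ->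
    exists H C Q, [/\ redex l0 H C, Par Q0 P0 =p= Par H Q & Par Q0' P0' =p= Par C Q].
  move=> wP wP' wQ wQ' [H [C [R [rH e e']]]]; exists H, C, R; split=> //.
  - exact: pcong_trans (pcong_comm wQ wP) e.
  - exact: pcong_trans (pcong_comm wQ' wP') e'.
elim=> {l P P'}.
- by move=> c v P Q w; apply: base => //; [split|]; constructor.
- by move=> c v P Q w; apply: base => //; [split|]; constructor.
- by move=> s v P w; apply: base => //; [split|]; constructor.
- by move=> a v P w; apply: base => //; [split|]; constructor.
- by move=> h P w; apply: base => //; [split|]; constructor.
- move=> c v P P' Q Q' tP IP tQ IQ rc; rewrite pwf_par => /andP[wP wQ].
  exact: com rc tP tQ wP wQ (IP wP) (IQ wQ).
- move=> c v P P' Q Q' tP IP tQ IQ rc; rewrite pwf_par => /andP[wQ wP].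
  have wP' := pwf_ptrans tP wP; have wQ' := pwf_ptrans tQ wQ.
  exact: swap wP wP' wQ wQ' (com _ _ _ _ _ _ rc tP tQ wP wQ (IP wP) (IQ wQ)).
- move=> l P P' Q t IH; rewrite pwf_par => /andP[wP wQ].
  exact: par t wP wQ (IH wP).
- move=> l P P' Q t IH; rewrite pwf_par => /andP[wQ wP].
  by apply: swap => //; [apply: pwf_ptrans t wP|apply: par t wP wQ (IH wP)].
- move=> l P Q t IH w; have [H [C [R [rH e e']]]] := IH (pwf_unfold w).
  by exists H, C, R; split=> //; apply: pcong_trans (pcong_unfold w) e.
- move=> l b P Q P' eb t IH w; have [e0 wP] := pcong_cond eb w.
  have [H [C [R [rH e e']]]] := IH wP.
  by exists H, C, R; split=> //; apply: pcong_trans e0 e.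
- move=> l b P Q P' eb t IH w; have [e0 wP] := pcong_cond eb w.
  have [H [C [R [rH e e']]]] := IH wP.
  by exists H, C, R; split=> //; apply: pcong_trans e0 e.
Qed.

(** * Normal form of the processes that let time pass *)

Definition pars (T : Type) (F : T -> proc S) (s : seq T) : proc S :=
  \big[@Par S/Nil S]_(r <- s) F r.

Lemma pars_cat (T : Type) (F : T -> proc S) s1 s2 :
  pwf0 (pars F s1) -> pwf0 (pars F s2) ->
  Par (pars F s1) (pars F s2) =p= pars F (s1 ++ s2) /\ pwf0 (pars F (s1 ++ s2)).
Proof.
rewrite /pars; elim: s1 => [|x s1 IH] /=.
  rewrite big_nil => w1 w2; split=> //.
  by apply: pcong_trans (pcong_comm _ _) _ => //; apply: pcong_unit.
rewrite !big_cons !pwf_par => /andP[wx w1] w2; have [e w] := IH w1 w2.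
rewrite wx; split=> //.
apply: pcong_trans (pcong_assoc _ _ _) _ => //.
exact: pcong_parr.
Qed.

Lemma pars_nil (T : Type) (F : T -> proc S) : pars F [::] = Nil S.
Proof. exact: big_nil. Qed.

Lemma pars_seq1 (T : Type) (F : T -> proc S) x : pars F [:: x] = Par (F x) (Nil S).
Proof. by rewrite /pars big_cons big_nil. Qed.

(** The components are sorted into timeouts and delays, the form demanded by [red_timestat] and
    [red_timemob]; unfolding and evaluation of guards are absorbed by the congruence, and [Nil] is
    an empty product. *)
Lemma sigma_normal P P' : ptrans_sigma P P' -> pwf0 P ->
  exists ts rs,
    P =p= Par (pars (fun x => Timeout x.1.1 x.1.2 x.2) ts)
              (pars (Pre (Sigma S)) rs) /\
    P' =p= Par (pars (fun x => x.2) ts) (pars id rs).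
Proof.
elim=> {P P'}.
- move=> _; exists [::], [::]; rewrite !pars_nil.
  by split; apply: pcong_sym; apply: pcong_unit.
- move=> P w; exists [::], [:: P]; rewrite !pars_nil !pars_seq1.
  have wP : pwf0 P by move: w; rewrite pwf_pre.
  split; apply: pcong_sym; (apply: pcong_trans (pcong_comm _ _) _; rewrite ?pwf_par ?w ?wP //).
  + by apply: pcong_trans (pcong_unit _) (pcong_unit _); rewrite ?pwf_par ?w.
  + by apply: pcong_trans (pcong_unit _) (pcong_unit _); rewrite ?pwf_par ?wP.
- move=> p P Q w; exists [:: (p, P, Q)], [::]; rewrite !pars_nil !pars_seq1 /=.
  have wQ : pwf0 Q by move: w; rewrite pwf_timeout => /and3P[].
  split; apply: pcong_sym.
  + by apply: pcong_trans (pcong_unit _) (pcong_unit _); rewrite ?pwf_par ?w.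
  + by apply: pcong_trans (pcong_unit _) (pcong_unit _); rewrite ?pwf_par ?wQ.
- move=> P P' Q Q' sP IP sQ IQ _; rewrite pwf_par => /andP[wP wQ].
  have [ts [rs [e e']]] := IP wP; have [ts1 [rs1 [e1 e1']]] := IQ wQ.
  have wP' := pwf_ptrans_sigma sP wP; have wQ' := pwf_ptrans_sigma sQ wQ.
  exists (ts ++ ts1), (rs ++ rs1).
  have := wP; have := wQ; have := wP'; have := wQ'.
  rewrite (pcong_pwf e) (pcong_pwf e') (pcong_pwf e1) (pcong_pwf e1') !pwf_par.
  move=> /andP[w1 w2] /andP[w3 w4] /andP[w5 w6] /andP[w7 w8].
  split.
  + apply: pcong_trans (pcong_par wP wQ e e1) _.
    apply: pcong_trans (pcong_shuffle _ _ _ _) _ => //.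
    have [f wf] := pars_cat w7 w5; have [g wg] := pars_cat w8 w6.
    by apply: pcong_par => //; rewrite (pcong_pwf f, pcong_pwf g).
  + apply: pcong_trans (pcong_par wP' wQ' e' e1') _.
    apply: pcong_trans (pcong_shuffle _ _ _ _) _ => //.
    have [f wf] := pars_cat w3 w1; have [g wg] := pars_cat w4 w2.
    by apply: pcong_par => //; rewrite (pcong_pwf f, pcong_pwf g).
- move=> P Q t IH w; have [ts [rs [e e']]] := IH (pwf_unfold w).
  by exists ts, rs; split=> //; apply: pcong_trans (pcong_unfold w) e.
- move=> b P Q P' eb t IH w; have [e0 wP] := pcong_cond eb w.
  have [ts [rs [e e']]] := IH wP.
  by exists ts, rs; split=> //; apply: pcong_trans e0 e.
- move=> b P Q P' eb t IH w; have [e0 wP] := pcong_cond eb w.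
  have [ts [rs [e e']]] := IH wP.
  by exists ts, rs; split=> //; apply: pcong_trans e0 e.
Qed.

Lemma sigma_waiting P P' : ptrans_sigma P P' -> pwf0 P ->
  exists k m (p : 'I_k -> pi S) (A B : 'I_k -> proc S) (C : 'I_m -> proc S),
    P =p= waiting p A B C /\ P' =p= elapsed B C.
Proof.
move=> t w; have [ts [rs [e e']]] := sigma_normal t w.
exists (size ts), (size rs), (fun i => (tnth (in_tuple ts) i).1.1),
  (fun i => (tnth (in_tuple ts) i).1.2), (fun i => (tnth (in_tuple ts) i).2),
  (fun i => tnth (in_tuple rs) i).
by move: e e'; rewrite /pars /waiting /elapsed !(big_tnth _ _ ts) !(big_tnth _ _ rs).
Qed.

Lemma waiting_elapsed k m (p : 'I_k -> pi S) (A B : 'I_k -> proc S)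
    (C : 'I_m -> proc S) :
  ~ (exists R, ptrans (PTau S) (waiting p A B C) R) ->
  ptrans_sigma (waiting p A B C) (elapsed B C).
Proof.
have big n (F F' : 'I_n -> proc S) : (forall i, ptrans_sigma (F i) (F' i)) ->
    ~ (exists R, ptrans (PTau S) (\big[@Par S/Nil S]_(i < n) F i) R) ->
    ptrans_sigma (\big[@Par S/Nil S]_(i < n) F i) (\big[@Par S/Nil S]_(i < n) F' i).
  elim: n F F' => [|n IH] F F' h; first by rewrite !big_ord0 => _; constructor.
  rewrite !big_ord_recl => nt; constructor => //; apply: IH => //.
  by case=> R hR; apply: nt; eexists; apply: pt_parr hR.
move=> nt; constructor => //; apply: big => [i|]; try by constructor.
- by case=> R hR; apply: nt; eexists; apply: pt_parl hR.
- by case=> R hR; apply: nt; eexists; apply: pt_parr hR.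
Qed.

End NormalForms.

(** * Renaming of channels in processes *)

Section ChannelMaps.

Variable S : cait_sig.

Implicit Types (P Q R : proc S) (v : value S) (b : guard S) (l : plabel S).
Implicit Types (f g : chan S -> chan S) (c d : chan S).

Definition mapc_pi f (p : pi S) : pi S :=
  match p with Send c t => Send (f c) t | Recv c => Recv (f c) end.

(** Renaming by an arbitrary function rather than by one pair of names: the renamings met along a
    nest of restrictions then compose to a single one. *)
Fixpoint mapc f P : proc S :=
  match P with
  | Nil => Nil S
  | Pre r P => Pre r (mapc f P)
  | Par P Q => Par (mapc f P) (mapc f Q)
  | Timeout p P Q => Timeout (mapc_pi f p) (mapc f P) (mapc f Q)
  | Cond b P Q => Cond b (mapc f P) (mapc f Q)
  | PVar i => PVar S i
  | Fix P => Fix (mapc f P)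
  end.

Definition mapc_label f l : plabel S :=
  match l with
  | POut c v => POut (f c) v
  | PIn c v => PIn (f c) v
  | _ => l
  end.

Lemma ren_procE c d P : ren_proc c d P = mapc (ren_chan c d) P.
Proof.
by elim: P => //= [r P ->|P -> Q ->|[c' t|c'] P -> Q ->|b P -> Q ->|P ->].
Qed.

Lemma eq_in_mapc f g P : {in pchans P, f =1 g} -> mapc f P = mapc g P.
Proof.
elim: P => //=.
- by move=> r P IH h; rewrite IH.
- by move=> P IP Q IQ h; rewrite IP ?IQ // => c hc; apply: h; rewrite mem_cat hc ?orbT.
- move=> p P IP Q IQ h.
  rewrite IP ?IQ; try by move=> c hc; apply: h; rewrite inE mem_cat hc ?orbT.
  by case: p h => [c t|c] h /=; rewrite h ?mem_head.
- by move=> b P IP Q IQ h; rewrite IP ?IQ // => c hc; apply: h; rewrite mem_cat hc ?orbT.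
- by move=> P IH h; rewrite IH.
Qed.

Lemma mapc_id P : mapc id P = P.
Proof. by elim: P => //= [r P ->|P -> Q ->|[c t|c] P -> Q ->|b P -> Q ->|P ->]. Qed.

Lemma mapc_comp f g P : mapc f (mapc g P) = mapc (f \o g) P.
Proof. by elim: P => //= [r P ->|P -> Q ->|[c t|c] P -> Q ->|b P -> Q ->|P ->]. Qed.

Lemma pchans_mapc f P : pchans (mapc f P) = map f (pchans P).
Proof.
elim: P => //= [P -> Q ->|p P -> Q ->|b P -> Q ->]; rewrite ?map_cat //.
by case: p.
Qed.

Lemma shiftv_mapc f k P : shiftv k (mapc f P) = mapc f (shiftv k P).
Proof.
elim: P k => //= [r P IH k|P IP Q IQ k|[c t|c] P IP Q IQ k|b P IP Q IQ k|P IH k];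
  by rewrite ?IH ?IP ?IQ.
Qed.

Lemma shiftp_mapc f k P : shiftp k (mapc f P) = mapc f (shiftp k P).
Proof.
elim: P k => //= [r P IH k|P IP Q IQ k|[c t|c] P IP Q IQ k|b P IP Q IQ k|P IH k];
  by rewrite ?IH ?IP ?IQ.
Qed.

Lemma substv_mapc f k v P : substv k v (mapc f P) = mapc f (substv k v P).
Proof.
elim: P k => //= [r P IH k|P IP Q IQ k|[c t|c] P IP Q IQ k|b P IP Q IQ k|P IH k];
  by rewrite ?IH ?IP ?IQ.
Qed.

Lemma substp_mapc f k R P :
  substp k (mapc f R) (mapc f P) = mapc f (substp k R P).
Proof.
have it n R0 : iter n (shiftv 0) (mapc f R0) = mapc f (iter n (shiftv 0) R0).
  by elim: n => //= n ->; rewrite shiftv_mapc.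
elim: P k R => //=.
- by move=> r P IH k R; rewrite it IH.
- by move=> P IP Q IQ k R; rewrite IP IQ.
- by move=> p P IP Q IQ k R; case: p => [c t|c] /=; rewrite ?shiftv_mapc IP IQ.
- by move=> b P IP Q IQ k R; rewrite IP IQ.
- by move=> i k R; case: ifP => // _; case: ifP.
- by move=> P IH k R; rewrite shiftp_mapc IH.
Qed.

Lemma unfold_mapc f P : unfold_fix (mapc f P) = mapc f (unfold_fix P).
Proof. exact: (substp_mapc f 0 (Fix P) P). Qed.

Lemma pwf_mapc f D n m P : pwf D n m (mapc f P) = pwf D n m P.
Proof.
have sc n0 m0 : scoped n0 m0 (mapc f P) = scoped n0 m0 P.
  elim: P n0 m0 => //= [r P IH|P IP Q IQ|[c t|c] P IP Q IQ|[p ts] P IP Q IQ] n0 m0;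
  by rewrite ?IH ?IP ?IQ.
have tg : time_guarded (mapc f P) = time_guarded P.
  have vg' Q k : var_guarded k (mapc f Q) = var_guarded k Q.
    elim: Q k => //= [[||s|a t] Q IH k|P0 IP Q IQ k|b P0 IP Q IQ k] //;
    by rewrite ?IP ?IQ.
  by elim: P {sc} => //= [P -> Q ->|p P -> Q ->|b P -> Q ->|P ->] //; rewrite vg'.
have dv : devices (mapc f P) = devices P.
  elim: P {sc tg} => //= [[||s|a t] P -> |P -> Q ->|p P -> Q ->|b P -> Q ->] //.
by rewrite /pwf sc tg dv.
Qed.

Lemma pstruct_mapc f P P' : pstruct P P' -> pstruct (mapc f P) (mapc f P').
Proof.
elim=> {P P'} /=; intros; try by constructor.
by rewrite -unfold_mapc; constructor.
Qed.

Lemma pcong_mapc f D P P' : pcong D P P' -> pcong D (mapc f P) (mapc f P').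
Proof.
apply: rst_map => {}P {}P' [hP hP' h].
by apply: pcong_step; rewrite ?pwf_mapc //; apply: pstruct_mapc.
Qed.

(** Merging channels can only add communications, so every range-preserving map carries transitions
    forward. Carrying them back is possible for fresh renamings, see [ptrans_ren_inv]. *)
Lemma ptrans_mapc f l P P' : (forall c, rng (f c) = rng c) ->
  ptrans l P P' -> ptrans (mapc_label f l) (mapc f P) (mapc f P').
Proof.
move=> fr; elim=> {l P P'} /=.
- by move=> *; constructor.
- by move=> *; rewrite /instv -substv_mapc; constructor.
- by move=> *; rewrite /instv -substv_mapc; constructor.
- by move=> *; constructor.
- by move=> *; rewrite /instv -substv_mapc; constructor.
- by move=> c v P P' Q Q' _ IP _ IQ rc; apply: pt_coml IP IQ _; rewrite fr.
- by move=> c v P P' Q Q' _ IP _ IQ rc; apply: pt_comr IP IQ _; rewrite fr.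
- by move=> *; apply: pt_parl.
- by move=> *; apply: pt_parr.
- by move=> l P Q _; rewrite -unfold_mapc; constructor.
- by move=> *; apply: pt_true.
- by move=> *; apply: pt_false.
Qed.

Lemma pchans_substv k v P : pchans (substv k v P) = pchans P.
Proof.
elim: P k => //= [P IP Q IQ k|[c t|c] P IP Q IQ k|b P IP Q IQ k];
by rewrite ?IP ?IQ.
Qed.

Lemma pchans_shiftv k P : pchans (shiftv k P) = pchans P.
Proof.
elim: P k => //= [P IP Q IQ k|[c t|c] P IP Q IQ k|b P IP Q IQ k];
by rewrite ?IP ?IQ.
Qed.

Lemma pchans_shiftp k P : pchans (shiftp k P) = pchans P.
Proof.
elim: P k => //= [P IP Q IQ k|[c t|c] P IP Q IQ k|b P IP Q IQ k];
by rewrite ?IP ?IQ.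
Qed.

Lemma pchans_substp k R P :
  {subset pchans (substp k R P) <= pchans P ++ pchans R}.
Proof.
have it n R0 : pchans (iter n (shiftv 0) R0) = pchans R0.
  by elim: n => //= n IH; rewrite pchans_shiftv.
move=> c; elim: P k R => //=.
- by move=> r P IH k R /IH; rewrite it.
- by move=> P IP Q IQ k R; rewrite !mem_cat => /orP[/IP|/IQ];
    rewrite mem_cat => /orP[] -> ; rewrite ?orbT.
- move=> p P IP Q IQ k R; rewrite !(inE, mem_cat) => /or3P[->|/IP|/IQ] //;
    by rewrite mem_cat ?it => /orP[] ->; rewrite ?orbT.
- by move=> b P IP Q IQ k R; rewrite !mem_cat => /orP[/IP|/IQ];
    rewrite mem_cat => /orP[] -> ; rewrite ?orbT.
- by move=> i k R; case: ltngtP.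
- by move=> P IH k R /IH; rewrite pchans_shiftp.
Qed.

Lemma pchans_unfold P : {subset pchans (unfold_fix P) <= pchans P}.
Proof. by move=> c /pchans_substp; rewrite mem_cat orbb. Qed.

Lemma pchans_ptrans l P P' : ptrans l P P' -> {subset pchans P' <= pchans P}.
Proof.
elim=> {l P P'} /=.
- by move=> c v P Q d hd; rewrite !(inE, mem_cat) hd orbT.
- by move=> c v P Q d; rewrite pchans_substv => hd; rewrite !(inE, mem_cat) hd orbT.
- by move=> s v P d; rewrite pchans_substv.
- by move=> a v P d.
- by move=> s P d; rewrite pchans_substv.
- move=> c v P P' Q Q' _ IP _ IQ _ d; rewrite !mem_cat.
  by move=> /orP[/IP|/IQ] ->; rewrite ?orbT.
- move=> c v P P' Q Q' _ IP _ IQ _ d; rewrite !mem_cat.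
  by move=> /orP[/IQ|/IP] ->; rewrite ?orbT.
- by move=> l P P' Q _ IP d; rewrite !mem_cat => /orP[/IP|] ->; rewrite ?orbT.
- by move=> l P P' Q _ IP d; rewrite !mem_cat => /orP[|/IP] ->; rewrite ?orbT.
- by move=> l P Q _ IP d /IP /pchans_unfold.
- by move=> l b P Q P' _ _ IP d /IP; rewrite mem_cat => ->.
- by move=> l b P Q P' _ _ IP d /IP; rewrite mem_cat orbC => ->.
Qed.

Lemma pchans_sigma P P' : ptrans_sigma P P' -> {subset pchans P' <= pchans P}.
Proof.
elim=> {P P'} //=.
- by move=> P d.
- by move=> p P Q d hd; rewrite !(inE, mem_cat) hd !orbT.
- move=> P P' Q Q' _ IP _ IQ _ d; rewrite !mem_cat.
  by move=> /orP[/IP|/IQ] ->; rewrite ?orbT.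
- by move=> P Q _ IP d /IP /pchans_unfold.
- by move=> b P Q P' _ _ IP d /IP; rewrite mem_cat => ->.
- by move=> b P Q P' _ _ IP d /IP; rewrite mem_cat orbC => ->.
Qed.

Definition plabel_chan l : seq (chan S) :=
  match l with POut c _ | PIn c _ => [:: c] | _ => [::] end.

Lemma plabel_chan_sub l P P' : ptrans l P P' -> {subset plabel_chan l <= pchans P}.
Proof.
elim=> {l P P'} //=.
- by move=> c v P Q d; rewrite inE => /eqP ->; rewrite mem_head.
- by move=> c v P Q d; rewrite inE => /eqP ->; rewrite mem_head.
- by move=> l P P' Q _ IP d /IP; rewrite mem_cat => ->.
- by move=> l P P' Q _ IP d /IP; rewrite mem_cat orbC => ->.
- by move=> l P Q _ IP d /IP /pchans_unfold.
- by move=> l b P Q P' _ _ IP d /IP; rewrite mem_cat => ->.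
- by move=> l b P Q P' _ _ IP d /IP; rewrite mem_cat orbC => ->.
Qed.

Lemma rng_ren_chan c d : rng d = rng c -> forall e, rng (ren_chan c d e) = rng e.
Proof. by rewrite /ren_chan => h e; case: eqP => [->|]. Qed.

Lemma ren_chanK c d e : e != d -> ren_chan d c (ren_chan c d e) = e.
Proof.
rewrite /ren_chan; case: (eqVneq e c) => [-> _|ne /negbTE ->] //.
by rewrite eqxx.
Qed.

Lemma ren_procK c d P : d \notin pchans P -> ren_proc d c (ren_proc c d P) = P.
Proof.
move=> dP; rewrite !ren_procE mapc_comp -[RHS]mapc_id.
apply: eq_in_mapc => e eP /=; rewrite ren_chanK //.
by apply: contraNneq dP => <-.
Qed.

Lemma notin_ren_proc c d P : d \notin pchans P -> c \notin pchans (ren_proc c d P).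
Proof.
move=> dP; rewrite ren_procE pchans_mapc; apply/mapP=> -[e eP].
rewrite /ren_chan; case: (eqVneq e c) => [ec cd|ne ec].
  by move: dP; rewrite -cd -ec eP.
by rewrite ec eqxx in ne.
Qed.

Lemma ptrans_ren c d l P P' : rng d = rng c -> ptrans l P P' ->
  ptrans (mapc_label (ren_chan c d) l) (ren_proc c d P) (ren_proc c d P').
Proof. by move=> h; rewrite !ren_procE; apply: ptrans_mapc; apply: rng_ren_chan. Qed.

(** Renaming to a fresh name is undone by renaming back, so a transition of the renamed process is
    reflected by carrying it forward along the inverse renaming. *)
Lemma ptrans_ren_inv c d l P X : d \notin pchans P -> rng d = rng c ->
  ptrans l (ren_proc c d P) X ->
  exists l' P', [/\ l = mapc_label (ren_chan c d) l', X = ren_proc c d P' &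
                    ptrans l' P P'].
Proof.
move=> dP r t; have cP := notin_ren_proc c dP.
exists (mapc_label (ren_chan d c) l), (ren_proc d c X); split.
- have := plabel_chan_sub t; case: l {t} => //= e v /(_ e (mem_head _ _)) he;
    by rewrite ren_chanK //; apply/eqP => E; case/negP: cP; rewrite -{1}E.
- rewrite ren_procK //; apply: contra cP; exact: pchans_ptrans t _.
- by have := ptrans_ren (esym r) t; rewrite ren_procK.
Qed.

Lemma notau_ren c d P : d \notin pchans P -> rng d = rng c ->
  ~ (exists R, ptrans (PTau S) P R) -> ~ (exists R, ptrans (PTau S) (ren_proc c d P) R).
Proof.
move=> dP r n [R /(ptrans_ren_inv dP r)[l [P' [E _ t]]]].
by case: l E t => // _ t; apply: n; exists P'.
Qed.

(** Freshness of [d] protects the negative premise: merging two channels could enable a local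
    communication, which would stop time. *)
Lemma sigma_ren c d P P' : rng d = rng c -> ptrans_sigma P P' -> d \notin pchans P ->
  ptrans_sigma (ren_proc c d P) (ren_proc c d P').
Proof.
move=> r; elim=> {P P'} /=; try by move=> *; constructor.
- move=> P P' Q Q' _ IP _ IQ n; rewrite mem_cat => /norP[dP dQ].
  constructor; [exact: IP|exact: IQ|].
  by apply: (@notau_ren c d (Par P Q)) => //=; rewrite mem_cat negb_or dP.
- move=> P Q _ IP dP; constructor.
  move: IP; rewrite !ren_procE unfold_mapc; apply.
  by apply: contra dP; apply: pchans_unfold.
- move=> b P Q P' e _ IP; rewrite mem_cat => /norP[dP _].
  by apply: pts_sigma_true => //; apply: IP.
- move=> b P Q P' e _ IP; rewrite mem_cat => /norP[_ dP].
  by apply: pts_sigma_false => //; apply: IP.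
Qed.

Lemma sigma_ren_inv c d P X : d \notin pchans P -> rng d = rng c ->
  ptrans_sigma (ren_proc c d P) X ->
  exists2 P', X = ren_proc c d P' & ptrans_sigma P P'.
Proof.
move=> dP r t; have cP := notin_ren_proc c dP.
exists (ren_proc d c X).
- rewrite ren_procK //; apply: contra cP; exact: pchans_sigma t _.
- by have := sigma_ren (esym r) t cP; rewrite ren_procK.
Qed.

End ChannelMaps.

(** * Well-formed networks *)

Section Networks.

Variable S : cait_sig.

Implicit Types (P Q R : proc S) (v : value S) (c d e : chan S).
Implicit Types (M N O : net S) (J : interface S) (l : nlabel S).

Notation key := (node S * {fset (sensor S + actuator S)%type})%type.

(** All that the conditions of [wf] relating different nodes depend on. Transitions keep this list,
    and congruences keep it as a set. *)
Fixpoint nkeys M : seq key :=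
  match M with
  | Zero => [::]
  | Node n J _ _ _ => [:: (n, domf J)]
  | NPar M N => nkeys M ++ nkeys N
  | Res _ M => nkeys M
  end.

Definition key_disj (x y : key) : bool :=
  (x.1 != y.1) && all (fun k => exclusive k ==> (k \notin y.2)) (enum_fset x.2).

Definition dom_ok (F : {fset (sensor S + actuator S)%type}) (mu : mobility) : bool :=
  if mu is Stationary then true else
    all (fun k => if k is inl s then ~~ loc_dependent s else true) (enum_fset F).

Notation pwfd F := (pwf (fun k => k \in F) 0 0).

Fixpoint procs_ok M : bool :=
  match M with
  | Zero => true
  | Node _ J P mu _ => pwfd (domf J) P && dom_ok (domf J) mu
  | NPar M N => procs_ok M && procs_ok N
  | Res _ M => procs_ok M
  end.

Lemma key_disj_sym : symmetric key_disj.
Proof.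
suff h x y : key_disj x y -> key_disj y x by move=> x y; apply/idP/idP; apply: h.
case/andP=> ne /allP dx; rewrite /key_disj eq_sym ne /=; apply/allP=> k ky.
apply/implyP=> ek; apply/negP=> kx.
by have := dx k kx; rewrite ek ky.
Qed.

(** Separates the conditions on single nodes from those between nodes; a transition affects the
    former only through the node that moves, and leaves the latter literally unchanged. *)
Lemma wfE M : wf M = procs_ok M && pairwise key_disj (nkeys M).
Proof.
rewrite /wf; congr andb.
  elim: M => //= [n J P mu h|M IM N IN]; last by rewrite all_cat IM IN.
  by rewrite andbT /pwf /dom_ok /= -!andbA; case: mu.
have -> : [seq x.1.1.1 | x <- nodes M] = map fst (nkeys M).
  by elim: M => //= M IM N IN; rewrite !map_cat IM IN.
rewrite uniq_pairwise pairwise_map.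
have -> : pairwise (@disjoint_devices S) (nodes M) = pairwise
   (fun x y : key => all (fun k => exclusive k ==> (k \notin y.2)) (enum_fset x.2))
   (nkeys M).
  have : nkeys M = [seq (x.1.1.1, domf x.1.1.2) | x <- nodes M].
    by elim: M => //= M IM N IN; rewrite !map_cat IM IN.
  by move=> ->; rewrite pairwise_map; apply: eq_pairwise => -[[[n J] P] mu] [[[]]].
elim: (nkeys M) => //= x s IH; rewrite -IH /key_disj.
rewrite [X in _ = X && _]all_predI.
by case: (all _ s); case: (all _ s); case: (pairwise _ s); case: (pairwise _ s).
Qed.

Lemma wf_par M N :
  wf (NPar M N) = [&& wf M, wf N & allrel key_disj (nkeys M) (nkeys N)].
Proof.
rewrite !wfE /= pairwise_cat.
by case: (procs_ok M); case: (procs_ok N); case: (pairwise _ (nkeys M));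
  case: (pairwise _ (nkeys N)) => //=; rewrite ?andbT ?andbF.
Qed.

Lemma wf_res c M : wf (Res c M) = wf M.
Proof. by rewrite !wfE. Qed.

Lemma wf_node1 n J P mu h :
  wf (Node n J P mu h) = pwfd (domf J) P && dom_ok (domf J) mu.
Proof. by rewrite wfE /= !andbT. Qed.

Lemma nkeys_ren c d M : nkeys (ren_net c d M) = nkeys M.
Proof. by elim: M => //= [M -> N ->|e M IH] //; case: ifP => //= _. Qed.

Lemma procs_ok_ren c d M : procs_ok (ren_net c d M) = procs_ok M.
Proof.
elim: M => //= [n J P mu h|M -> N ->|e M IH] //; last by case: ifP => //= _.
by rewrite ren_procE pwf_mapc.
Qed.

Lemma wf_ren c d M : wf (ren_net c d M) = wf M.
Proof. by rewrite !wfE nkeys_ren procs_ok_ren. Qed.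

Lemma allrel_key_disjC (s t : seq key) :
  allrel key_disj s t = allrel key_disj t s.
Proof.
by rewrite allrelC; apply: eq_allrel => x y; rewrite key_disj_sym.
Qed.

Lemma nkeys_nstruct M N : nstruct M N -> nkeys M =i nkeys N.
Proof.
elim=> {M N} //=.
- by move=> M N x; rewrite !mem_cat orbC.
- by move=> M N O x; rewrite catA.
- by move=> M x; rewrite cats0.
- by move=> c d M _ _ x; rewrite nkeys_ren.
- by move=> M M' N _ IH x; rewrite !mem_cat IH.
- by move=> M M' N _ IH x; rewrite !mem_cat IH.
Qed.

Lemma scong_keys M N : scong M N -> nkeys M =i nkeys N.
Proof.
elim=> {M N} [M N [_ _ /nkeys_nstruct]|M|M N _ IH x|M N O _ h1 _ h2 x] //.
by rewrite h1.
Qed.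

Lemma scong_wf M N : scong M N -> wf M = wf N.
Proof. by elim=> {M N} [M N [-> -> _]|M|M N _ ->|M N O _ -> _ ->]. Qed.

Lemma scong_refl M : scong M M. Proof. exact: rst_refl. Qed.
Lemma scong_sym M N : scong M N -> scong N M. Proof. exact: rst_sym. Qed.
Lemma scong_trans N M O : scong M N -> scong N O -> scong M O.
Proof. exact: rst_trans. Qed.
Lemma scong_step M N : wf M -> wf N -> nstruct M N -> scong M N.
Proof. by move=> *; apply: rst_step. Qed.

(** Lets a chain of congruence steps be carried into a parallel context, where each intermediate
    network has to be well-formed again. *)
Lemma scong_wf_parl M N O : scong M N -> wf (NPar M O) = wf (NPar N O).
Proof.
move=> h; rewrite !wf_par (scong_wf h); congr andb; congr andb.
by apply: eq_allrel_meml; apply: scong_keys.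
Qed.

Lemma scong_parl O M N : wf (NPar M O) -> scong M N -> scong (NPar M O) (NPar N O).
Proof.
move=> + h; elim: h => {M N}.
- move=> M N [wM wN h] w; apply: scong_step => //; last by constructor.
  by rewrite -(@scong_wf_parl M) //; apply: scong_step.
- by move=> *; apply: scong_refl.
- move=> M N h IH w; apply: scong_sym; apply: IH.
  by rewrite (scong_wf_parl _ h).
- move=> M N N' h1 IH1 h2 IH2 w; apply: scong_trans (IH1 w) (IH2 _).
  by rewrite -(scong_wf_parl _ h1).
Qed.

Lemma wf_parC M N : wf (NPar M N) = wf (NPar N M).
Proof. by rewrite !wf_par allrel_key_disjC; case: (wf M); case: (wf N). Qed.

Lemma scong_comm M N : wf (NPar M N) -> scong (NPar M N) (NPar N M).
Proof. by move=> w; apply: scong_step; rewrite // 1?wf_parC //; constructor. Qed.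

Lemma scong_parr O M N : wf (NPar O M) -> scong M N -> scong (NPar O M) (NPar O N).
Proof.
move=> w h; apply: scong_trans (scong_comm w) _.
have w' : wf (NPar M O) by rewrite wf_parC.
apply: scong_trans (scong_parl w' h) _; apply: scong_comm.
by rewrite -(scong_wf_parl _ h).
Qed.

Lemma scong_par M M' N N' : wf (NPar M N) -> scong M M' -> scong N N' ->
  scong (NPar M N) (NPar M' N').
Proof.
move=> w h h'; apply: scong_trans (scong_parl w h) _.
by apply: scong_parr => //; rewrite -(scong_wf_parl _ h).
Qed.

Lemma wf_parA M N O : wf (NPar (NPar M N) O) = wf (NPar M (NPar N O)).
Proof.
rewrite !wf_par /= allrel_catl allrel_catr.
case: (wf M); case: (wf N); case: (wf O); rewrite ?andbF //=.
by case: (allrel _ (nkeys M) (nkeys N)) => //=; rewrite andbC //= andbC.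
Qed.

Lemma scong_assoc M N O : wf (NPar (NPar M N) O) ->
  scong (NPar (NPar M N) O) (NPar M (NPar N O)).
Proof. by move=> w; apply: scong_step; rewrite -?wf_parA //; constructor. Qed.

Lemma wf_par0 M : wf (NPar M (Zero S)) = wf M.
Proof. by rewrite wf_par /= allrel0r !andbT. Qed.

Lemma scong_unit M : wf M -> scong (NPar M (Zero S)) M.
Proof. by move=> w; apply: scong_step; rewrite ?wf_par0 //; constructor. Qed.

Lemma scong_res c M N : scong M N -> scong (Res c M) (Res c N).
Proof.
apply: (rst_map (f := Res c)) => {}M {}N [wM wN h].
by apply: rst_step; split=> //; constructor.
Qed.

Lemma scong_node n J P P' mu h : dom_ok (domf J) mu ->
  pcong (fun k => k \in domf J) P P' ->
  scong (Node n J P mu h) (Node n J P' mu h).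
Proof.
move=> dj; apply: (rst_map (f := fun P => Node n J P mu h)) => {}P {}P' [wP wP' e].
by apply: scong_step; rewrite ?wf_node1 ?wP ?wP' ?dj //; constructor.
Qed.

Lemma scong_alpha c d M : wf M -> d \notin nchans M -> rng d = rng c ->
  scong (Res c M) (Res d (ren_net c d M)).
Proof.
by move=> w dM r; apply: scong_step; rewrite ?wf_res ?wf_ren //; constructor.
Qed.

Lemma scong_extrude c M N : wf (NPar M N) -> c \notin free_chans M ->
  scong (Res c (NPar M N)) (NPar M (Res c N)).
Proof.
move=> w dM; apply: scong_step; last by constructor.
  by rewrite wf_res.
by move: w; rewrite !wf_par wf_res.
Qed.

(** * Preservation of well-formedness by transitions *)

Lemma actuate_dev D a v P P' : ptrans (PActuate a v) P P' -> pwf D 0 0 P -> D (inr a).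
Proof.
move E : (PActuate a v) => lb t; elim: t E => {lb P P'} //.
- by move=> a' v' P [-> _]; rewrite pwf_pre => /andP[/andP[]].
- by move=> lb P P' Q _ IH E; rewrite pwf_par => /andP[/IH h _]; apply: h.
- by move=> lb P P' Q _ IH E; rewrite pwf_par => /andP[_ /IH h]; apply: h.
- by move=> lb P Q _ IH E /pwf_unfold /IH h; apply: h.
- by move=> lb b P Q P' _ _ IH E; rewrite pwf_cond => /and3P[_ /IH h _]; apply: h.
- by move=> lb b P Q P' _ _ IH E; rewrite pwf_cond => /and3P[_ _ /IH h]; apply: h.
Qed.

(** A well-formed node mentions only actuators of its own interface, so the write replaces a value
    and does not extend the interface. *)
Lemma domf_set_act J a v P P' : ptrans (PActuate a v) P P' -> pwfd (domf J) P ->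
  domf J.[inr a <- v]%fmap = domf J.
Proof. by move=> t w; rewrite dom_setf mem_fset1U //; apply: actuate_dev t w. Qed.

Lemma ntrans_ok l M M' : ntrans l M M' -> procs_ok M ->
  procs_ok M' /\ nkeys M' = nkeys M.
Proof.
elim=> {l M M'} /=; try by
  intros; match goal with
    H : is_true (_ && _), T : ptrans _ _ _ |- _ =>
      case/andP: H => w ->; rewrite (pwf_ptrans T w) end.
- move=> n J a v P P' mu h _ t /andP[w dj].
  have := domf_set_act t w => /= ->; rewrite dj.
  by rewrite (pwf_ptrans t w).
- by move=> c v h k M M' N N' _ IM _ IN _ /andP[/IM[-> ->] /IN[-> ->]].
- by move=> c v h k M M' N N' _ IM _ IN _ /andP[/IN[-> ->] /IM[-> ->]].
- by move=> l M M' N _ IM /andP[/IM[-> ->] ->].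
- by move=> l M M' N _ IM /andP[-> /IM[-> ->]].
- by move=> l c M M' _ IM _ /IM.
Qed.

Lemma ntrans_wf l M M' : ntrans l M M' -> wf M -> wf M'.
Proof.
by move=> t; rewrite !wfE => /andP[/(ntrans_ok t)[-> ->] ->].
Qed.

Lemma ntrans_keys l M M' : ntrans l M M' -> wf M -> nkeys M' = nkeys M.
Proof. by move=> t; rewrite !wfE => /andP[/(ntrans_ok t)[_ ->]]. Qed.

Lemma sigma_ok M M' : ntrans_sigma M M' -> procs_ok M ->
  procs_ok M' /\ nkeys M' = nkeys M.
Proof.
elim=> {M M'} //=.
- by move=> n J P P' h t _ /andP[w _]; rewrite (pwf_ptrans_sigma t w).
- by move=> n J P P' h k t _ _ /andP[w ->]; rewrite (pwf_ptrans_sigma t w).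
- by move=> M M' N N' _ IM _ IN _ /andP[/IM[-> ->] /IN[-> ->]].
Qed.

Lemma sigma_wf M M' : ntrans_sigma M M' -> wf M -> wf M'.
Proof. by move=> t; rewrite !wfE => /andP[/(sigma_ok t)[-> ->] ->]. Qed.

(** * Channels of labels and of targets of transitions *)

Definition nlabel_chan l : seq (chan S) :=
  match l with NOut c _ _ | NIn c _ _ => [:: c] | _ => [::] end.

Lemma on_chanE c l : on_chan c l = (c \in nlabel_chan l).
Proof. by case: l => //= *; rewrite inE eq_sym. Qed.

Lemma nlabel_chan_sub l M M' : ntrans l M M' -> {subset nlabel_chan l <= free_chans M}.
Proof.
elim=> {l M M'} //=.
- by move=> n J c v P P' mu h t _ d hd; apply: plabel_chan_sub t _ hd.
- by move=> n J c v P P' mu h t _ d hd; apply: plabel_chan_sub t _ hd.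
- by move=> l M M' N _ IM d /IM; rewrite mem_cat => ->.
- by move=> l M M' N _ IM d /IM; rewrite mem_cat orbC => ->.
- move=> l c M M' _ IM; rewrite on_chanE => cl d dl; rewrite mem_filter IM // andbT.
  by apply: contraNneq cl => <-.
Qed.

Lemma free_chans_ntrans l M M' : ntrans l M M' ->
  {subset free_chans M' <= free_chans M}.
Proof.
elim=> {l M M'} /=; try by intros; move=> x; eapply pchans_ptrans; eassumption.
- move=> c v h k M M' N N' _ IM _ IN _ d; rewrite !mem_cat.
  by move=> /orP[/IM|/IN] ->; rewrite ?orbT.
- move=> c v h k M M' N N' _ IM _ IN _ d; rewrite !mem_cat.
  by move=> /orP[/IN|/IM] ->; rewrite ?orbT.
- by move=> l M M' N _ IM d; rewrite !mem_cat => /orP[/IM|] ->; rewrite ?orbT.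
- by move=> l M M' N _ IM d; rewrite !mem_cat => /orP[|/IM] ->; rewrite ?orbT.
- by move=> l c M M' _ IM _ d; rewrite !mem_filter => /andP[-> /IM].
Qed.

Lemma free_chans_sigma M M' : ntrans_sigma M M' ->
  {subset free_chans M' <= free_chans M}.
Proof.
elim=> {M M'} //=; try by intros; move=> x; eapply pchans_sigma; eassumption.
- move=> M M' N N' _ IM _ IN _ d; rewrite !mem_cat.
  by move=> /orP[/IM|/IN] ->; rewrite ?orbT.
- by move=> c M M' _ IM d; rewrite !mem_filter => /andP[-> /IM].
Qed.

Lemma nchans_ntrans l M M' : ntrans l M M' -> {subset nchans M' <= nchans M}.
Proof.
elim=> {l M M'} /=; try by intros; move=> x; eapply pchans_ptrans; eassumption.
- move=> c v h k M M' N N' _ IM _ IN _ d; rewrite !mem_cat.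
  by move=> /orP[/IM|/IN] ->; rewrite ?orbT.
- move=> c v h k M M' N N' _ IM _ IN _ d; rewrite !mem_cat.
  by move=> /orP[/IN|/IM] ->; rewrite ?orbT.
- by move=> l M M' N _ IM d; rewrite !mem_cat => /orP[/IM|] ->; rewrite ?orbT.
- by move=> l M M' N _ IM d; rewrite !mem_cat => /orP[|/IM] ->; rewrite ?orbT.
- by move=> l c M M' _ IM _ d; rewrite !inE => /orP[->|/IM ->] //; rewrite orbT.
Qed.

Lemma nchans_sigma M M' : ntrans_sigma M M' -> {subset nchans M' <= nchans M}.
Proof.
elim=> {M M'} //=; try by intros; move=> x; eapply pchans_sigma; eassumption.
- move=> M M' N N' _ IM _ IN _ d; rewrite !mem_cat.
  by move=> /orP[/IM|/IN] ->; rewrite ?orbT.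
- by move=> c M M' _ IM d; rewrite !inE => /orP[->|/IM ->] //; rewrite orbT.
Qed.

Lemma free_chans_nchans M : {subset free_chans M <= nchans M}.
Proof.
elim: M => //= [n J P mu h c|M IM N IN c|c M IM d] //.
  by rewrite !mem_cat => /orP[/IM|/IN] ->; rewrite ?orbT.
by rewrite mem_filter inE => /andP[_ /IM ->]; rewrite orbT.
Qed.

End Networks.

(** * Congruent networks have the same transitions *)

Section NetworkSimulation.

Variable S : cait_sig.

Implicit Types (P Q R : proc S) (v : value S) (c d e : chan S).
Implicit Types (M N O X : net S) (J : interface S) (l : nlabel S).

Definition mapc_nlabel (f : chan S -> chan S) l : nlabel S :=
  match l with
  | NOut c v h => NOut (f c) v h
  | NIn c v h => NIn (f c) v h
  | _ => l
  end.

Lemma ntrans_resE c l M X : ntrans l (Res c M) X ->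
  exists M', [/\ X = Res c M', ntrans l M M' & ~~ on_chan c l].
Proof. by move=> t; inv t; exists M'. Qed.

Lemma nsigma_resE c M X : ntrans_sigma (Res c M) X ->
  exists2 M', X = Res c M' & ntrans_sigma M M'.
Proof. by move=> t; inv t; exists M'. Qed.

Lemma nsigma_parE M N X : ntrans_sigma (NPar M N) X ->
  exists M' N', [/\ X = NPar M' N', ntrans_sigma M M', ntrans_sigma N N' &
                    no_tau (NPar M N)].
Proof. by move=> t; inv t; exists M', N'. Qed.

Lemma mapc_nlabel_id c d l : ~~ on_chan c l -> mapc_nlabel (ren_chan c d) l = l.
Proof. by case: l => //= e v h; rewrite /ren_chan => /negbTE ->. Qed.

Lemma ntrans_ren c d l M M' : rng d = rng c -> ntrans l M M' -> d \notin nchans M ->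
  ntrans (mapc_nlabel (ren_chan c d) l) (ren_net c d M) (ren_net c d M').
Proof.
move=> r; elim=> {l M M'} /=.
- by move=> n J P P' mu h /(ptrans_ren r) t _; apply: nt_pos.
- by move=> n J s v P P' mu h Js /(ptrans_ren r) t _; apply: nt_sensread Js t.
- by move=> n J a v P P' mu h Js /(ptrans_ren r) t _; apply: nt_actunchg Js t.
- by move=> n J a v P P' mu h Js /(ptrans_ren r) t _; apply: nt_actchg Js t.
- by move=> n J P P' mu h /(ptrans_ren r) t _; apply: nt_loccom.
- move=> n J e v P P' mu h /(ptrans_ren r) t re _; apply: nt_out => //.
  by rewrite rng_ren_chan.
- move=> n J e v P P' mu h /(ptrans_ren r) t re _; apply: nt_in => //.
  by rewrite rng_ren_chan.
- move=> e v h k M M' N N' _ IM _ IN re; rewrite mem_cat => /norP[/IM tM /IN tN].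
  by apply: nt_glbcoml tM tN _; rewrite rng_ren_chan.
- move=> e v h k M M' N N' _ IM _ IN re; rewrite mem_cat => /norP[/IN tN /IM tM].
  by apply: nt_glbcomr tM tN _; rewrite rng_ren_chan.
- by move=> l M M' N _ IM; rewrite mem_cat => /norP[/IM tM _]; apply: nt_parl.
- by move=> l M M' N _ IM; rewrite mem_cat => /norP[_ /IM tM]; apply: nt_parr.
- move=> l e M M' t IM el; rewrite inE => /norP[de dM].
  case: eqP => [ec|ec].
    by rewrite mapc_nlabel_id -?ec //; apply: nt_res.
  apply: nt_res; first exact: IM.
  case: l el {t IM} => //= e' v h el; rewrite /ren_chan; case: ifP => // _;
    by rewrite eq_sym in de; rewrite eq_sym (negbTE de).
Qed.

Lemma ren_chan_inj c d e e' : e != d -> e' != d ->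
  ren_chan c d e = ren_chan c d e' -> e = e'.
Proof. by move=> h h' E; rewrite -(ren_chanK c h) E ren_chanK. Qed.

Lemma ntrans_ren_inv c d l M X : rng d = rng c -> d \notin nchans M ->
  ntrans l (ren_net c d M) X ->
  exists l' M', [/\ l = mapc_nlabel (ren_chan c d) l', X = ren_net c d M' &
                    ntrans l' M M'].
Proof.
move=> r; elim: M l X => /= [|n J P mu h|M IM N IN|e M IM] l X.
- by move=> _ t; inv t.
- move=> dP t; inv t;
    match goal with H : ptrans _ (ren_proc _ _ _) _ |- _ =>
      case: (ptrans_ren_inv dP r H) => l' [P1 [El -> tP]] end;
    case: l' El tP => //.
  + by move=> h0 [<-] tP; exists (NTau S), (Node n J P1 mu h); split=> //; apply: nt_pos.
  + move=> s0 v0 [<- <-] tP; exists (NTau S), (Node n J P1 mu h); split=> //.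
    by eapply nt_sensread; eassumption.
  + move=> s0 v0 [<- <-] tP; exists (NTau S), (Node n J P1 mu h); split=> //.
    by eapply nt_actunchg; eassumption.
  + move=> s0 v0 [<- <-] tP.
    exists (NAct a), (Node n J.[inr a <- v]%fmap P1 mu h); split=> //.
    by eapply nt_actchg; eassumption.
  + by move=> _ tP; exists (NTau S), (Node n J P1 mu h); split=> //; apply: nt_loccom.
  + move=> c1 v1 [Ec Ev] tP; subst; exists (NOut c1 v1 h), (Node n J P1 mu h).
    split=> //; apply: nt_out => //.
    by match goal with H : is_true (range_ge0 _) |- _ => move: H end;
      rewrite rng_ren_chan.
  + move=> c1 v1 [Ec Ev] tP; subst; exists (NIn c1 v1 h), (Node n J P1 mu h).
    split=> //; apply: nt_in => //.
    by match goal with H : is_true (range_ge0 _) |- _ => move: H end;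
      rewrite rng_ren_chan.
- rewrite mem_cat => /norP[dM dN] t.
  have neq M0 M0' l0 : d \notin nchans M0 -> ntrans l0 M0 M0' ->
      forall c0, c0 \in nlabel_chan l0 -> c0 != d.
    move=> dM0 t0 c0 c0l; apply: contraNneq dM0 => <-.
    by apply: free_chans_nchans; apply: nlabel_chan_sub t0 _ c0l.
  inv t.
  + match goal with tO : ntrans (NOut _ _ _) _ _, tI : ntrans (NIn _ _ _) _ _,
        rg : is_true (in_range _ _) |- _ =>
      case: (IM _ _ dM tO) => l1 [M1 [E1 -> t1]];
      case: (IN _ _ dN tI) => l2 [N1 [E2 -> t2]]; move: rg end.
    case: l1 E1 t1 => // c1 v1 h1 [E1 Ev1 Eh1] t1.
    case: l2 E2 t2 => // c2 v2 h2 [E2 Ev2 Eh2] t2 rg; subst.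
    (* Both labels carry the same renamed channel; the original channels differ from the fresh [d],
       and away from [d] the renaming is injective. *)
    have ec : c1 = c2.
      apply: ren_chan_inj E2; last exact: neq t2 _ (mem_head _ _).
      exact: neq t1 _ (mem_head _ _).
    subst c2; exists (NTau S), (NPar M1 N1); split=> //.
    by apply: nt_glbcoml t1 t2 _; rewrite -(rng_ren_chan r).
  + match goal with tO : ntrans (NOut _ _ _) _ _, tI : ntrans (NIn _ _ _) _ _,
        rg : is_true (in_range _ _) |- _ =>
      case: (IN _ _ dN tO) => l1 [M1 [E1 -> t1]];
      case: (IM _ _ dM tI) => l2 [N1 [E2 -> t2]]; move: rg end.
    case: l1 E1 t1 => // c1 v1 h1 [E1 Ev1 Eh1] t1.
    case: l2 E2 t2 => // c2 v2 h2 [E2 Ev2 Eh2] t2 rg; subst.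
    have ec : c1 = c2.
      apply: ren_chan_inj E2; last exact: neq t2 _ (mem_head _ _).
      exact: neq t1 _ (mem_head _ _).
    subst c2; exists (NTau S), (NPar N1 M1); split=> //.
    by apply: nt_glbcomr t1 t2 _; rewrite -(rng_ren_chan r).
  + match goal with H : ntrans _ (ren_net _ _ _) _ |- _ =>
      case: (IM _ _ dM H) => l1 [M1 [E1 -> t1]] end.
    by exists l1, (NPar M1 N); split=> //; apply: nt_parl.
  + match goal with H : ntrans _ (ren_net _ _ _) _ |- _ =>
      case: (IN _ _ dN H) => l1 [M1 [E1 -> t1]] end.
    by exists l1, (NPar M M1); split=> //; apply: nt_parr.
- rewrite inE => /norP[de dM]; case: eqP => [ec t|ec t].
  + subst e; have [M' [-> t' cl]] := ntrans_resE t.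
    exists l, (Res c M'); split=> //=; last exact: nt_res.
      by rewrite mapc_nlabel_id.
    by rewrite eqxx.
  + have [M' [-> H1 H3]] := ntrans_resE t.
    have [l1 [M1 [E1 -> t1]]] := IM _ _ dM H1; exists l1, (Res e M1); split=> //=.
      by case: eqP ec.
    apply: nt_res => //; subst l; apply: contra H3.
    case: (l1) => //= e' v h /eqP ->;
      by rewrite /ren_chan (introF eqP ec) eqxx.
Qed.

Lemma no_tau_ren c d M : rng d = rng c -> d \notin nchans M ->
  no_tau M -> no_tau (ren_net c d M).
Proof.
move=> r dM n [X /(ntrans_ren_inv r dM)[l [M' [E _ t]]]].
by case: l E t => // _ t; apply: n; exists M'.
Qed.

Lemma nsigma_ren c d M M' : rng d = rng c -> ntrans_sigma M M' -> d \notin nchans M ->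
  ntrans_sigma (ren_net c d M) (ren_net c d M').
Proof.
move=> r; elim=> {M M'} /=.
- move=> n J P P' h t nt dP; constructor; first exact: sigma_ren.
  by apply: (no_tau_ren (M := Node n J P Stationary h)).
- move=> n J P P' h k t nt le dP; constructor => //; first exact: sigma_ren.
  by apply: (no_tau_ren (M := Node n J P Mobile h)).
- move=> M M' N N' _ IM _ IN nt dMN; have := dMN; rewrite mem_cat => /norP[dM dN].
  constructor; [exact: IM|exact: IN|].
  exact: (no_tau_ren (M := NPar M N)).
- by constructor.
- move=> e M M' t IM; rewrite inE => /norP[_ dM].
  by case: eqP => _; constructor => //; apply: IM.
Qed.

Lemma no_tau_ren_inv c d M : rng d = rng c -> d \notin nchans M ->
  no_tau (ren_net c d M) -> no_tau M.
Proof. by move=> r dM n [M' t]; apply: n; eexists; apply: ntrans_ren r t dM. Qed.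

Lemma nsigma_ren_inv c d M X : rng d = rng c -> d \notin nchans M ->
  ntrans_sigma (ren_net c d M) X ->
  exists2 M', X = ren_net c d M' & ntrans_sigma M M'.
Proof.
move=> r; elim: M X => /= [|n J P mu h|M IM N IN|e M IM] X.
- by move=> _ t; inv t; exists (Zero S) => //; constructor.
- move=> dP t; inv t; match goal with H : ptrans_sigma _ _ |- _ =>
      case: (sigma_ren_inv dP r H) => P1 -> tP end.
  + exists (Node n J P1 Stationary h) => //; constructor => //.
    exact: (no_tau_ren_inv (M := Node n J P Stationary h) r dP).
  + exists (Node n J P1 Mobile k) => //; constructor => //.
    exact: (no_tau_ren_inv (M := Node n J P Mobile h) r dP).
- move=> dMN t; have := dMN; rewrite mem_cat => /norP[dM dN].
  have [M' [N' [-> H1 H2 nt]]] := nsigma_parE t.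
  have [M1 -> tM] := IM _ dM H1; have [N1 -> tN] := IN _ dN H2.
  exists (NPar M1 N1) => //; constructor => //.
  exact: (no_tau_ren_inv (M := NPar M N) r dMN).
- rewrite inE => /norP[_ dM]; case: eqP => [ec t|ec t]; have [M' -> H0] := nsigma_resE t.
  + by subst e; exists (Res c M') => /=; rewrite ?eqxx //; constructor.
  + have [M1 -> tM] := IM _ dM H0; exists (Res e M1) => /=; last by constructor.
    by case: eqP ec.
Qed.

Definition ntsim M N := forall l M', ntrans l M M' ->
  exists2 N', ntrans l N N' & scong M' N'.
Definition nssim M N := forall M', ntrans_sigma M M' ->
  exists2 N', ntrans_sigma N N' & scong M' N'.
Definition nsim M N :=
  [/\ scong M N, ntsim M N, ntsim N M, nssim M N & nssim N M].

Lemma nsim_refl M : nsim M M.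
Proof.
by split=> [|l M' t|l M' t|M' t|M' t]; try exists M' => //; apply: scong_refl.
Qed.

Lemma nsim_sym M N : nsim M N -> nsim N M.
Proof. by case=> e *; split=> //; apply: scong_sym. Qed.

Lemma ntsim_trans M N O : ntsim M N -> ntsim N O -> ntsim M O.
Proof.
move=> h1 h2 l M' /h1[N' /h2[O' h e'] e].
by exists O' => //; apply: scong_trans e'.
Qed.

Lemma nssim_trans M N O : nssim M N -> nssim N O -> nssim M O.
Proof.
move=> h1 h2 M' /h1[N' /h2[O' h e'] e].
by exists O' => //; apply: scong_trans e'.
Qed.

Lemma nsim_trans M N O : nsim M N -> nsim N O -> nsim M O.
Proof.
move=> [e t1 t2 s1 s2] [e' t1' t2' s1' s2']; split.
- exact: scong_trans e e'.
- exact: ntsim_trans t1 t1'.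
- exact: ntsim_trans t2' t2.
- exact: nssim_trans s1 s1'.
- exact: nssim_trans s2' s2.
Qed.

Lemma ntsim_notau M N : ntsim M N -> no_tau N -> no_tau M.
Proof. by move=> h nN [O /h[O' hO' _]]; apply: nN; exists O'. Qed.

Lemma nsigma_notau M M' : ntrans_sigma M M' -> no_tau M.
Proof.
elim=> {M M'} //; first by case=> X t; inv t.
by move=> c M M' _ IH [X /ntrans_resE[X' [_ t _]]]; apply: IH; exists X'.
Qed.

Lemma ntsim_node n J P P' mu h : wf (Node n J P mu h) ->
  pcong (fun k => k \in domf J) P P' ->
  ntsim (Node n J P mu h) (Node n J P' mu h).
Proof.
rewrite wf_node1 => /andP[wP dj] e; have [_ t _ _ _] := pcong_psim e.
have sn P1 P2 := @scong_node S n J P1 P2 mu h dj.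
move=> l X tX; inv tX;
  match goal with H : ptrans _ P _ |- _ => case: (t _ _ H) => Q tQ eQ end;
  eexists; try (eapply sn; exact eQ).
- by apply: nt_pos.
- by eapply nt_sensread; eassumption.
- by eapply nt_actunchg; eassumption.
- by eapply nt_actchg; eassumption.
- match goal with H : ptrans (PActuate _ _) P _ |- _ =>
    have E := domf_set_act H wP end.
  by apply: scong_node; rewrite E.
- by apply: nt_loccom.
- by apply: nt_out.
- by apply: nt_in.
Qed.

Lemma nsim_node n J P P' mu h : wf (Node n J P mu h) ->
  pcong (fun k => k \in domf J) P P' -> nsim (Node n J P mu h) (Node n J P' mu h).
Proof.
have ss P1 P2 : wf (Node n J P1 mu h) -> pcong (fun k => k \in domf J) P1 P2 ->
    nssim (Node n J P1 mu h) (Node n J P2 mu h).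
  move=> w e; have := w; rewrite wf_node1 => /andP[w1 dj].
  have e' := pcong_sym e.
  have w' : wf (Node n J P2 mu h) by rewrite wf_node1 -(pcong_pwf e) w1.
  have t := ntsim_node w' e'.
  have [_ _ _ s _] := pcong_psim e.
  move=> X tX; inv tX; match goal with H : ptrans_sigma _ _ |- _ =>
      case: (s _ H) => Q tQ eQ end.
  - exists (Node n J Q Stationary h); last exact: scong_node.
    by constructor => //; apply: ntsim_notau t _.
  - exists (Node n J Q Mobile k); last exact: scong_node.
    by constructor => //; apply: ntsim_notau t _.
move=> w e; have := w; rewrite wf_node1 => /andP[wP dj].
have e' := pcong_sym e.
have w' : wf (Node n J P' mu h) by rewrite wf_node1 -(pcong_pwf e) wP.
split; [exact: scong_node|exact: ntsim_node|exact: ntsim_node|exact: ss|exact: ss].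
Qed.

Lemma ntsim_comm M N : wf (NPar M N) -> ntsim (NPar M N) (NPar N M).
Proof.
move=> w l X t; have wX := ntrans_wf t w; inv t; eexists;
  try (eapply scong_comm; eassumption).
- by eapply nt_glbcomr; eassumption.
- by eapply nt_glbcoml; eassumption.
- by apply: nt_parr.
- by apply: nt_parl.
Qed.

Lemma nsim_comm M N : wf (NPar M N) -> nsim (NPar M N) (NPar N M).
Proof.
have ss M0 N0 : wf (NPar M0 N0) -> nssim (NPar M0 N0) (NPar N0 M0).
  move=> w X t; have wX := sigma_wf t w; have [M' [N' [EX H1 H2 H4]]] := nsigma_parE t.
  subst X; exists (NPar N' M'); last exact: scong_comm.
  by constructor => //; apply: ntsim_notau H4; apply: ntsim_comm; rewrite wf_parC.
move=> w; have w' : wf (NPar N M) by rewrite wf_parC.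
by split; [apply: scong_comm|apply: ntsim_comm|apply: ntsim_comm|apply: ss|apply: ss].
Qed.

Ltac inv_npar := match goal with H : ntrans _ (NPar _ _) _ |- _ => inv H end.

Lemma ntsim_assocr M N O : wf (NPar (NPar M N) O) ->
  ntsim (NPar (NPar M N) O) (NPar M (NPar N O)).
Proof.
move=> w l X t; have wX := ntrans_wf t w; inv t; try inv_npar;
  eexists; try (eapply scong_assoc; eassumption).
- by eapply nt_glbcoml; [eassumption|apply: nt_parr; eassumption|eassumption].
- by apply: nt_parr; eapply nt_glbcoml; eassumption.
- by eapply nt_glbcomr; [apply: nt_parr; eassumption|eassumption|eassumption].
- by apply: nt_parr; eapply nt_glbcomr; eassumption.
- by eapply nt_glbcoml; [eassumption|apply: nt_parl; eassumption|eassumption].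
- by eapply nt_glbcomr; [apply: nt_parl; eassumption|eassumption|eassumption].
- by apply: nt_parl.
- by apply: nt_parr; apply: nt_parl.
- by apply: nt_parr; apply: nt_parr.
Qed.

Lemma nsim_assoc M N O : wf (NPar (NPar M N) O) ->
  nsim (NPar (NPar M N) O) (NPar M (NPar N O)).
Proof.
have rot M0 N0 O0 : wf (NPar (NPar M0 N0) O0) -> wf (NPar (NPar N0 O0) M0).
  by rewrite wf_parA wf_parC.
have flip M0 N0 O0 : wf (NPar (NPar M0 N0) O0) -> wf (NPar M0 (NPar N0 O0)).
  by rewrite wf_parA.
have tl M0 N0 O0 : wf (NPar (NPar M0 N0) O0) ->
    ntsim (NPar M0 (NPar N0 O0)) (NPar (NPar M0 N0) O0).
  move=> w; have w1 := rot _ _ _ w; have w2 := rot _ _ _ w1.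
  apply: ntsim_trans (ntsim_comm (flip _ _ _ w)) _.
  apply: ntsim_trans (ntsim_assocr w1) _.
  apply: ntsim_trans (ntsim_comm (flip _ _ _ w1)) _.
  apply: ntsim_trans (ntsim_assocr w2) _.
  exact: ntsim_comm (flip _ _ _ w2).
have sr M0 N0 O0 : wf (NPar (NPar M0 N0) O0) ->
    nssim (NPar (NPar M0 N0) O0) (NPar M0 (NPar N0 O0)).
  move=> w X t; have wX := sigma_wf t w; have [M1 [O' [EX H1 H2 H4]]] := nsigma_parE t.
  have [M' [N' [EX1 H3 H5 _]]] := nsigma_parE H1; subst M1 X.
  exists (NPar M' (NPar N' O')); last exact: scong_assoc.
  have nt := ntsim_notau (tl _ _ _ w) H4.
  constructor => //; constructor => //.
  by case=> Y hY; apply: nt; eexists; apply: nt_parr hY.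
have sc M0 N0 : wf (NPar M0 N0) -> nssim (NPar M0 N0) (NPar N0 M0).
  by move=> w; case: (nsim_comm w).
move=> w; have w1 := rot _ _ _ w; have w2 := rot _ _ _ w1; split.
- exact: scong_assoc.
- exact: ntsim_assocr.
- exact: tl.
- exact: sr.
apply: nssim_trans (sc _ _ (flip _ _ _ w)) _.
apply: nssim_trans (sr _ _ _ w1) _.
apply: nssim_trans (sc _ _ (flip _ _ _ w1)) _.
apply: nssim_trans (sr _ _ _ w2) _.
exact: sc (flip _ _ _ w2).
Qed.

Lemma nsim_unit M : wf M -> nsim (NPar M (Zero S)) M.
Proof.
move=> w; have w0 : wf (NPar M (Zero S)) by rewrite wf_par0.
have t1 : ntsim (NPar M (Zero S)) M.
  move=> l X t; inv t;
    try by match goal with H : ntrans _ (Zero S) _ |- _ => inv H end.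
  by eexists; first eassumption; apply: scong_unit; apply: ntrans_wf; eauto.
split=> // [|l X t|X t|X t]; first exact: scong_unit.
- exists (NPar X (Zero S)); first by apply: nt_parl.
  by apply: scong_sym; apply: scong_unit; apply: ntrans_wf; eauto.
- have [M' [Z' [-> tM tZ _]]] := nsigma_parE t; inv tZ.
  by exists M' => //; apply: scong_unit; apply: sigma_wf tM w.
- exists (NPar X (Zero S)).
    constructor => //; first by constructor.
    by apply: ntsim_notau t1 _; apply: nsigma_notau t.
  by apply: scong_sym; apply: scong_unit; apply: sigma_wf; eauto.
Qed.

Lemma nsim_res_zero c : nsim (Res c (Zero S)) (Zero S).
Proof.
have e : scong (Res c (Zero S)) (Zero S) by apply: scong_step => //; constructor.
split=> // [l X t|l X t|X t|X t].
- by have [M' [_ t' _]] := ntrans_resE t; inv t'.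
- by inv t.
- by have [M' -> t'] := nsigma_resE t; inv t'; exists (Zero S) => //; constructor.
- by inv t; exists (Res c (Zero S)); [do 2!constructor|apply: scong_sym].
Qed.

Lemma nsim_res_swap c d M : wf M -> nsim (Res c (Res d M)) (Res d (Res c M)).
Proof.
have ts c0 d0 M0 : wf M0 -> ntsim (Res c0 (Res d0 M0)) (Res d0 (Res c0 M0)).
  move=> w l X t; have [M1 [-> t1 cl]] := ntrans_resE t.
  have [M'0 [-> H2 dl]] := ntrans_resE t1; exists (Res d0 (Res c0 M'0)).
    by do 2!apply: nt_res => //.
  by apply: scong_step; rewrite ?wf_res ?(ntrans_wf H2) //; constructor.
have ss c0 d0 M0 : wf M0 -> nssim (Res c0 (Res d0 M0)) (Res d0 (Res c0 M0)).
  move=> w X t; have [M1 -> t1] := nsigma_resE t.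
  have [M'0 -> H1] := nsigma_resE t1; exists (Res d0 (Res c0 M'0)).
    by do 2!constructor.
  by apply: scong_step; rewrite ?wf_res ?(sigma_wf H1) //; constructor.
move=> w; split; [|exact: ts|exact: ts|exact: ss|exact: ss].
by apply: scong_step; rewrite ?wf_res //; constructor.
Qed.

(** No label of [M] is on [c], so no communication between [M] and [N] uses [c], and either
    placement of the restriction blocks the same labels, all of them coming from [N]. *)
Lemma nsim_extrude c M N : wf (NPar M N) -> c \notin free_chans M ->
  nsim (Res c (NPar M N)) (NPar M (Res c N)).
Proof.
move=> w cM.
have off l M' : ntrans l M M' -> ~~ on_chan c l.
  by move=> t; rewrite on_chanE; apply: contra cM; apply: nlabel_chan_sub t _.
have off' l M' : ntrans l M M' -> c \notin free_chans M'.
  by move=> t; apply: contra cM; apply: free_chans_ntrans t _.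
have t1 : ntsim (Res c (NPar M N)) (NPar M (Res c N)).
  have offO c0 v h M' : ntrans (NOut c0 v h) M M' -> c0 != c by move/off.
  have offI c0 v h M' : ntrans (NIn c0 v h) M M' -> c0 != c by move/off.
  move=> l X t; have [X0 [-> H1 cl]] := ntrans_resE t.
  have wX := ntrans_wf H1 w; inv H1; eexists;
    try (eapply scong_extrude; [eassumption|eauto]).
  - by eapply nt_glbcoml; [eassumption|apply: nt_res; [eassumption|eauto]|eassumption].
  - by eapply nt_glbcomr; [apply: nt_res; [eassumption|eauto]|eassumption|eassumption].
  - by apply: nt_parl.
  - by apply: nt_parr; apply: nt_res.
have t2 : ntsim (NPar M (Res c N)) (Res c (NPar M N)).
  have fin l M' N' : ntrans l (NPar M N) (NPar M' N') -> ~~ on_chan c l ->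
      c \notin free_chans M' ->
      exists2 Y, ntrans l (Res c (NPar M N)) Y & scong (NPar M' (Res c N')) Y.
    move=> t cl cM'; exists (Res c (NPar M' N')); first exact: nt_res.
    by apply: scong_sym; apply: scong_extrude => //; apply: ntrans_wf t w.
  move=> l X t; inv t;
    try (match goal with H : ntrans _ (Res c N) _ |- _ =>
           case: (ntrans_resE H) => Y [-> tY cl] end); apply: fin; eauto.
  - by eapply nt_glbcoml; eassumption.
  - by eapply nt_glbcomr; eassumption.
  - exact: nt_parl.
  - exact: nt_parr.
have sub M' : ntrans_sigma M M' -> c \notin free_chans M'.
  by move=> t; apply: contra cM; apply: free_chans_sigma t _.
split=> // [|X t|X t]; first exact: scong_extrude.
- have [X0 -> t0] := nsigma_resE t.
  have wX := sigma_wf t0 w; have [M' [N' [EX H1 H2 H4]]] := nsigma_parE t0.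
  subst X0; exists (NPar M' (Res c N')); last by apply: scong_extrude; eauto.
  constructor => //; first by constructor.
  apply: ntsim_notau t2 _; case=> Y /ntrans_resE[Y' [_ tY _]].
  by apply: H4; exists Y'.
- have [M' [N1 [-> H1 H2 H4]]] := nsigma_parE t.
  have [N' -> H3] := nsigma_resE H2.
  have t' : ntrans_sigma (NPar M N) (NPar M' N').
    constructor => //; case=> Y tY; apply: (ntsim_notau t1 H4).
    by exists (Res c Y); apply: nt_res.
  exists (Res c (NPar M' N')); first by constructor.
  by apply: scong_sym; apply: scong_extrude; eauto; apply: sigma_wf t' w.
Qed.

Lemma nsim_alpha c d M : wf M -> d \notin nchans M -> rng d = rng c ->
  nsim (Res c M) (Res d (ren_net c d M)).
Proof.
move=> w dM r; split.
- exact: scong_alpha.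
- move=> l X t; have [M' [-> H1 H3]] := ntrans_resE t.
  exists (Res d (ren_net c d M')); last first.
    apply: scong_alpha => //; first exact: ntrans_wf H1 w.
    by apply: contra dM; apply: nchans_ntrans H1 _.
  rewrite -(@mapc_nlabel_id c d l) //; apply: nt_res; first exact: ntrans_ren.
  rewrite mapc_nlabel_id // on_chanE; apply: contra dM => dl.
  by apply: free_chans_nchans; apply: nlabel_chan_sub H1 _ dl.
- move=> l X t; have [M' [-> H1 H3]] := ntrans_resE t.
  have [l' [M1 [El EM' t1]]] := ntrans_ren_inv r dM H1; subst M'.
  have cl : ~~ on_chan c l'.
    apply: contra H3; subst l; case: (l') => //= e v h /eqP ->;
    by rewrite /ren_chan !eqxx.
  subst l; rewrite mapc_nlabel_id //; exists (Res c M1); first exact: nt_res.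
  apply: scong_sym; apply: scong_alpha => //; first exact: ntrans_wf t1 w.
  by apply: contra dM; apply: nchans_ntrans t1 _.
- move=> X t; have [M' -> H0] := nsigma_resE t; exists (Res d (ren_net c d M')).
    by constructor; apply: nsigma_ren.
  apply: scong_alpha => //; first exact: sigma_wf H0 w.
  by apply: contra dM; apply: nchans_sigma H0 _.
- move=> X t; have [M' -> H0] := nsigma_resE t.
  have [M1 -> t1] := nsigma_ren_inv r dM H0.
  exists (Res c M1); first by constructor.
  apply: scong_sym; apply: scong_alpha => //; first exact: sigma_wf t1 w.
  by apply: contra dM; apply: nchans_sigma t1 _.
Qed.

Lemma nsim_parl M M' N : wf (NPar M N) -> nsim M M' -> nsim (NPar M N) (NPar M' N).
Proof.
have tl M0 M1 : wf (NPar M0 N) -> scong M0 M1 -> ntsim M0 M1 ->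
    ntsim (NPar M0 N) (NPar M1 N).
  move=> w e t l X tX; have wX := ntrans_wf tX w; inv tX;
    try match goal with H : ntrans _ M0 _ |- _ => case: (t _ _ H) => Y hY e' end;
    eexists; try (eapply scong_parl; [exact wX|eassumption]).
  - by eapply nt_glbcoml; eassumption.
  - by eapply nt_glbcomr; eassumption.
  - by apply: nt_parl; eassumption.
  - by apply: nt_parr; eassumption.
have sl M0 M1 : wf (NPar M0 N) -> scong M0 M1 -> ntsim M1 M0 -> nssim M0 M1 ->
    nssim (NPar M0 N) (NPar M1 N).
  move=> w e t s X tX; have wX := sigma_wf tX w.
  have [M2 [N' [EX H1 H2 H4]]] := nsigma_parE tX; subst X; have [Y hY e'] := s _ H1.
  exists (NPar Y N'); last exact: scong_parl.
  constructor => //; apply: ntsim_notau H4; apply: tl => //.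
    by rewrite -(scong_wf_parl _ e).
  exact: scong_sym.
move=> w [e t1 t2 s1 s2]; have e' := scong_sym e.
have w' : wf (NPar M' N) by rewrite -(scong_wf_parl _ e).
by split; [apply: scong_parl|apply: tl|apply: tl|apply: sl|apply: sl].
Qed.

Lemma nsim_parr M N N' : wf (NPar M N) -> nsim N N' -> nsim (NPar M N) (NPar M N').
Proof.
move=> w h; apply: nsim_trans (nsim_comm w) _.
have w' : wf (NPar N M) by rewrite wf_parC.
apply: nsim_trans (nsim_parl w' h) _; apply: nsim_comm.
by case: h => e _ _ _ _; rewrite -(scong_wf_parl _ e).
Qed.

Lemma nsim_res c M M' : nsim M M' -> nsim (Res c M) (Res c M').
Proof.
have tl M0 M1 : ntsim M0 M1 -> ntsim (Res c M0) (Res c M1).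
  move=> t l X tX; have [M2 [-> H1 cl]] := ntrans_resE tX; have [Y hY e'] := t _ _ H1.
  by exists (Res c Y); [apply: nt_res|apply: scong_res].
have sl M0 M1 : nssim M0 M1 -> nssim (Res c M0) (Res c M1).
  move=> t X tX; have [M2 -> H0] := nsigma_resE tX; have [Y hY e'] := t _ H0.
  by exists (Res c Y); [constructor|apply: scong_res].
move=> [e t1 t2 s1 s2].
by split; [apply: scong_res|apply: tl|apply: tl|apply: sl|apply: sl].
Qed.

Theorem scong_nsim M N : scong M N -> nsim M N.
Proof.
have step M0 N0 : nstruct M0 N0 -> wf M0 -> wf N0 -> nsim M0 N0.
  elim=> {M0 N0}.
  - move=> n J P P' mu h e wM wN; apply: nsim_node => //.
    by move: wM wN; rewrite !wf_node1 => /andP[? _] /andP[? _]; apply: pcong_step.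
  - by move=> *; apply: nsim_comm.
  - by move=> *; apply: nsim_assoc.
  - by move=> *; apply: nsim_unit.
  - by move=> *; apply: nsim_res_zero.
  - by move=> c d M0; rewrite !wf_res => w _; apply: nsim_res_swap.
  - by move=> c M0 N0 h; rewrite wf_res => w _; apply: nsim_extrude.
  - by move=> c d M0 dM r; rewrite wf_res => w _; apply: nsim_alpha.
  - move=> M0 M1 N0 _ IH w; rewrite wf_par => /and3P[w1 _ _].
    by apply: nsim_parl => //; apply: IH => //; move: w; rewrite wf_par => /and3P[].
  - move=> M0 M1 N0 _ IH w; rewrite wf_par => /and3P[_ w1 _].
    by apply: nsim_parr => //; apply: IH => //; move: w; rewrite wf_par => /and3P[].
  - by move=> c M0 M1 _ IH; rewrite !wf_res => *; apply: nsim_res; apply: IH.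
elim=> {M N} [M N [wM wN h]|M|M N _|M N O _ + _]; last exact: nsim_trans.
- exact: step.
- exact: nsim_refl.
- exact: nsim_sym.
Qed.

End NetworkSimulation.

(** * From transitions to reductions *)

Section TransitionsToReductions.

Variable S : cait_sig.

Implicit Types (P Q R : proc S) (v : value S) (c d e : chan S).
Implicit Types (M N O X U : net S) (J : interface S) (l : nlabel S).
Implicit Types (g : seq (chan S)) (n : node S) (mu : mobility) (h k : loc S).

Notation nu g U := (foldr (@Res S) U g).

(* M' is M with the process P of one node replaced by P'; B lists the channels
   restricted above that node. *)
Inductive at_node n J P P' mu h : net S -> net S -> seq (chan S) -> Prop :=
  | an_node : at_node n J P P' mu h (Node n J P mu h) (Node n J P' mu h) [::]
  | an_parl M M' N B : at_node n J P P' mu h M M' B ->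
      at_node n J P P' mu h (NPar M N) (NPar M' N) B
  | an_parr M M' N B : at_node n J P P' mu h M M' B ->
      at_node n J P P' mu h (NPar N M) (NPar N M') B
  | an_res c M M' B : at_node n J P P' mu h M M' B ->
      at_node n J P P' mu h (Res c M) (Res c M') (c :: B).

Lemma wf_nu g U : wf (nu g U) = wf U.
Proof. by elim: g => //= c g IH; rewrite wf_res. Qed.

Lemma nkeys_nu g U : nkeys (nu g U) = nkeys U.
Proof. by elim: g. Qed.

Lemma scong_nu g U U' : scong U U' -> scong (nu g U) (nu g U').
Proof. by move=> e; elim: g => //= c g IH; apply: scong_res. Qed.

Lemma scong_extruder c M N : wf (NPar M N) -> c \notin free_chans N ->
  scong (NPar (Res c M) N) (Res c (NPar M N)).
Proof.
move=> w cN; have w' : wf (NPar N M) by rewrite wf_parC.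
have wr : wf (NPar (Res c M) N) by move: w; rewrite !wf_par wf_res.
apply: scong_trans (scong_comm wr) _.
apply: scong_trans (scong_sym (scong_extrude w' cN)) _.
by apply: scong_res; apply: scong_comm.
Qed.

Lemma scong_nu_parl g M N : wf (NPar M N) -> {in g, forall c, c \notin free_chans N} ->
  scong (NPar (nu g M) N) (nu g (NPar M N)).
Proof.
move=> w; elim: g => [|c g IH] h; first exact: scong_refl.
have wg : wf (NPar (nu g M) N) by move: w; rewrite !wf_par wf_nu nkeys_nu.
apply: scong_trans (scong_extruder wg (h c (mem_head _ _))) _.
by apply: scong_res; apply: IH => d dg; apply: h; rewrite inE dg orbT.
Qed.

Lemma scong_nu_parr g M N : wf (NPar M N) -> {in g, forall c, c \notin free_chans M} ->
  scong (NPar M (nu g N)) (nu g (NPar M N)).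
Proof.
move=> w; elim: g => [|c g IH] h; first exact: scong_refl.
have wg : wf (NPar M (nu g N)) by move: w; rewrite !wf_par wf_nu nkeys_nu.
apply: scong_trans (scong_sym (scong_extrude wg (h c (mem_head _ _)))) _.
by apply: scong_res; apply: IH => d dg; apply: h; rewrite inE dg orbT.
Qed.

Lemma ren_nu c d g U : c \notin g -> ren_net c d (nu g U) = nu g (ren_net c d U).
Proof.
elim: g => //= e g IH; rewrite inE => /norP[ne /IH ->].
by rewrite eq_sym (negbTE ne).
Qed.

(** Brings the active node to the top: the restrictions are renamed away from [X] and moved
    outwards, and [f] collects the renamings that the node undergoes. The same [g], [f] and [M0]
    serve for [M] and [M'], so a reduction of the exposed node can be put back into its context. *)
Lemma focus n J P P' mu h M M' B (X : seq (chan S)) :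
  at_node n J P P' mu h M M' B -> wf M -> wf M' ->
  exists g (f : chan S -> chan S) M0,
    [/\ {in g, forall c, c \notin X}, forall c, rng (f c) = rng c,
        forall c, c \notin B -> f c = c,
        scong M (nu g (NPar (Node n J (mapc f P) mu h) M0)) &
        scong M' (nu g (NPar (Node n J (mapc f P') mu h) M0))].
Proof.
have grow M1 N g (f : chan S -> chan S) P0 M0 : wf (NPar M1 N) ->
    {in g, forall c, c \notin free_chans N} ->
    scong M1 (nu g (NPar (Node n J (mapc f P0) mu h) M0)) ->
    scong (NPar M1 N) (nu g (NPar (Node n J (mapc f P0) mu h) (NPar M0 N))).
  move=> w gN e; have w1 := w; rewrite (scong_wf_parl _ e) in w1.
  have w2 : wf (NPar (NPar (Node n J (mapc f P0) mu h) M0) N).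
    by move: w1; rewrite !wf_par wf_nu nkeys_nu wf_par.
  apply: scong_trans (scong_parl w e) _.
  apply: scong_trans (scong_nu_parl w2 gN) _.
  by apply: scong_nu; apply: scong_assoc.
move=> a; elim: a X => {M M' B}.
- move=> X w w'; exists [::], id, (Zero S); rewrite !mapc_id /=.
  by split=> //; apply: scong_sym; apply: scong_unit.
- move=> M M' N B _ IH X w w'.
  have := w; rewrite wf_par => /and3P[wM wN _].
  have := w'; rewrite wf_par => /and3P[wM' _ _].
  have [g [f [M0 [gX fr fB e e']]]] := IH (X ++ free_chans N) wM wM'.
  have gN : {in g, forall c, c \notin free_chans N}.
    by move=> c /gX; rewrite mem_cat => /norP[].
  exists g, f, (NPar M0 N); split=> //; try exact: grow.
  by move=> c /gX; rewrite mem_cat => /norP[].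
- move=> M M' N B _ IH X w w'.
  have wC : wf (NPar M N) by rewrite wf_parC.
  have wC' : wf (NPar M' N) by rewrite wf_parC.
  have := w; rewrite wf_par => /and3P[wN wM _].
  have := w'; rewrite wf_par => /and3P[_ wM' _].
  have [g [f [M0 [gX fr fB e e']]]] := IH (X ++ free_chans N) wM wM'.
  have gN : {in g, forall c, c \notin free_chans N}.
    by move=> c /gX; rewrite mem_cat => /norP[].
  exists g, f, (NPar M0 N); split=> //.
  + by move=> c /gX; rewrite mem_cat => /norP[].
  + by apply: scong_trans (scong_comm w) _; apply: grow.
  + by apply: scong_trans (scong_comm w') _; apply: grow.
- move=> c M M' B _ IH X; rewrite !wf_res => wM wM'.
  (* The names already moved out must avoid [c] as well, so that the renaming of [c] passes below
     the binders [g]. *)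
  have [g [f [M0 [gX fr fB e e']]]] := IH (c :: X) wM wM'.
  set U := nu g (NPar (Node n J (mapc f P) mu h) M0) in e.
  set U' := nu g (NPar (Node n J (mapc f P') mu h) M0) in e'.
  (* One name has to be fresh for both networks, since source and target are renamed alike. *)
  have [d dn rd] := chan_fresh c (X ++ nchans U ++ nchans U').
  move: dn; rewrite !mem_cat => /norP[dX /norP[dU dU']].
  have cg : c \notin g by apply/negP=> /gX; rewrite mem_head.
  have E P0 : nu g (NPar (Node n J (mapc (ren_chan c d \o f) P0) mu h)
                         (ren_net c d M0))
      = ren_net c d (nu g (NPar (Node n J (mapc f P0) mu h) M0)).
    by rewrite ren_nu //= ren_procE mapc_comp.
  exists (d :: g), (ren_chan c d \o f), (ren_net c d M0); split=> /=.
  + move=> x; rewrite inE => /orP[/eqP ->|/gX] //.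
    by rewrite inE => /norP[].
  + by move=> x /=; rewrite rng_ren_chan.
  + move=> x; rewrite inE => /norP[xc xB]; rewrite fB //.
    by rewrite /ren_chan (negbTE xc).
  + rewrite E; apply: scong_trans (scong_res c e) _.
    by apply: scong_alpha => //; rewrite -(scong_wf e).
  + rewrite E; apply: scong_trans (scong_res c e') _.
    by apply: scong_alpha => //; rewrite -(scong_wf e').
Qed.

(** A visible label has passed all restrictions above its node, so [c] is not among them and [focus]
    does not rename it: both partners of a communication keep the same channel. The flag [out]
    treats outputs and inputs at once. *)
Lemma ntrans_visible_at (out : bool) c v k M M' :
  ntrans (if out then NOut c v k else NIn c v k) M M' ->
  exists n J P P' mu B,
    [/\ at_node n J P P' mu k M M' B,
        ptrans (if out then POut c v else PIn c v) P P' & c \notin B].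
Proof.
move E : (if out then _ else _) => l t; elim: t E => {l M M'};
  try by case: (out).
- move=> n J c0 v0 P P' mu h t _; case: out => // -[-> -> ->].
  by exists n, J, P, P', mu, [::]; split=> //; constructor.
- move=> n J c0 v0 P P' mu h t _; case: out => // -[-> -> ->].
  by exists n, J, P, P', mu, [::]; split=> //; constructor.
- move=> l M M' N _ IH /IH[n [J [P [P' [mu [B [a t cB]]]]]]].
  by exists n, J, P, P', mu, B; split=> //; constructor.
- move=> l M M' N _ IH /IH[n [J [P [P' [mu [B [a t cB]]]]]]].
  by exists n, J, P, P', mu, B; split=> //; constructor.
- move=> l d M M' _ IH dl El; have [n [J [P [P' [mu [B [a t cB]]]]]]] := IH El.
  exists n, J, P, P', mu, (d :: B); split=> //; first by constructor.
  by move: dl; rewrite inE negb_or cB -El; case: out {El IH t} => /= ->.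
Qed.

(** The instance of [red_parp] for one node; the product over one index ends in [Zero], which
    congruence removes. *)
Lemma red_par1 w n J J' P P' Q mu h :
  wf (Node n J (Par P Q) mu h) -> wf (Node n J' (Par P' Q) mu h) ->
  red w (Node n J P mu h) (Node n J' P' mu h) ->
  red w (Node n J (Par P Q) mu h) (Node n J' (Par P' Q) mu h).
Proof.
move=> w1 w2 r.
have := @red_parp S w 1 (fun=> n) (fun=> J) (fun=> J') (fun=> P) (fun=> P')
  (fun=> Q) (fun=> mu) (fun=> mu) (fun=> h) (fun=> h).
rewrite !big_ord_recl !big_ord0 => rp.
apply: red_struct (rp _) _.
- by apply: scong_sym; apply: scong_unit.
- exact: red_parn.
- exact: scong_unit.
Qed.

Lemma red_par2 w n1 n2 J1 J2 P1 P2 P1' P2' Q1 Q2 mu1 mu2 h1 h2 :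
  wf (NPar (Node n1 J1 (Par P1 Q1) mu1 h1) (Node n2 J2 (Par P2 Q2) mu2 h2)) ->
  wf (NPar (Node n1 J1 (Par P1' Q1) mu1 h1) (Node n2 J2 (Par P2' Q2) mu2 h2)) ->
  red w (NPar (Node n1 J1 P1 mu1 h1) (Node n2 J2 P2 mu2 h2))
        (NPar (Node n1 J1 P1' mu1 h1) (Node n2 J2 P2' mu2 h2)) ->
  red w (NPar (Node n1 J1 (Par P1 Q1) mu1 h1) (Node n2 J2 (Par P2 Q2) mu2 h2))
        (NPar (Node n1 J1 (Par P1' Q1) mu1 h1) (Node n2 J2 (Par P2' Q2) mu2 h2)).
Proof.
move=> w1 w2 r.
(* Presents a pair as a family over two indices, the form in which [red_parp] takes its products. *)
pose F (T : Type) (x y : T) (i : 'I_2) := if val i == 0 then x else y.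
have := @red_parp S w 2 (F _ n1 n2) (F _ J1 J2) (F _ J1 J2) (F _ P1 P2)
  (F _ P1' P2') (F _ Q1 Q2) (F _ mu1 mu2) (F _ mu1 mu2) (F _ h1 h2) (F _ h1 h2).
rewrite !big_ord_recl !big_ord0 /F /= => rp.
have un A B : wf (NPar A B) -> scong (NPar A (NPar B (Zero S))) (NPar A B).
  move=> wAB; have := wAB; rewrite wf_par => /and3P[wA wB _].
  apply: scong_parr; last exact: scong_unit.
  by rewrite -wf_parA wf_par0.
have sub A B A' B' :
    wf (NPar (Node n1 J1 (Par A A') mu1 h1) (Node n2 J2 (Par B B') mu2 h2)) ->
    wf (NPar (Node n1 J1 A mu1 h1) (Node n2 J2 B mu2 h2)).
  rewrite !wf_par !wf_node1 !pwf_par.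
  by move=> /and3P[/andP[/andP[-> _] ->] /andP[/andP[-> _] ->] ->].
apply: red_struct (rp _) _.
- by apply: scong_sym; apply: un.
- apply: red_struct r _; first by apply: un; apply: sub w1.
  by apply: scong_sym; apply: un; apply: sub w2.
- exact: un.
Qed.

Lemma red_nu w g M M' : red w M M' -> red w (nu g M) (nu g M').
Proof. by move=> r; elim: g => //= c g; apply: red_res. Qed.

Lemma red_glb n1 n2 J1 J2 P1 P2 P1' P2' mu1 mu2 h1 h2 c v :
  wf (NPar (Node n1 J1 P1 mu1 h1) (Node n2 J2 P2 mu2 h2)) ->
  ptrans (POut c v) P1 P1' -> ptrans (PIn c v) P2 P2' ->
  in_range (dist h1 h2) (rng c) ->
  red (RTau S) (NPar (Node n1 J1 P1 mu1 h1) (Node n2 J2 P2 mu2 h2))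
               (NPar (Node n1 J1 P1' mu1 h1) (Node n2 J2 P2' mu2 h2)).
Proof.
move=> w t1 t2 rg; have := w; rewrite wf_par !wf_node1.
move=> /and3P[/andP[w1 d1] /andP[w2 d2] kd].
have [H1 [C1 [Q1 [[pH1 tH1] e1 e1']]]] := ptrans_redex t1 w1.
have [H2 [C2 [Q2 [[pH2 tH2] e2 e2']]]] := ptrans_redex t2 w2.
have [B1 EH1] := head_out pH1 tH1; have [A2 [B2 [EH2 EC2]]] := head_in pH2 tH2.
have w1' := pwf_ptrans t1 w1; have w2' := pwf_ptrans t2 w2.
have w' : wf (NPar (Node n1 J1 P1' mu1 h1) (Node n2 J2 P2' mu2 h2)).
  by rewrite wf_par !wf_node1 w1' w2' d1 d2.
have s : scong (NPar (Node n1 J1 P1 mu1 h1) (Node n2 J2 P2 mu2 h2))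
  (NPar (Node n1 J1 (Par H1 Q1) mu1 h1) (Node n2 J2 (Par H2 Q2) mu2 h2)).
  by apply: scong_par => //; apply: scong_node.
have s' : scong (NPar (Node n1 J1 P1' mu1 h1) (Node n2 J2 P2' mu2 h2))
  (NPar (Node n1 J1 (Par C1 Q1) mu1 h1) (Node n2 J2 (Par C2 Q2) mu2 h2)).
  by apply: scong_par => //; apply: scong_node.
have sw := w; have sw' := w'; rewrite (scong_wf s) in sw; rewrite (scong_wf s') in sw'.
apply: red_struct s _ (scong_sym s').
by apply: red_par2 => //; subst; apply: red_glbcom.
Qed.

Lemma scong_shuffle X1 X2 Y1 Y2 : wf (NPar (NPar X1 X2) (NPar Y1 Y2)) ->
  scong (NPar (NPar X1 X2) (NPar Y1 Y2)) (NPar (NPar X1 Y1) (NPar X2 Y2)) /\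
  wf (NPar X1 Y1).
Proof.
move=> wx.
have s1 := scong_assoc wx; have w1 := wx; rewrite (scong_wf s1) in w1.
have w2 : wf (NPar X2 (NPar Y1 Y2)) by move: w1; rewrite wf_par => /and3P[].
have w3 : wf (NPar (NPar X2 Y1) Y2) by rewrite wf_parA.
have s2 := scong_sym (scong_assoc w3).
have w4 : wf (NPar X2 Y1) by move: w3; rewrite wf_par => /and3P[].
have s3 := scong_parl w3 (scong_comm w4).
have w5 : wf (NPar (NPar Y1 X2) Y2) by rewrite -(scong_wf s3).
have s4 := scong_trans s2 (scong_trans s3 (scong_assoc w5)).
have s5 := scong_parr w1 s4.
have w6 : wf (NPar X1 (NPar Y1 (NPar X2 Y2))) by rewrite -(scong_wf s5).
have w7 : wf (NPar (NPar X1 Y1) (NPar X2 Y2)) by rewrite wf_parA.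
split; last by move: w7; rewrite wf_par => /and3P[].
exact: scong_trans s1 (scong_trans s5 (scong_sym (scong_assoc w7))).
Qed.

(** The partners may sit deep below different restrictions. Each is focused, with names avoiding the
    other side, all restrictions are moved outside, and the two nodes are brought next to each
    other, where [red_glb] applies. *)
Lemma red_com c v h k M M' N N' : wf (NPar M N) ->
  ntrans (NOut c v k) M M' -> ntrans (NIn c v h) N N' ->
  in_range (dist h k) (rng c) -> red (RTau S) (NPar M N) (NPar M' N').
Proof.
move=> w tM tN rg; have w' : wf (NPar M' N').
  by apply: ntrans_wf w; apply: nt_glbcoml tM tN rg.
have := w; rewrite wf_par => /and3P[wM wN kMN].
have wM' := ntrans_wf tM wM; have wN' := ntrans_wf tN wN.
have [n1 [J1 [P1 [P1' [mu1 [B1 [a1 t1 c1]]]]]]] := @ntrans_visible_at true _ _ _ _ _ tM.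
have [n2 [J2 [P2 [P2' [mu2 [B2 [a2 t2 c2]]]]]]] := @ntrans_visible_at false _ _ _ _ _ tN.
have [g1 [f1 [M0 [g1X fr1 fB1 e1 e1']]]] :=
  focus (free_chans N ++ free_chans N') a1 wM wM'.
set A := Node n1 J1 (mapc f1 P1) mu1 k in e1.
set A' := Node n1 J1 (mapc f1 P1') mu1 k in e1'.
have [g2 [f2 [N0 [g2X fr2 fB2 e2 e2']]]] :=
  focus (free_chans (NPar A M0) ++ free_chans (NPar A' M0)) a2 wN wN'.
set B := Node n2 J2 (mapc f2 P2) mu2 h in e2.
set B' := Node n2 J2 (mapc f2 P2') mu2 h in e2'.
have glue (M1 N1 U V : net S) : wf (NPar M1 N1) -> scong M1 (nu g1 U) ->
    scong N1 (nu g2 V) -> {in g1, forall c, c \notin free_chans N1} ->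
    {in g2, forall c, c \notin free_chans U} ->
    scong (NPar M1 N1) (nu g1 (nu g2 (NPar U V))) /\ wf (NPar U V).
  move=> w1 eU eV h1 h2.
  have wUN : wf (NPar U N1).
    by move: w1; rewrite (scong_wf_parl _ eU) !wf_par wf_nu nkeys_nu.
  have wUV : wf (NPar U V).
    by move: wUN; rewrite wf_parC (scong_wf_parl _ eV) wf_parC !wf_par wf_nu nkeys_nu.
  split=> //; apply: scong_trans (scong_parl w1 eU) _.
  apply: scong_trans (scong_nu_parl wUN h1) _; apply: scong_nu.
  apply: scong_trans (scong_parr wUN eV) _.
  exact: scong_nu_parr.
have [||s wUV] := glue M N (NPar A M0) (NPar B N0) w e1 e2.
- by move=> x /g1X; rewrite mem_cat => /norP[].
- by move=> x /g2X; rewrite mem_cat => /norP[].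
have [||s' wUV'] := glue M' N' (NPar A' M0) (NPar B' N0) w' e1' e2'.
- by move=> x /g1X; rewrite mem_cat => /norP[].
- by move=> x /g2X; rewrite mem_cat => /norP[].
apply: red_struct s _ (scong_sym s'); apply: red_nu; apply: red_nu.
have [s1 wAB] := scong_shuffle wUV; have [s1' wAB'] := scong_shuffle wUV'.
apply: red_struct s1 _ (scong_sym s1'); apply: red_parn.
apply: (red_glb (c := c) (v := v) wAB).
- by have := ptrans_mapc fr1 t1; rewrite /= fB1.
- by have := ptrans_mapc fr2 t2; rewrite /= fB2.
- by rewrite dist_sym.
Qed.

Definition rlabel_nlabel (w : rlabel S) : nlabel S :=
  match w with RTau => NTau S | RAct a => NAct a end.

Lemma red_node w n J J' P P' mu h lb :
  wf (Node n J P mu h) -> wf (Node n J' P' mu h) ->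
  domf J' = domf J -> ptrans lb P P' ->
  (forall H C, redex lb H C -> red w (Node n J H mu h) (Node n J' C mu h)) ->
  red w (Node n J P mu h) (Node n J' P' mu h).
Proof.
move=> w1 w2 dJ t hr; have := w1; rewrite wf_node1 => /andP[wP dj].
have [H [C [Q [rH e e']]]] := ptrans_redex t wP.
have s : scong (Node n J P mu h) (Node n J (Par H Q) mu h) by apply: scong_node.
have s' : scong (Node n J' P' mu h) (Node n J' (Par C Q) mu h).
  by apply: scong_node; rewrite dJ.
have sw := w1; have sw' := w2; rewrite (scong_wf s) in sw; rewrite (scong_wf s') in sw'.
apply: red_struct s _ (scong_sym s').
by apply: red_par1 => //; apply: hr.
Qed.

Theorem ntrans_red w M M' : ntrans (rlabel_nlabel w) M M' -> wf M -> red w M M'.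
Proof.
move E : (rlabel_nlabel w) => l t; elim: t w E => {l M M'}.
- move=> n J P P' mu h t [] // _ wM.
  have wM' : wf (Node n J P' mu h) by apply: ntrans_wf wM; apply: nt_pos.
  apply: red_node (t) _ => //.
  by move=> H C [pH tH]; case: H pH tH => //= [r H|p H Q] _ tH; inv tH; constructor.
- move=> n J s v P P' mu h Js t [] // _ wM.
  have wM' : wf (Node n J P' mu h) by apply: ntrans_wf wM; apply: nt_sensread Js t.
  apply: red_node (t) _ => //.
  by move=> H C [pH tH]; case: H pH tH => //= [r H|p H Q] _ tH; inv tH; constructor.
- move=> n J a v P P' mu h Js t [] // _ wM.
  have wM' : wf (Node n J P' mu h) by apply: ntrans_wf wM; apply: nt_actunchg Js t.
  apply: red_node (t) _ => //.
  by move=> H C [pH tH]; case: H pH tH => //= [r H|p H Q] _ tH; inv tH; constructor.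
- move=> n J a v P P' mu h Js t [] // _ [->] wM.
  have wM' : wf (Node n J.[inr a <- v]%fmap P' mu h).
    by apply: ntrans_wf wM; apply: nt_actchg Js t.
  apply: red_node (t) _ => //.
    by move: wM; rewrite wf_node1 => /andP[wP _]; apply: domf_set_act t wP.
  by move=> H C [pH tH]; case: H pH tH => //= [r H|p H Q] _ tH; inv tH; constructor.
- move=> n J P P' mu h t [] // _ wM.
  have wM' : wf (Node n J P' mu h) by apply: ntrans_wf wM; apply: nt_loccom.
  apply: red_node (t) _ => // H C [c [v [A [B [A' [B' [rc -> ->]]]]]]].
  exact: red_loccom.
- by move=> n J c v P P' mu h _ _ [].
- by move=> n J c v P P' mu h _ _ [].
- by move=> c v h k M M' N N' tM _ tN _ rg [] // _ wMN; apply: red_com tM tN rg.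
- move=> c v h k M M' N N' tM _ tN _ rg [] // _ wMN.
  have wC : wf (NPar M N) by rewrite wf_parC.
  have r := red_com wC tM tN rg.
  apply: red_struct (scong_comm wMN) r (scong_comm _).
  by apply: ntrans_wf wC; apply: nt_glbcoml tM tN rg.
- move=> l M M' N _ IH w El; rewrite wf_par => /and3P[wM _ _].
  by apply: red_parn; apply: IH.
- move=> l M M' N t IH w El wNM; have wC : wf (NPar M N) by rewrite wf_parC.
  apply: red_struct (scong_comm wNM) (red_parn _ (IH w El _)) (scong_comm _).
    by move: wNM; rewrite wf_par => /and3P[].
  by apply: ntrans_wf wC; apply: nt_parl t.
- by move=> l c M M' _ IH _ w El; rewrite wf_res => wM; apply: red_res; apply: IH.
Qed.

Lemma no_red_no_tau M : wf M -> no_red_tau M -> no_tau M.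
Proof. by move=> wM nr [M' t]; apply: nr; exists M'; apply: ntrans_red. Qed.

End TransitionsToReductions.

(** * From reductions to transitions *)

Section ReductionsToTransitions.

Variable S : cait_sig.

Implicit Types (P Q R : proc S) (v : value S) (c d e : chan S).
Implicit Types (M N O X U : net S) (J : interface S) (l : nlabel S).
Implicit Types (n : node S) (mu : mobility) (h : loc S).
Implicit Types (f g : chan S -> chan S) (q : node S -> proc S).

Definition upd f c d : chan S -> chan S := fun e => if e == c then d else f e.

(* The node n occurs in M, and P is its process once the free channels of M are
   instantiated by f and the restricted ones by arbitrary names. *)
Inductive located n J mu h : (chan S -> chan S) -> net S -> proc S -> Prop :=
  | loc_node f P : located n J mu h f (Node n J P mu h) (mapc f P)
  | loc_parl f M N P : located n J mu h f M P -> located n J mu h f (NPar M N) P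
  | loc_parr f M N P : located n J mu h f M P -> located n J mu h f (NPar N M) P
  | loc_res f c d M P :
      located n J mu h (upd f c d) M P -> located n J mu h f (Res c M) P.

Section Located.

Variables (n : node S) (J : interface S) (mu : mobility) (h : loc S).
Notation located := (located n J mu h).

Lemma eq_in_located f g M P :
  {in free_chans M, f =1 g} -> located f M P -> located g M P.
Proof.
move=> + t; elim: t g => {f M P} /=.
- by move=> f P g fg; rewrite (eq_in_mapc fg); constructor.
- move=> f M N P _ IH g fg; apply: loc_parl; apply: IH => c cM.
  by apply: fg; rewrite mem_cat cM.
- move=> f M N P _ IH g fg; apply: loc_parr; apply: IH => c cM.
  by apply: fg; rewrite mem_cat cM orbT.
- move=> f c d M P _ IH g fg; apply: (@loc_res _ _ _ _ _ c d); apply: IH => e eM.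
  by rewrite /upd; case: (eqVneq e c) => // ne; apply: fg; rewrite mem_filter ne.
Qed.

Lemma located_parE f M N P :
  located f (NPar M N) P -> located f M P \/ located f N P.
Proof. by move=> t; inv t; [left|right]. Qed.

Lemma located_resE f c M P :
  located f (Res c M) P -> exists d, located (upd f c d) M P.
Proof. by move=> t; inv t; exists d. Qed.

Lemma located_ren f c d M P : d \notin nchans M ->
  located f (ren_net c d M) P <-> located (f \o ren_chan c d) M P.
Proof.
elim: M f P => /= [|n0 J0 P0 mu0 h0|M IM N IN|e M IM] f P.
- by split=> t; inv t.
- move=> _; split=> t; inv t.
  + by rewrite ren_procE mapc_comp; constructor.
  + by rewrite -mapc_comp -ren_procE; constructor.
- rewrite mem_cat => /norP[dM dN]; split=> t; inv t.
  + by apply: loc_parl; apply/(IM _ _ dM).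
  + by apply: loc_parr; apply/(IN _ _ dN).
  + by apply: loc_parl; apply/(IM _ _ dM).
  + by apply: loc_parr; apply/(IN _ _ dN).
- rewrite inE => /norP[de dM]; case: (eqVneq e c) => [->|ec].
    split=> /located_resE[d0 t]; apply: (@loc_res _ _ _ _ _ c d0);
      apply: eq_in_located t => x _; rewrite /upd /= /ren_chan; by case: eqP.
  split=> /located_resE[d0 H0]; apply: (@loc_res _ _ _ _ _ e d0).
  + apply: eq_in_located (iffLR (IM _ _ dM) H0) => x _; rewrite /upd /= /ren_chan.
    case: (eqVneq x c) => [->|xc]; last by [].
    by rewrite (negbTE de) eq_sym (negbTE ec).
  + apply/(IM _ _ dM); apply: eq_in_located H0 => x _; rewrite /upd /= /ren_chan.
    case: (eqVneq x c) => [->|xc]; last by [].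
    by rewrite (negbTE de) eq_sym (negbTE ec).
Qed.

(** The instantiation [f] of free channels is common to both sides, while restricted channels may be
    instantiated anew; this absorbs renaming and movement of restrictions. *)
Definition lsim M N := forall f P, located f M P ->
  exists2 P', located f N P' & pcong (fun k => k \in domf J) P P'.

Lemma lsim_eq M N : (forall f P, located f M P -> located f N P) -> lsim M N.
Proof. by move=> t f P /t; exists P => //; apply: pcong_refl. Qed.

Lemma lsim_parl M M' N : lsim M M' -> lsim (NPar M N) (NPar M' N).
Proof.
move=> t f P /located_parE[/t[P' lP' e]|lP].
  by exists P' => //; apply: loc_parl.
by exists P; [apply: loc_parr|apply: pcong_refl].
Qed.

Lemma lsim_parr M M' N : lsim M M' -> lsim (NPar N M) (NPar N M').
Proof.
move=> t f P /located_parE[lP|/t[P' lP' e]].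
  by exists P; [apply: loc_parl|apply: pcong_refl].
by exists P' => //; apply: loc_parr.
Qed.

Lemma lsim_res c M M' : lsim M M' -> lsim (Res c M) (Res c M').
Proof.
move=> t f P /located_resE[d /t[P' lP' e]].
by exists P' => //; apply: loc_res lP'.
Qed.

Lemma lsim_step M N : nstruct M N -> wf M -> wf N -> lsim M N /\ lsim N M.
Proof.
elim=> {M N}.
- move=> n0 J0 P P' mu0 h0 e; rewrite !wf_node1 => /andP[wP _] /andP[wP' _].
  split=> f X lX; inv lX.
  + exists (mapc f P'); first by constructor.
    by apply: pcong_mapc; apply: pcong_step.
  + exists (mapc f P); first by constructor.
    by apply: pcong_sym; apply: pcong_mapc; apply: pcong_step.
- move=> M N _ _; split; apply: lsim_eq => f P /located_parE[] t;
    by [apply: loc_parr|apply: loc_parl].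
- move=> M N O _ _; split; apply: lsim_eq => f P.
    move=> /located_parE[/located_parE[]|] t.
    + exact: loc_parl.
    + by apply: loc_parr; apply: loc_parl.
    + by apply: loc_parr; apply: loc_parr.
  move=> /located_parE[|/located_parE[]] t.
  + by apply: loc_parl; apply: loc_parl.
  + by apply: loc_parl; apply: loc_parr.
  + exact: loc_parr.
- move=> M _ _; split; apply: lsim_eq => f P t; last exact: loc_parl.
  by case/located_parE: t => // t; inv t.
- move=> c _ _; split; apply: lsim_eq => f P t; last by inv t.
  by case/located_resE: t => d t; inv t.
- have sw c d M f P : located f (Res c (Res d M)) P -> located f (Res d (Res c M)) P.
    move=> /located_resE[d0 /located_resE[d1 H1]]; case: (eqVneq c d) => [E|ne].
      (* If the two restricted names coincide, the inner binder decides, and its choice [d1] is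
         taken for both. *)
      subst d; apply: (@loc_res _ _ _ _ _ c d1); apply: (@loc_res _ _ _ _ _ c d1).
      by apply: eq_in_located H1 => x _; rewrite /upd; case: eqP.
    apply: (@loc_res _ _ _ _ _ d d1); apply: (@loc_res _ _ _ _ _ c d0).
    apply: eq_in_located H1 => x _; rewrite /upd; case: (eqVneq x d) => // ->.
    by rewrite eq_sym (negbTE ne).
  by move=> c d M _ _; split; apply: lsim_eq => f P; apply: sw.
- move=> c M N cM _ _; split; apply: lsim_eq => f P t.
  + have [d0 /located_parE[] H1] := located_resE t; last first.
      by apply: loc_parr; apply: loc_res H1.
    apply: loc_parl; apply: eq_in_located H1 => x xM; rewrite /upd.
    by case: eqP => // E; move: cM; rewrite -E xM.
  + have [H0|/located_resE[d0 H1]] := located_parE t; last first.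
      by apply: loc_res; apply: loc_parr H1.
    (* As [c] is not free in [M], any instantiation of it will do. *)
    apply: (@loc_res _ _ _ _ _ c c); apply: loc_parl.
    apply: eq_in_located H0 => x xM; rewrite /upd.
    by case: eqP => // E; move: cM; rewrite -E xM.
- move=> c d M dM r _ _.
  have up x f : {in free_chans M, upd f c x =1 upd f d x \o ren_chan c d}.
    move=> y yM; rewrite /upd /= /ren_chan; case: (eqVneq y c) => _; rewrite ?eqxx //.
    case: (eqVneq y d) => // E; move: dM; rewrite -E.
    by rewrite (free_chans_nchans yM).
  split; apply: lsim_eq => f P /located_resE[d0 H0].
  + apply: (@loc_res _ _ _ _ _ d d0); apply/(located_ren _ _ _ dM).
    by apply: eq_in_located H0; apply: up.
  + apply: (@loc_res _ _ _ _ _ c d0).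
    apply: eq_in_located (iffLR (located_ren _ _ _ dM) H0) => y yM.
    by rewrite up.
- move=> M M' N _ IH; rewrite !wf_par => /and3P[wM _ _] /and3P[wM' _ _].
  by have [? ?] := IH wM wM'; split; apply: lsim_parl.
- move=> M M' N _ IH; rewrite !wf_par => /and3P[_ wM _] /and3P[_ wM' _].
  by have [? ?] := IH wM wM'; split; apply: lsim_parr.
- move=> c M M' _ IH; rewrite !wf_res => wM wM'.
  by have [? ?] := IH wM wM'; split; apply: lsim_res.
Qed.

(** Structural congruence never splits or merges nodes: up to the names of restricted channels it
    rewrites the process of each node separately. This is how a congruence of networks is read back
    node by node. *)
Lemma scong_located M N : scong M N -> lsim M N.
Proof.
suff: scong M N -> lsim M N /\ lsim N M by move=> h0 /h0[].
elim=> {M N} [M N [wM wN t]|M|M N _ [? ?]|M N O _ [t1 t2] _ [t3 t4]] //.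
- exact: lsim_step.
- by split; apply: lsim_eq.
- split=> f P.
  + by move=> /t1[P' /t3[P'' l2 e2] e1]; exists P'' => //; apply: pcong_trans e2.
  + by move=> /t4[P' /t2[P'' l2 e2] e1]; exists P'' => //; apply: pcong_trans e2.
Qed.

Lemma located_name f M P : located f M P -> n \in map fst (nkeys M).
Proof.
elim=> {f M P} //= [f P|f M N P _ IH|f M N P _ IH]; rewrite ?mem_head //;
  by rewrite map_cat mem_cat IH ?orbT.
Qed.

End Located.

(** The added process depends only on the node name, so the operation is defined on every network
    and not just on the indexed products of [red_parp]. *)
Fixpoint padd q M : net S :=
  match M with
  | Zero => Zero S
  | Node n J P mu h => Node n J (Par P (q n)) mu h
  | NPar M N => NPar (padd q M) (padd q N)
  | Res c M => Res c (padd q M)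
  end.

Lemma ntrans_padd q l M M' : ntrans l M M' -> ntrans l (padd q M) (padd q M').
Proof.
elim=> {l M M'} /=.
- by move=> *; apply: nt_pos; apply: pt_parl.
- by move=> n J s v P P' mu h Js t; apply: nt_sensread Js _; apply: pt_parl.
- by move=> n J s v P P' mu h Js t; apply: nt_actunchg Js _; apply: pt_parl.
- by move=> n J s v P P' mu h Js t; apply: nt_actchg Js _; apply: pt_parl.
- by move=> *; apply: nt_loccom; apply: pt_parl.
- by move=> *; apply: nt_out => //; apply: pt_parl.
- by move=> *; apply: nt_in => //; apply: pt_parl.
- by move=> c v h k M M' N N' _ tM _ tN rg; apply: nt_glbcoml tM tN rg.
- by move=> c v h k M M' N N' _ tM _ tN rg; apply: nt_glbcomr tM tN rg.
- by move=> *; apply: nt_parl.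
- by move=> *; apply: nt_parr.
- by move=> *; apply: nt_res.
Qed.

Lemma nkeys_padd q M : nkeys (padd q M) = nkeys M.
Proof. by elim: M => //= M -> N ->. Qed.

Lemma wf_padd q M : wf (padd q M) -> wf M.
Proof.
rewrite !wfE nkeys_padd => /andP[ok ->]; rewrite andbT.
elim: M ok => //= [n J P mu h|M IM N IN]; first by rewrite pwf_par => /andP[/andP[-> _] ->].
by move=> /andP[/IM -> /IN ->].
Qed.

(** Transitions keep the tree of a network, so the result of a premise of [red_parp] can be compared
    with the expected product leaf by leaf. Those products contain no restrictions, hence the
    missing case. *)
Fixpoint same_shape M N : Prop :=
  match M, N with
  | Zero, Zero => True
  | Node n _ _ _ _, Node m _ _ _ _ => n = m
  | NPar M1 M2, NPar N1 N2 => same_shape M1 N1 /\ same_shape M2 N2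
  | _, _ => False
  end.

Lemma same_shape_ntrans l M M' X : ntrans l M M' -> same_shape M X -> same_shape M' X.
Proof.
move=> t; elim: t X => {l M M'} //=.
- by move=> c v h k M M' N N' _ IM _ IN _ [] //= X1 X2 [/IM ? /IN ?].
- by move=> c v h k M M' N N' _ IM _ IN _ [] //= X1 X2 [/IN ? /IM ?].
- by move=> l M M' N _ IM [] //= X1 X2 [/IM ? ?].
- by move=> l M M' N _ IM [] //= X1 X2 [? /IM ?].
Qed.

Lemma same_shape_names M N : same_shape M N -> map fst (nkeys M) = map fst (nkeys N).
Proof.
elim: M N => [|n J P mu h|M1 I1 M2 I2|c M IM] [|n' J' P' mu' h'|N1 N2|c' N] //=.
  by move=> ->.
by move=> [/I1 E1 /I2 E2]; rewrite !map_cat E1 E2.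
Qed.

(** Node names are distinct in [B], so the process found for a node of a branch of [A] lies in the
    corresponding branch of [B]; at the leaves the added process is put beside congruent
    processes. *)
Lemma scong_padd q A B : same_shape A B -> wf B -> wf (padd q A) ->
  (forall n J mu h P, located n J mu h id A P ->
     exists2 P', located n J mu h id B P' & pcong (fun k => k \in domf J) P P') ->
  scong (padd q A) (padd q B).
Proof.
elim: A B => [|n J P mu h|A1 I1 A2 I2|c M IM] [|n' J' P' mu' h'|B1 B2|c' N] //=.
- by move=> *; apply: scong_refl.
- move=> En wB wA t; have [P1 l1 e] := t n J mu h _ (loc_node _ _ _ _ _ _).
  inv l1; rewrite !mapc_id in e.
  move: wA; rewrite wf_node1 pwf_par => /andP[/andP[wP wq] dj].
  by apply: scong_node => //; apply: pcong_parl.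
- move=> [s1 s2] wB wA t; have := wB; rewrite wf_par => /and3P[wB1 wB2 kd].
  have ne n : n \in map fst (nkeys B1) -> n \in map fst (nkeys B2) -> False.
    move=> /mapP[x x1 ->] /mapP[y y2 E].
    by have := allrelP kd x y x1 y2; rewrite /key_disj E eqxx.
  have := wA; rewrite wf_par => /and3P[wA1 wA2 _].
  apply: scong_par => //; [apply: I1|apply: I2] => // n J mu h P lP.
  + have [P' lP' e] := t n J mu h P (loc_parl _ lP); exists P' => //; inv lP' => //.
    have := located_name lP; rewrite (same_shape_names s1) => n1.
    by case: (ne n n1); apply: located_name; eassumption.
  + have [P' lP' e] := t n J mu h P (loc_parr _ lP); exists P' => //; inv lP' => //.
    have := located_name lP; rewrite (same_shape_names s2) => n2.
    by case: (ne n _ n2); apply: located_name; eassumption.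
Qed.

Lemma same_shape_prod k0 (n : 'I_k0 -> node S) (J J' : 'I_k0 -> interface S)
    (P P' : 'I_k0 -> proc S) (mu mu' : 'I_k0 -> mobility) (h h' : 'I_k0 -> loc S) :
  same_shape (\big[@NPar S/Zero S]_(i < k0) Node (n i) (J i) (P i) (mu i) (h i))
             (\big[@NPar S/Zero S]_(i < k0) Node (n i) (J' i) (P' i) (mu' i) (h' i)).
Proof.
elim: k0 n J J' P P' mu mu' h h' => [|k0 IH] n J J' P P' mu mu' h h'.
  by rewrite !big_ord0.
by rewrite !big_ord_recl /=.
Qed.

Lemma prod_names k0 (n : 'I_k0 -> node S) (J : 'I_k0 -> interface S)
    (P : 'I_k0 -> proc S) (mu : 'I_k0 -> mobility) (h : 'I_k0 -> loc S) :
  (forall i, n i \in map fst (nkeys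
      (\big[@NPar S/Zero S]_(i < k0) Node (n i) (J i) (P i) (mu i) (h i)))) /\
  (wf (\big[@NPar S/Zero S]_(i < k0) Node (n i) (J i) (P i) (mu i) (h i)) -> injective n).
Proof.
elim: k0 n J P mu h => [|k0 IH] n J P mu h; first by split=> [[]|_ []].
rewrite !big_ord_recl /=.
have [IH1 IH2] := IH (n \o lift ord0) (J \o lift ord0) (P \o lift ord0)
  (mu \o lift ord0) (h \o lift ord0); split.
  by move=> i; case: (unliftP ord0 i) => [j|] ->; rewrite inE ?eqxx // IH1 orbT.
rewrite wf_par => /and3P[_ /IH2 inj kd].
have ne j : n (lift ord0 j) <> n ord0.
  move=> E; have /mapP[y y2 Ey] := IH1 j.
  have := allrelP kd (n ord0, domf (J ord0)) y (mem_head _ _) y2.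
  by rewrite /key_disj /= -E -Ey eqxx.
move=> i j; case: (unliftP ord0 i) => [i'|] ->; case: (unliftP ord0 j) => [j'|] -> //.
- by move=> /inj ->.
- by move/ne.
- by move/esym/ne.
Qed.

Lemma rlabel_off c (w : rlabel S) : ~~ on_chan c (rlabel_nlabel w).
Proof. by case: w. Qed.

Lemma in_range_ge0 (x : nat) (r : range) : in_range x r -> range_ge0 r.
Proof. by case: r. Qed.

Theorem red_ntrans w M M' : red w M M' -> wf M ->
  exists2 M'', ntrans (rlabel_nlabel w) M M'' & scong M'' M'.
Proof.
elim=> {w M M'}.
- by move=> n J P mu h _; eexists; last exact: scong_refl; apply: nt_pos; constructor.
- move=> n J s v P mu h Js _; eexists; last exact: scong_refl.
  by apply: nt_sensread Js _; constructor.
- move=> n J s v P mu h Js _; eexists; last exact: scong_refl.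
  by apply: nt_actunchg Js _; constructor.
- move=> n J s v P mu h Js _; eexists; last exact: scong_refl.
  by apply: nt_actchg Js _; constructor.
- move=> n J c v P Q R R' mu h rc _; eexists; last exact: scong_refl.
  by apply: nt_loccom; apply: pt_coml rc; constructor.
- move=> n J P R mu1 h m K Q R' mu2 k c v rg _; eexists; last exact: scong_refl.
  have r0 := in_range_ge0 rg; rewrite dist_sym in rg.
  by apply: nt_glbcoml rg; [apply: nt_out => //|apply: nt_in => //]; constructor.
- move=> w k n J J' P P' Q mu mu' h h' r IH wM.
  (* Distinct node names make the added component Q i a function of n i; the
     result of the premise is then compared node by node, by scong_located. *)
  pose q x := if [pick i | n i == x] is Some i then Q i else Nil S.
  have [_ inj] := prod_names n J (fun i => Par (P i) (Q i)) mu h.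
  have qn i : q (n i) = Q i.
    rewrite /q; case: pickP => [j /eqP /(inj wM) -> //|/(_ i)].
    by rewrite eqxx.
  have pE (J0 : 'I_k -> interface S) (P0 : 'I_k -> proc S) (mu0 : 'I_k -> mobility)
      (h0 : 'I_k -> loc S) :
      \big[@NPar S/Zero S]_(i < k) Node (n i) (J0 i) (Par (P0 i) (Q i)) (mu0 i) (h0 i)
      = padd q (\big[@NPar S/Zero S]_(i < k) Node (n i) (J0 i) (P0 i) (mu0 i) (h0 i)).
    rewrite (big_morph (padd q) (id1 := Zero S) (op1 := @NPar S)) //.
    by apply: eq_bigr => i _ /=; rewrite qn.
  rewrite !pE in wM *.
  have [Z tZ eZ] := IH (wf_padd wM).
  exists (padd q Z); first exact: ntrans_padd.
  have wZ := ntrans_wf (ntrans_padd q tZ) wM.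
  apply: scong_padd => //.
  + by apply: same_shape_ntrans tZ _; apply: same_shape_prod.
  + by rewrite -(scong_wf eZ) (wf_padd wZ).
  + by move=> n0 J0 mu0 h0 P0; apply: scong_located.
- move=> w M M' N r IH wMN; have := wMN; rewrite wf_par => /and3P[wM _ _].
  have [Z tZ eZ] := IH wM; exists (NPar Z N); first exact: nt_parl.
  by apply: scong_parl => //; apply: ntrans_wf wMN; apply: nt_parl tZ.
- move=> w c M M' r IH; rewrite wf_res => wM; have [Z tZ eZ] := IH wM.
  by exists (Res c Z); [apply: nt_res => //; apply: rlabel_off|apply: scong_res].
- move=> w M N N' M' e1 r IH e2 wM; have [|Z tZ eZ] := IH; first by rewrite -(scong_wf e1).
  have [_ _ t2 _ _] := scong_nsim e1; have [Y tY eY] := t2 _ _ tZ.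
  exists Y => //; apply: scong_trans (scong_sym eY) _.
  exact: scong_trans eZ e2.
Qed.

Lemma no_tau_no_red M : wf M -> no_tau M -> no_red_tau M.
Proof. by move=> wM nt [M' r]; have [Z t _] := red_ntrans r wM; apply: nt; exists Z. Qed.

Lemma red_sigma_ntrans M M' : red_sigma M M' -> wf M ->
  exists2 M'', ntrans_sigma M M'' & scong M'' M'.
Proof.
have ns n J P mu h : no_tau (Node n J P mu h) -> ~ (exists R, ptrans (PTau S) P R).
  by move=> nt [R t]; apply: nt; eexists; apply: nt_loccom t.
elim=> {M M'}.
- move=> n J h k l p P Q R nr wM; eexists; last exact: scong_refl.
  have nt := no_red_no_tau wM nr; constructor => //.
  by apply: waiting_elapsed; apply: ns nt.
- move=> n J h h' k l p P Q R nr le wM; eexists; last exact: scong_refl.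
  have nt := no_red_no_tau wM nr; constructor => //.
  by apply: waiting_elapsed; apply: ns nt.
- move=> M M' N N' _ IM _ IN nr wMN; have := wMN; rewrite wf_par => /and3P[wM wN _].
  have [Y tY eY] := IM wM; have [Z tZ eZ] := IN wN.
  have t : ntrans_sigma (NPar M N) (NPar Y Z).
    by constructor => //; apply: no_red_no_tau.
  by exists (NPar Y Z) => //; apply: scong_par => //; apply: sigma_wf t wMN.
- by move=> _; exists (Zero S); [constructor|apply: scong_refl].
- move=> c M M' _ IM; rewrite wf_res => wM; have [Y tY eY] := IM wM.
  by exists (Res c Y); [constructor|apply: scong_res].
- move=> M N N' M' e1 _ IH e2 wM; have [|Z tZ eZ] := IH; first by rewrite -(scong_wf e1).
  have [_ _ _ _ t2] := scong_nsim e1; have [Y tY eY] := t2 _ tZ.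
  exists Y => //; apply: scong_trans (scong_sym eY) _.
  exact: scong_trans eZ e2.
Qed.

Lemma ntrans_red_sigma M M' : ntrans_sigma M M' -> wf M -> red_sigma M M'.
Proof.
elim=> {M M'}.
- move=> n J P P' h t nt wM; have := wM; rewrite wf_node1 => /andP[wP dj].
  have [k [m [p [A [B [C [e e']]]]]]] := sigma_waiting t wP.
  have s := scong_node n h dj e; have s' := scong_node n h dj e'.
  apply: red_sigma_struct (s) _ (scong_sym s'); constructor.
  move=> [X r]; apply: (no_tau_no_red wM nt); exists X.
  exact: red_struct s r (scong_refl _).
- move=> n J P P' h k0 t nt le wM; have := wM; rewrite wf_node1 => /andP[wP dj].
  have [k [m [p [A [B [C [e e']]]]]]] := sigma_waiting t wP.
  have s := scong_node n h dj e; have s' := scong_node n k0 dj e'.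
  apply: red_sigma_struct (s) _ (scong_sym s'); constructor => //.
  move=> [X r]; apply: (no_tau_no_red wM nt); exists X.
  exact: red_struct s r (scong_refl _).
- move=> M M' N N' _ IM _ IN nt wMN; have := wMN; rewrite wf_par => /and3P[wM wN _].
  by constructor; [apply: IM|apply: IN|apply: no_tau_no_red].
- by move=> _; constructor.
- by move=> c M M' _ IM; rewrite wf_res => wM; constructor; apply: IM.
Qed.

End ReductionsToTransitions.

(** * Barbs *)

Section Barbs.

Variable S : cait_sig.

Implicit Types (P Q : proc S) (v : value S) (c d e : chan S) (a : actuator S).
Implicit Types (M N O X U V W Z : net S) (J : interface S) (l : nlabel S).
Implicit Types (n : node S) (mu : mobility) (h : loc S) (s : sensor S).

(** Restrictions bind channels only and cannot hide an actuator, so a barb can be read off at any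
    depth; see [barbP]. *)
Fixpoint hasact a v h M : bool :=
  match M with
  | Zero => false
  | Node _ J _ _ k => (k == h) && (J.[? inr a]%fmap == Some v)
  | NPar M N => hasact a v h M || hasact a v h N
  | Res _ M => hasact a v h M
  end.

Lemma hasact_ren a v h c d M : hasact a v h (ren_net c d M) = hasact a v h M.
Proof. by elim: M => //= [M -> N ->|e M IH] //; case: ifP. Qed.

Lemma hasact_scong a v h M N : scong M N -> hasact a v h M = hasact a v h N.
Proof.
elim=> {M N} [M N [_ _]|M|M N _ ->|M N O _ -> _ ->] //.
elim=> {M N} //=.
- by move=> M N; rewrite orbC.
- by move=> M N O; rewrite orbA.
- by move=> M; rewrite orbF.
- by move=> c d M _ _; rewrite hasact_ren.
- by move=> M M' N _ ->.
- by move=> M M' N _ ->.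
Qed.

Lemma hasact_at a v h M : hasact a v h M -> exists n J P mu B,
  at_node n J P P mu h M M B /\ J.[? inr a]%fmap = Some v.
Proof.
elim: M => //= [n J P mu k /andP[/eqP -> /eqP Ja]|M IM N IN /orP[/IM|/IN]|c M IM /IM].
- by exists n, J, P, mu, [::]; split=> //; constructor.
- move=> [n [J [P [mu [B [? ?]]]]]]; exists n, J, P, mu, B; split=> //.
  by constructor.
- move=> [n [J [P [mu [B [? ?]]]]]]; exists n, J, P, mu, B; split=> //.
  by constructor.
- move=> [n [J [P [mu [B [? ?]]]]]]; exists n, J, P, mu, (c :: B); split=> //.
  by constructor.
Qed.

Lemma barbP a v h M : wf M -> barb a v h M <-> hasact a v h M.
Proof.
move=> wM; split=> [[g [n [J [P [mu [M' [e Ja]]]]]]]|].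
  rewrite (hasact_scong _ _ _ e); elim: g {e} => //=.
  by rewrite eqxx Ja eqxx.
move=> /hasact_at[n [J [P [mu [B [a0 Ja]]]]]].
have [g [f [M0 [_ _ _ e _]]]] := focus [::] a0 wM wM.
by exists g, n, J, (mapc f P), mu, M0.
Qed.

Lemma hasact_ntrans a v h l M M' : ntrans l M M' ->
  (forall b, l <> NAct b) -> hasact a v h M' = hasact a v h M.
Proof.
elim=> {l M M'} //=.
- by move=> n J b v' P P' mu h' _ _ /(_ b).
- by move=> c v' h' k M M' N N' _ IM _ IN _ _; rewrite IM // IN.
- by move=> c v' h' k M M' N N' _ IM _ IN _ _; rewrite IM // IN.
- by move=> l M M' N _ IM h'; rewrite IM.
- by move=> l M M' N _ IM h'; rewrite IM.
Qed.

Lemma hasact_key a v h M : hasact a v h M -> exists2 x, x \in nkeys M & inr a \in x.2.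
Proof.
elim: M => //= [n J P mu k /andP[_ /eqP Ja]|M IM N IN /orP[/IM|/IN] [x xM ax]].
- by exists (n, domf J); rewrite ?mem_head //=; case: fndP Ja.
- by exists x => //; rewrite mem_cat xM.
- by exists x => //; rewrite mem_cat xM orbT.
Qed.

Lemma act_key a M M' : ntrans (NAct a) M M' -> wf M ->
  exists2 x, x \in nkeys M & inr a \in x.2.
Proof.
move E : (NAct a) => l t; elim: t E => {l M M'} //=.
- move=> n J b v P P' mu h _ t [->]; rewrite wf_node1 => /andP[wP _].
  by exists (n, domf J); rewrite ?mem_head //; apply: actuate_dev t wP.
- move=> l M M' N _ IM El; rewrite wf_par => /and3P[/(IM El)[x xM ax] _ _].
  by exists x => //; rewrite mem_cat xM.
- move=> l M M' N _ IM El; rewrite wf_par => /and3P[_ /(IM El)[x xM ax] _].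
  by exists x => //; rewrite mem_cat xM orbT.
Qed.

Lemma wf_par_act a M N x y : wf (NPar M N) -> x \in nkeys M -> y \in nkeys N ->
  inr a \in x.2 -> inr a \in y.2 -> False.
Proof.
rewrite wf_par => /and3P[_ _ kd] xM yN ax ay.
have /andP[_ /allP /(_ _ ax)] := allrelP kd x y xM yN.
by rewrite /= ay.
Qed.

(** * Sensor updates *)

Lemma domf_set_in J k v : k \in domf J -> domf J.[k <- v]%fmap = domf J.
Proof. by move=> kJ; rewrite dom_setf mem_fset1U. Qed.

Lemma update_keys s h v M : nkeys (sensor_update s h v M) = nkeys M.
Proof.
elim: M => //= [n J P mu k|M -> N ->] //.
by case: ifP => //= /andP[_ sJ]; have /= -> := domf_set_in v sJ.
Qed.

Lemma update_wf s h v M : wf (sensor_update s h v M) = wf M.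
Proof.
rewrite !wfE update_keys; congr andb.
elim: M => //= [n J P mu k|M -> N ->] //.
by case: ifP => //= /andP[_ sJ]; have /= -> := domf_set_in v sJ.
Qed.

Lemma update_ren s h v c d M :
  sensor_update s h v (ren_net c d M) = ren_net c d (sensor_update s h v M).
Proof.
elim: M => //= [n J P mu k|M -> N ->|e M IH] //; first by case: ifP.
by case: ifP => //= _; rewrite IH.
Qed.

Lemma update_scong s h v M N : scong M N ->
  scong (sensor_update s h v M) (sensor_update s h v N).
Proof.
apply: rst_map => {}M {}N [wM wN e]; apply: scong_step; rewrite ?update_wf //.
have fu M0 : free_chans (sensor_update s h v M0) = free_chans M0.
  by elim: M0 => //= [n J P mu k|M0 -> N0 ->|c M0 ->] //; case: ifP.
have nu M0 : nchans (sensor_update s h v M0) = nchans M0.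
  by elim: M0 => //= [n J P mu k|M0 -> N0 ->|c M0 ->] //; case: ifP.
elim: e {wM wN} => {M N} /=; try by intros; constructor.
- by move=> n J P P' mu k e; case: ifP => _; constructor.
- by move=> c M N cM; constructor; rewrite fu.
- by move=> c d M dM r; rewrite update_ren; constructor; rewrite ?nu.
Qed.

(** * Barbed congruence in terms of labelled transitions *)

Definition lstep M N := ntrans (NTau S) M N \/ ntrans_sigma M N.
Definition lsteps := clos_refl_trans (net S) lstep.

Lemma lstep_wf M N : lstep M N -> wf M -> wf N.
Proof. by case=> t; [apply: ntrans_wf t|apply: sigma_wf t]. Qed.

Lemma lsteps_wf M N : lsteps M N -> wf M -> wf N.
Proof.
by elim=> {M N} [M N t|M|M N O _ h1 _ h2] //; [apply: lstep_wf|move=> /h1 /h2].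
Qed.

Lemma lstep_step M N : lstep M N -> wf M -> step M N.
Proof.
case=> t w; first by left; apply: ntrans_red.
by right; apply: ntrans_red_sigma.
Qed.

Lemma lstep_scong M N M' : scong M N -> lstep M M' ->
  exists2 N', lstep N N' & scong M' N'.
Proof.
move=> /scong_nsim[_ ts _ ss _] [/ts[N' t e]|/ss[N' t e]]; exists N' => //.
  by left.
by right.
Qed.

Lemma steps_lsteps M N M' : steps M M' -> scong M N -> wf N ->
  exists2 N', lsteps N N' & scong M' N'.
Proof.
move=> t; elim: t N => {M M'}.
- move=> M M' t N e wN; have wM : wf M by rewrite (scong_wf e).
  have [Z tZ eZ] : exists2 Z, lstep M Z & scong Z M'.
    case: t => t; first by have [Z ? ?] := red_ntrans t wM; exists Z => //; left.
    by have [Z ? ?] := red_sigma_ntrans t wM; exists Z => //; right.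
  have [N' tN eN] := lstep_scong e tZ; exists N'; first exact: rt_step.
  exact: scong_trans (scong_sym eZ) eN.
- by move=> M N e wN; exists N => //; apply: rt_refl.
- move=> M M1 M2 _ IH1 _ IH2 N e wN; have [N1 t1 e1] := IH1 _ e wN.
  have [N2 t2 e2] := IH2 _ e1 (lsteps_wf t1 wN).
  by exists N2 => //; apply: rt_trans t1 t2.
Qed.

(* Barbed congruence restated for labelled transitions, up to structural
   congruence. *)
Record game (R : net S -> net S -> Prop) : Prop := Game {
  game_wf : network_rel R;
  game_sym : symmetric_rel R;
  game_scong : forall M M' N N', scong M M' -> R M N -> scong N N' -> R M' N';
  game_step : forall M N M', R M N -> lstep M M' -> exists2 N', lsteps N N' & R M' N';
  game_act : forall M N a M', R M N -> ntrans (NAct a) M M' ->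
    exists N1 N2 N', [/\ lsteps N N1, ntrans (NAct a) N1 N2, lsteps N2 N' & R M' N'];
  game_barb : forall M N a v h, R M N -> hasact a v h M ->
    exists2 N', lsteps N N' & hasact a v h N';
  game_ctx : contextual R }.

Lemma barbed_game M N : barbed_cong M N -> exists2 R, game R & R M N.
Proof.
move=> [R0 [[nR sR rR bR cR] RMN]].
(* Reductions agree with transitions only up to congruence, so [R0] is composed with [scong] on both
   sides. *)
exists (fun M N => exists M1 N1, [/\ scong M M1, R0 M1 N1 & scong N1 N]); last first.
  by exists M, N; split=> //; apply: scong_refl.
split.
- move=> A B [A1 [B1 [eA r eB]]]; have [wA wB] := nR _ _ r.
  by rewrite (scong_wf eA) -(scong_wf eB).
- move=> A B [A1 [B1 [eA r eB]]]; exists B1, A1; split; try exact: scong_sym.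
  exact: sR.
- move=> A A' B B' eA' [A1 [B1 [eA r eB]]] eB'; exists A1, B1; split=> //.
    exact: scong_trans (scong_sym eA') eA.
  exact: scong_trans eB eB'.
- move=> A B A' [A1 [B1 [eA r eB]]] t; have [wA wB] := nR _ _ r.
  have [A1' tA eA'] := lstep_scong eA t.
  have [hs _] := rR _ _ r; have [B1' tB r'] := hs _ (lstep_step tA wA).
  have wB' : wf B by rewrite -(scong_wf eB).
  have [B' tB' eB'] := steps_lsteps tB eB wB'.
  by exists B' => //; exists A1', B1'.
- move=> A B a A' [A1 [B1 [eA r eB]]] t; have [wA wB] := nR _ _ r.
  have [_ ts _ _ _] := scong_nsim eA; have [A1' tA eA'] := ts _ _ t.
  have [_ ha] := rR _ _ r.
  have [B2 [B3 [B4 [t1 t2 t3 r']]]] := ha _ _ (@ntrans_red S (RAct a) _ _ tA wA).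
  have wB' : wf B by rewrite -(scong_wf eB).
  have [C2 s2 e2] := steps_lsteps t1 eB wB'.
  have wC2 := lsteps_wf s2 wB'.
  have wB2 : wf B2 by rewrite (scong_wf e2).
  have [B3' t2' e3'] := red_ntrans t2 wB2.
  have [_ ts2 _ _ _] := scong_nsim e2; have [C3 s3 e3] := ts2 _ _ t2'.
  have [C4 s4 e4] := steps_lsteps t3 (scong_trans (scong_sym e3') e3) (ntrans_wf s3 wC2).
  by exists C2, C3, C4; split=> //; exists A1', B4.
- move=> A B a v h [A1 [B1 [eA r eB]]]; have [wA wB] := nR _ _ r.
  rewrite (hasact_scong _ _ _ eA) => /(barbP _ _ _ wA) /(bR _ _ r)[B1' t b].
  have wB' : wf B by rewrite -(scong_wf eB).
  have [B' tB eB'] := steps_lsteps t eB wB'; exists B' => //.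
  rewrite -(hasact_scong _ _ _ eB'); apply/barbP => //.
  by rewrite (scong_wf eB'); apply: lsteps_wf tB wB'.
- move=> A B [A1 [B1 [eA r eB]]]; have [c1 c2 c3] := cR _ _ r; split.
  + move=> O wA wB; exists (NPar A1 O), (NPar B1 O); split.
    * exact: scong_parl.
    * by apply: c1; [rewrite -(scong_wf_parl _ eA)|rewrite (scong_wf_parl _ eB)].
    * by apply: scong_parl => //; rewrite (scong_wf_parl _ eB).
  + by move=> c; exists (Res c A1), (Res c B1); split; try exact: scong_res; apply: c2.
  + move=> s h v hv; exists (sensor_update s h v A1), (sensor_update s h v B1).
    by split; try exact: update_scong; apply: c3.
Qed.

End Barbs.

(** * Timers *)

Section Game.

Variable S : cait_sig.

Implicit Types (P Q : proc S) (v : value S) (c d e : chan S) (a : actuator S).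
Implicit Types (M N O X Y U V W Z G : net S) (l : nlabel S) (b : bool).
Implicit Types (n m : node S) (h : loc S) (s : sensor S).

Notation tau := (NTau S).
Notation bval b := (Val (vbool S b)).

(** Test nodes own one actuator and no sensor: sensor updates leave them alone, and a fresh node
    name and a fresh actuator suffice to compose them with a well-formed network. Since [vbool] is
    injective, the booleans provide two distinct values. *)
Definition switch a b : interface S := ([fmap].[inr a <- vbool S b])%fmap.

Lemma domf_switch a b : domf (switch a b) = [fset inr a]%fset.
Proof. by rewrite /switch dom_setf fsetU0. Qed.

Lemma switch_set a b b' : (switch a b).[inr a <- vbool S b']%fmap = switch a b'.
Proof.
by apply/fmapP => x; rewrite !fnd_set; case: eqP.
Qed.

Lemma switchE a a' b :
  (switch a b).[? inr a']%fmap = if a' == a then Some (vbool S b) else None.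
Proof. by rewrite fnd_set fnd_fmap0; congr (if _ then _ else _). Qed.

Lemma switch_inl s a b : (switch a b).[? inl s]%fmap = None.
Proof. by rewrite fnd_set fnd_fmap0. Qed.

Lemma switch_sensor s a b : (inl s \in domf (switch a b)) = false.
Proof. by rewrite domf_switch inE. Qed.

(** Stationary, so that a test keeps its location when time passes. *)
Definition dev n a b P h : net S := Node n (switch a b) P Stationary h.

Lemma update_dev s h v n a b P k : sensor_update s h v (dev n a b P k) = dev n a b P k.
Proof. by rewrite /dev /=; case: ifP => // /andP[_]; rewrite switch_sensor. Qed.

Definition fresh n a (M : net S) : bool :=
  (n \notin map fst (nkeys M)) &&
  all (fun x : node S * {fset (sensor S + actuator S)%type} => inr a \notin x.2)
      (nkeys M).

Lemma fresh_par n a M N : fresh n a (NPar M N) = fresh n a M && fresh n a N.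
Proof.
rewrite /fresh /= map_cat mem_cat all_cat negb_or -!andbA.
by do ?bool_congr.
Qed.

Lemma exists_fresh M : exists n a, fresh n a M.
Proof.
have [n nM] := node_fresh (map fst (nkeys M)).
pose acts (x : node S * {fset (sensor S + actuator S)%type}) : seq (actuator S) :=
  pmap (fun k => if k is inr a then Some a else None) (enum_fset x.2).
have [a aM] := actuator_fresh (flatten (map acts (nkeys M))).
exists n, a; apply/andP; split=> //; apply/allP => x xM.
apply: contra aM => ax; apply/flatten_mapP; exists x => //.
by rewrite mem_pmap; apply/mapP; exists (inr a).
Qed.

Lemma wf_dev n a b P h :
  wf (dev n a b P h) = pwf (fun k => k \in [fset inr a]%fset) 0 0 P.
Proof. by rewrite wf_node1 domf_switch andbT. Qed.

Lemma nkeys_dev n a b P h : nkeys (dev n a b P h) = [:: (n, [fset inr a]%fset)].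
Proof. by rewrite -(domf_switch a b). Qed.

Lemma wf_par_dev M n a b P h : wf M -> fresh n a M -> wf (dev n a b P h) ->
  wf (NPar M (dev n a b P h)).
Proof.
move=> wM /andP[nM aM] wD; rewrite wf_par wM wD nkeys_dev /=.
apply/allrelP => x y xM; rewrite inE => /eqP -> /=; rewrite /key_disj /=.
apply/andP; split; first by apply: contraNneq nM => <-; apply: map_f.
apply/allP => k0 kx; apply/implyP => _; rewrite inE.
by apply: contraTneq kx => ->; apply: (allP aM).
Qed.

Lemma dev_no_act M n a b P h X : wf (NPar M (dev n a b P h)) -> ~ ntrans (NAct a) M X.
Proof.
move=> w t; have := w; rewrite wf_par => /and3P[wM _ _].
have [x xM ax] := act_key t wM.
apply: (@wf_par_act S a _ _ x (n, [fset inr a]%fset) w) => //.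
  by rewrite nkeys_dev mem_head.
by rewrite inE.
Qed.

(** Components synchronise only by an output meeting an input, so a component confined to actions on
    [a] never interacts with [W]. *)
Lemma par_act_inv a T : (forall l X, ntrans l T X -> l = NAct a) ->
  forall l W Z, ntrans l (NPar W T) Z ->
    (exists2 W', Z = NPar W' T & ntrans l W W') \/
    (l = NAct a /\ exists2 T', Z = NPar W T' & ntrans l T T').
Proof.
move=> hT l W Z t; inv t;
  try by match goal with H : ntrans _ T _ |- _ => have := hT _ _ H end.
  by left; eexists.
by right; split; [exact: hT H3|eexists].
Qed.

Lemma par_quiet_inv T : (forall l X, ~ ntrans l T X) ->
  forall l W Z, ntrans l (NPar W T) Z -> exists2 W', Z = NPar W' T & ntrans l W W'.
Proof.
move=> hT l W Z t; inv t;
  try by match goal with H : ntrans _ T _ |- _ => case: (hT _ _ H) end.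
by eexists.
Qed.

Lemma taus_refl M : taus M M. Proof. exact: rt_refl. Qed.
Lemma taus_trans M N O : taus M N -> taus N O -> taus M O.
Proof. exact: rt_trans. Qed.
Lemma taus_step M N : ntrans tau M N -> taus M N.
Proof. by move=> t; apply: rt_step; constructor. Qed.

Lemma taus_ind_r M (I : net S -> Prop) : I M ->
  (forall N O, taus M N -> I N -> ntrans tau N O -> I O) -> forall N, taus M N -> I N.
Proof.
move=> h0 h1; apply: (clos_refl_trans_ind_left (net S) (@etrans S (ETau S)) M) => //.
by move=> N O t IN t'; inv t'; apply: h1 t IN _.
Qed.

Lemma lsteps_ind_r M (I : net S -> Prop) : I M ->
  (forall N O, lsteps M N -> I N -> lstep N O -> I O) -> forall N, lsteps M N -> I N.
Proof. exact: clos_refl_trans_ind_left. Qed.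

Lemma taus_wf M N : taus M N -> wf M -> wf N.
Proof. by move=> + wM; elim/taus_ind_r => // A B _ wA t; apply: ntrans_wf t wA. Qed.

Lemma hasact_taus a v h M N : taus M N -> hasact a v h N = hasact a v h M.
Proof. by elim/taus_ind_r => // A B _ <- t; rewrite (hasact_ntrans _ _ _ t). Qed.

Lemma taus_par_quiet T W Z : (forall l X, ~ ntrans l T X) -> taus (NPar W T) Z ->
  exists2 W', Z = NPar W' T & taus W W'.
Proof.
move=> hT; elim/taus_ind_r; first by exists W => //; apply: taus_refl.
move=> A B _ [W1 -> t1] t; have [W2 -> t2] := par_quiet_inv hT t.
by exists W2 => //; apply: taus_trans t1 (taus_step t2).
Qed.

Definition dev_trans n a b h (lb : plabel S) P' l X : Prop :=
  match lb with
  | PTau | PLoc _ => l = tau /\ X = dev n a b P' h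
  | PSense _ _ => False
  | PActuate a' v =>
      if (a' == a) && (v == vbool S b) then l = tau /\ X = dev n a b P' h
      else l = NAct a' /\ X = Node n (switch a b).[inr a' <- v]%fmap P' Stationary h
  | POut c v => [/\ l = NOut c v h, X = dev n a b P' h & range_ge0 (rng c)]
  | PIn c v => [/\ l = NIn c v h, X = dev n a b P' h & range_ge0 (rng c)]
  end.

Lemma dev_inv n a b P h l X : ntrans l (dev n a b P h) X ->
  exists lb P', ptrans lb P P' /\ dev_trans n a b h lb P' l X.
Proof.
move=> t; inversion t; subst; do 2!eexists; (split; first by eassumption) => //=.
- by match goal with H : fnd _ _ = _ |- _ => move: H end; rewrite switch_inl.
- match goal with H : fnd _ _ = _ |- _ => move: H end.
  by rewrite switchE; case: eqP => // _ [->]; rewrite eqxx.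
- match goal with H : fnd _ _ <> _ |- _ => move: H end.
  by rewrite switchE; case: eqP => //= _; case: eqP => [->|].
Qed.

Lemma dev_sigma_inv n a b P h X : ntrans_sigma (dev n a b P h) X ->
  exists2 P', ptrans_sigma P P' & X = dev n a b P' h.
Proof. by move=> t; inversion t; subst; exists P'. Qed.

(** No timed rule applies to an actuation prefix. The actuator starts at [false], so writing [true]
    changes it: the step is the visible action on [a] and cannot happen silently. *)
Definition blocker n a h : net S :=
  dev n a false (Pre (Actuate a (bval true)) (Nil S)) h.

Lemma blocker_act n a h l X : ntrans l (blocker n a h) X -> l = NAct a.
Proof.
move=> /dev_inv[lb [P' [t]]]; inv t; rewrite /= eqxx /=.
by case: eqP => [/vbool_inj|_ []].
Qed.

Lemma blocker_sigma n a h X : ~ ntrans_sigma (blocker n a h) X.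
Proof. by move=> /dev_sigma_inv[P' t]; inv t. Qed.

Lemma wf_blocker n a h : wf (blocker n a h).
Proof. by rewrite wf_dev /pwf /= inE eqxx. Qed.

Lemma lsteps_blocked n a h W Z : lsteps (NPar W (blocker n a h)) Z ->
  exists2 W', Z = NPar W' (blocker n a h) & taus W W'.
Proof.
elim/lsteps_ind_r; first by exists W => //; apply: taus_refl.
move=> A B _ [W1 -> t1] [t|t]; last first.
  by have [W2 [D [_ _ /blocker_sigma]]] := nsigma_parE t.
have [[W2 -> t2]|[]//] := par_act_inv (@blocker_act n a h) t.
by exists W2 => //; apply: taus_trans t1 (taus_step t2).
Qed.

(** * Making time steps visible by blockers and timers *)

Section Timer.

Variable R : net S -> net S -> Prop.
Hypothesis gR : game R.

Lemma add_blocker (k : loc S) U V : R U V -> exists n a,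
  [/\ fresh n a U, fresh n a V &
      R (NPar U (blocker n a k)) (NPar V (blocker n a k))].
Proof.
move=> r; have [wU wV] := game_wf gR r.
have [n [a]] := exists_fresh (NPar U V); rewrite fresh_par => /andP[fU fV].
exists n, a; split=> //; have [ctx _ _] := game_ctx gR r.
by apply: ctx; apply: wf_par_dev => //; apply: wf_blocker.
Qed.

(* In the presence of a blocker U cannot let time pass, hence cannot match an
   action that it is unable to perform before the next time slot. *)
Lemma act_before_sigma (k : loc S) a U V V' : R U V -> ntrans (NAct a) V V' ->
  exists U' X, taus U U' /\ ntrans (NAct a) U' X.
Proof.
move=> r t; have [n [a2 [fU fV r']]] := add_blocker k r.
have tD : ntrans (NAct a) (NPar V (blocker n a2 k)) (NPar V' (blocker n a2 k)).
  exact: nt_parl.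
have [N1 [N2 [N' [t1 t2 _ _]]]] := game_act gR (game_sym gR r') tD.
have [U' E tU] := lsteps_blocked t1; subst N1.
have [[X _ tX]|[[E] _]] := par_act_inv (@blocker_act n a2 k) t2; first by exists U', X.
(* The answer is not the action of the blocker: [a] is an actuator of [V], while [a2] is fresh for
   [V]. *)
have [_ wV] := game_wf gR r; have [x xV ax] := act_key t wV.
by case/andP: fV => _ /allP /(_ x xV); rewrite -E ax.
Qed.

(* The timer performs an a-action in every time slot: it is idle in the states
   idle b and waits for the action, which blocks time, in the states due b. *)
Definition timer a : proc S :=
  Fix (Pre (Sigma S) (Pre (Actuate a (bval true))
      (Pre (Sigma S) (Pre (Actuate a (bval false)) (PVar S 0))))).

(** The index [b] is the value now on the actuator, and the pending action writes the opposite
    value, as only a change is visible. These are the states that [timer a] passes through after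
    being unfolded. *)
Definition due_proc a b : proc S :=
  if b then Pre (Actuate a (bval false)) (timer a)
  else Pre (Actuate a (bval true))
      (Pre (Sigma S) (Pre (Actuate a (bval false)) (timer a))).

Definition idle_proc a b : proc S :=
  if b then Pre (Sigma S) (due_proc a true) else timer a.

Definition idle n a h b : net S := dev n a b (idle_proc a b) h.
Definition due n a h b : net S := dev n a b (due_proc a b) h.

Lemma wf_idle n a h b : wf (idle n a h b).
Proof. by rewrite wf_dev /pwf; case: b; rewrite /= !inE !eqxx. Qed.

Lemma idle_quiet n a h b l X : ~ ntrans l (idle n a h b) X.
Proof.
move=> /dev_inv[lb [P' [t _]]]; case: b t => t; inv t.
by match goal with H : ptrans _ _ _ |- _ => inv H end.
Qed.

Lemma idle_sigma n a h b X : ntrans_sigma (idle n a h b) X -> X = due n a h b.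
Proof.
move=> /dev_sigma_inv[P' t ->]; case: b t => t; inv t => //.
by match goal with H : ptrans_sigma _ _ |- _ => inv H end.
Qed.

Lemma idle_due n a h b : ntrans_sigma (idle n a h b) (due n a h b).
Proof.
constructor; last by case=> X /idle_quiet.
by case: b; do ?constructor.
Qed.

Lemma due_inv n a h b l X : ntrans l (due n a h b) X ->
  l = NAct a /\ X = idle n a h (~~ b).
Proof.
move=> /dev_inv[lb [P' [t]]]; case: b t => t; inv t; rewrite /= eqxx /=;
  by case: eqP => [/vbool_inj|_ [-> ->]] //; rewrite switch_set.
Qed.

Lemma due_idle n a h b : ntrans (NAct a) (due n a h b) (idle n a h (~~ b)).
Proof.
rewrite /due /idle /dev -(switch_set a b (~~ b)).
case: b; apply: nt_actchg; try exact: pt_actuate;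
  by rewrite switchE eqxx => -[/vbool_inj].
Qed.

Lemma due_sigma n a h b X : ~ ntrans_sigma (due n a h b) X.
Proof. by move=> /dev_sigma_inv[P' t]; case: b t => t; inv t. Qed.

Definition wsigma M N := exists A B, [/\ taus M A, ntrans_sigma A B & taus B N].

Lemma lsteps_due n a h b W Z : lsteps (NPar W (due n a h b)) Z ->
  exists2 W', Z = NPar W' (due n a h b) & taus W W'.
Proof.
elim/lsteps_ind_r; first by exists W => //; apply: taus_refl.
move=> A B _ [W1 -> t1] [t|t]; last first.
  by have [W2 [D [_ _ /due_sigma]]] := nsigma_parE t.
have hT l X : ntrans l (due n a h b) X -> l = NAct a by case/due_inv.
have [[W2 -> t2]|[]//] := par_act_inv hT t.
by exists W2 => //; apply: taus_trans t1 (taus_step t2).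
Qed.

(** At most one time step fits into a weak reduction: it makes the timer due, and a due timer stops
    time until its action, which no silent step can perform. *)
Lemma lsteps_idle n a h b W Z : lsteps (NPar W (idle n a h b)) Z ->
  (exists2 W', Z = NPar W' (idle n a h b) & taus W W') \/
  (exists2 W', Z = NPar W' (due n a h b) & wsigma W W').
Proof.
elim/lsteps_ind_r; first by left; exists W => //; apply: taus_refl.
have hT l X : ntrans l (due n a h b) X -> l = NAct a by case/due_inv.
move=> A B _ [] [W1 -> t1] [t|t].
- have [W2 -> t2] := par_quiet_inv (@idle_quiet n a h b) t.
  by left; exists W2 => //; apply: taus_trans t1 (taus_step t2).
- have [W2 [D [-> t2 /idle_sigma -> _]]] := nsigma_parE t.
  by right; exists W2 => //; exists W1, W2; split=> //; apply: taus_refl.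
- have [[W2 -> t2]|[]//] := par_act_inv hT t.
  right; exists W2 => //; have [A0 [B0 [? ? t3]]] := t1; exists A0, B0; split=> //.
  exact: taus_trans t3 (taus_step t2).
- by have [W2 [D [_ _ /due_sigma]]] := nsigma_parE t.
Qed.

Lemma idle_due_neq n a h b b' W V : R (NPar W (idle n a h b)) (NPar V (due n a h b')) ->
  False.
Proof.
move=> r; have [w _] := game_wf gR r.
have [U' [X [tU tX]]] := act_before_sigma h r (nt_parr _ (due_idle n a h b')).
have [W' E tW] := taus_par_quiet (@idle_quiet n a h b) tU; subst U'.
have [W'' _ t] := par_quiet_inv (@idle_quiet n a h b) tX.
(* The idle timer is silent, so [W] itself would have to act on [a], an actuator owned by the
   timer. *)
exact: dev_no_act (taus_wf tU w) t.
Qed.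

(** The timer is quantified inside because its phase [b] flips with every time step; both sides must
    have the same phase. *)
Definition timed W V : Prop :=
  exists n a h b, R (NPar W (idle n a h b)) (NPar V (idle n a h b)).

Lemma timed_sym W V : timed W V -> timed V W.
Proof. by move=> [n [a [h [b r]]]]; exists n, a, h, b; apply: game_sym. Qed.

Lemma timed_wf W V : timed W V -> wf W /\ wf V.
Proof.
move=> [n [a [h [b /(game_wf gR)[]]]]].
by rewrite !wf_par => /and3P[-> _ _] /and3P[-> _ _].
Qed.

(** A time step in the answer would leave a due timer on one side and an idle one on the other,
    which [idle_due_neq] excludes. *)
Lemma timed_tau W V W' : timed W V -> ntrans tau W W' ->
  exists2 V', taus V V' & timed W' V'.
Proof.
move=> [n [a [h [b r]]]] t.
have [Z tZ r'] := game_step gR r (or_introl (nt_parl (idle n a h b) t)).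
have [[V' E tV]|[V' E _]] := lsteps_idle tZ; subst Z.
  by exists V' => //; exists n, a, h, b.
by case: (idle_due_neq r').
Qed.

Lemma timed_sigma W V W' : timed W V -> ntrans_sigma W W' ->
  exists2 V', wsigma V V' & timed W' V'.
Proof.
move=> [n [a [h [b r]]]] t.
have ts : ntrans_sigma (NPar W (idle n a h b)) (NPar W' (due n a h b)).
  constructor; [exact: t|exact: idle_due|].
  case=> X /(par_quiet_inv (@idle_quiet n a h b))[X' _ tX].
  by apply: (nsigma_notau t); exists X'.
have [Z tZ r'] := game_step gR r (or_intror ts).
have [[V' E _]|[V' E [A [B [tA tB tV]]]]] := lsteps_idle tZ; subst Z.
  by case: (idle_due_neq (game_sym gR r')).
(* Both timers are now due, and playing the pending action makes them idle again. Only the timer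
   owns [a], so the partner answers with its own timer; the internal steps around it are absorbed
   into the weak time step. *)
have [N1 [N2 [N3 [t1 t2 t3 r2]]]] := game_act gR r' (nt_parr W' (due_idle n a h b)).
have [V1 E tV1] := lsteps_due t1; subst N1.
have w1 := lsteps_wf t1 (game_wf gR r').2.
have hT l X : ntrans l (due n a h b) X -> l = NAct a by case/due_inv.
have [[V2 _ /(dev_no_act w1)]//|[_ [T E /due_inv[_ ET]]]] := par_act_inv hT t2; subst.
have [[V3 E tV3]|[V3 E _]] := lsteps_idle t3; subst N3.
  exists V3; last by exists n, a, h, (~~ b).
  exists A, B; split=> //; apply: taus_trans tV _; exact: taus_trans tV1 tV3.
by case: (idle_due_neq r2).
Qed.

Definition wact a M N := exists A B, [/\ taus M A, ntrans (NAct a) A B & taus B N].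

Lemma timed_act W V a0 W' : timed W V -> ntrans (NAct a0) W W' ->
  exists2 V', wact a0 V V' & timed W' V'.
Proof.
move=> [n [a [h [b r]]]] t; have [wW wV] := game_wf gR r.
have ne : a0 <> a by move=> E; subst a0; apply: dev_no_act wW t.
have [N1 [N2 [N3 [t1 t2 t3 r2]]]] := game_act gR r (nt_parl (idle n a h b) t).
have hT l X : ntrans l (due n a h b) X -> l = NAct a by case/due_inv.
have [[V1 E tV1]|[V1 E _]] := lsteps_idle t1; subst N1.
  have [V2 E tV2] := par_quiet_inv (@idle_quiet n a h b) t2; subst N2.
  have [[V3 E tV3]|[V3 E _]] := lsteps_idle t3; subst N3.
    by exists V3; [exists V1, V2|exists n, a, h, b].
  by case: (idle_due_neq r2).
(* Had time passed before the answer, the timer of the partner would stay due to the end, since [a0]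
   differs from [a]. *)
have [[V2 E tV2]|[[]]//] := par_act_inv hT t2; subst N2.
by have [V3 E _] := lsteps_due t3; subst N3; case: (idle_due_neq r2).
Qed.

Lemma hasact_dev a v h n a' b P k : hasact a v h (dev n a' b P k) -> a = a'.
Proof. by rewrite /= switchE => /andP[_]; case: (eqVneq a a'). Qed.

(** The game matches barbs only weakly, but a blocker excludes time steps and internal steps change
    no actuator, so the barb is present from the start. It belongs neither to the timer nor to the
    blocker, whose actuators do not occur in [W]. *)
Lemma timed_hasact a v h W V : timed W V -> hasact a v h W -> hasact a v h V.
Proof.
move=> [n [a1 [h1 [b r]]]] hW; have [wW _] := game_wf gR r.
have [n2 [a2 [fW _ r']]] := add_blocker h1 r.
have hW' : hasact a v h (NPar (NPar W (idle n a1 h1 b)) (blocker n2 a2 h1)).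
  by rewrite /= hW.
have [Z tZ hZ] := game_barb gR r' hW'.
have [Z1 E tZ1] := lsteps_blocked tZ; subst Z.
have [V' E tV] := taus_par_quiet (@idle_quiet n a1 h1 b) tZ1; subst Z1.
have [x xW ax] := hasact_key hW.
case/orP: hZ => [/orP[hV|hT]|hD].
- by rewrite -(hasact_taus _ _ _ tV).
- have E : a = a1 := @hasact_dev a v h n a1 b (idle_proc a1 b) h1 hT.
  case: (@wf_par_act S a _ _ x (n, [fset inr a]%fset) wW) => //.
    by rewrite /idle nkeys_dev -E mem_head.
  by rewrite inE.
- have E : a = a2 := @hasact_dev a v h n2 a2 false (Nil S) h1 hD.
  move: fW; rewrite fresh_par => /andP[/andP[_ /allP h0] _].
  by case/negP: (h0 x xW); rewrite -E.
Qed.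

Lemma timed_update s h v W V : sensor_dom s v -> timed W V ->
  timed (sensor_update s h v W) (sensor_update s h v V).
Proof.
move=> sv [n [a [k [b r]]]]; exists n, a, k, b.
have E X : sensor_update s h v (NPar X (idle n a k b)) =
    NPar (sensor_update s h v X) (idle n a k b) by congr NPar; apply: update_dev.
by have [_ _ ctx] := game_ctx gR r; have := ctx s h v sv; rewrite !E.
Qed.

Lemma timed_scong W W' V V' : scong W W' -> scong V V' -> timed W V -> timed W' V'.
Proof.
move=> eW eV [n [a [h [b r]]]]; exists n, a, h, b; have [wW wV] := game_wf gR r.
by apply: game_scong gR _ _ _ _ _ r _; apply: scong_parl.
Qed.

Lemma timed_ctx W V : timed W V -> exists m a,
  [/\ fresh m a W, fresh m a V & forall b P (k : loc S), wf (dev m a b P k) ->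
    timed (NPar W (dev m a b P k)) (NPar V (dev m a b P k))].
Proof.
move=> [n [a0 [h [b0 r]]]]; have [wW wV] := game_wf gR r.
set T := idle n a0 h b0 in r wW wV.
have [m [a]] := exists_fresh (NPar (NPar W T) (NPar V T)).
rewrite fresh_par => /andP[fWT fVT].
exists m, a; move: (fWT) (fVT); rewrite !fresh_par => /andP[fW _] /andP[fV _].
split=> // b P k wD; exists n, a0, h, b0.
have wWD := wf_par_dev wW fWT wD; have wVD := wf_par_dev wV fVT wD.
have [ctx _ _] := game_ctx gR r; have r' := ctx _ wWD wVD.
have sw X : wf (NPar (NPar X T) (dev m a b P k)) ->
    scong (NPar (NPar X T) (dev m a b P k)) (NPar (NPar X (dev m a b P k)) T).
  move=> w; have w1 := w; rewrite wf_parA in w1.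
  have w2 : wf (NPar T (dev m a b P k)) by move: w1; rewrite wf_par => /and3P[].
  apply: scong_trans (scong_assoc w) _.
  apply: scong_trans (scong_parr w1 (scong_comm w2)) _.
  apply: scong_sym; apply: scong_assoc; rewrite wf_parA.
  by rewrite -(scong_wf (scong_parr w1 (scong_comm w2))).
exact: game_scong gR _ _ _ _ (sw _ wWD) r' (sw _ wVD).
Qed.

End Timer.

End Game.

(** * Observing communications *)

Section Observations.

Variable S : cait_sig.

Implicit Types (P Q : proc S) (v w : value S) (c d e : chan S) (a : actuator S).
Implicit Types (M N O X Y U V W Z G : net S) (l : nlabel S) (b : bool).
Implicit Types (n m : node S) (h k : loc S) (s : sensor S).

Notation tau := (NTau S).
Notation bval b := (Val (vbool S b)).

(** A network that neither disturbs nor changes under any move of the bisimulation game: it is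
    silent, lets time pass unchanged and ignores sensor updates. *)
Record inert G : Prop := Inert {
  inert_quiet : forall l X, ~ ntrans l G X;
  inert_sigma : ntrans_sigma G G;
  inert_sigma_eq : forall X, ntrans_sigma G X -> X = G;
  inert_update : forall s h v, sensor_update s h v G = G }.

Lemma inert_zero : inert (Zero S).
Proof. by split=> // [l X t||X t]; [inv t|constructor|inv t]. Qed.

Lemma inert_par G G' : inert G -> inert G' -> inert (NPar G G').
Proof.
move=> [q1 s1 e1 u1] [q2 s2 e2 u2].
have q l X : ~ ntrans l (NPar G G') X by move=> /(par_quiet_inv q2)[W _ /q1].
split=> //.
- by constructor=> //; case=> X /q.
- by move=> X t; have [A [B [-> /e1 -> /e2 -> _]]] := nsigma_parE t.
- by move=> s h v /=; rewrite u1 u2.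
Qed.

Lemma inert_dev n a b k : inert (dev n a b (Nil S) k).
Proof.
have q l X : ~ ntrans l (dev n a b (Nil S) k) X.
  by move=> /dev_inv[lb [P' [t _]]]; inv t.
split=> //.
- by constructor; [constructor|case=> X /q].
- by move=> X /dev_sigma_inv[P' t ->]; inv t.
- by move=> s h v; apply: update_dev.
Qed.

Definition report a : proc S := Pre (Actuate a (bval true)) (Nil S).

Definition sender n a c v k : net S :=
  dev n a false (Timeout (Send c (Val v)) (report a) (Nil S)) k.

(** A receiver accepts every value on [c]; the guard lets it report only if the value is [v], and
    otherwise it falls silent. *)
Definition receiver n a c v k : net S :=
  dev n a false (Timeout (Recv c)
    (Cond (Guard (fun vs => vs == [:: v]) [:: Var S 0]) (report a) (Nil S)) (Nil S)) k.

Definition reporting n a k : net S := dev n a false (report a) k.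
Definition received n a v w k : net S :=
  dev n a false
    (Cond (Guard (fun vs => vs == [:: v]) [:: Val w]) (report a) (Nil S)) k.
Definition reported n a k : net S := dev n a true (Nil S) k.

Lemma wf_sender n a c v k : wf (sender n a c v k).
Proof. by rewrite wf_dev /pwf /= inE eqxx. Qed.

Lemma wf_receiver n a c v k : wf (receiver n a c v k).
Proof. by rewrite wf_dev /pwf /= inE eqxx. Qed.

Lemma sender_inv n a c v k l X : ntrans l (sender n a c v k) X ->
  l = NOut c v k /\ X = reporting n a k.
Proof. by move=> /dev_inv[lb [P' [t]]]; inv t => -[-> ->]. Qed.

Lemma sender_out n a c v k : range_ge0 (rng c) ->
  ntrans (NOut c v k) (sender n a c v k) (reporting n a k).
Proof. by move=> r; apply: nt_out => //; constructor. Qed.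

Lemma receiver_inv n a c v k l X : ntrans l (receiver n a c v k) X ->
  exists w, l = NIn c w k /\ X = received n a v w k.
Proof. by move=> /dev_inv[lb [P' [t]]]; inv t => -[-> ->]; exists v0. Qed.

Lemma receiver_in n a c v w k : range_ge0 (rng c) ->
  ntrans (NIn c w k) (receiver n a c v k) (received n a v w k).
Proof. by move=> r; apply: nt_in => //; apply: pt_in. Qed.

Lemma reporting_inv n a k l X : ntrans l (reporting n a k) X ->
  l = NAct a /\ X = reported n a k.
Proof.
move=> /dev_inv[lb [P' [t]]]; inv t; rewrite /= eqxx /=.
by case: eqP => [/vbool_inj|_ [-> ->]] //; rewrite switch_set.
Qed.

Lemma report_act n a k P : ptrans (PActuate a (vbool S true)) P (Nil S) ->
  ntrans (NAct a) (dev n a false P k) (reported n a k).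
Proof.
move=> t; rewrite /reported /dev -(switch_set a false true).
by apply: nt_actchg t; rewrite switchE eqxx => -[/vbool_inj].
Qed.

Lemma received_inv n a v w k l X : ntrans l (received n a v w k) X ->
  [/\ w = v, l = NAct a & X = reported n a k].
Proof.
move=> /dev_inv[lb [P' [t]]]; inversion t; subst; last first.
  by match goal with H : ptrans _ (Nil S) _ |- _ => inv H end.
match goal with H : ptrans _ (report a) _ |- _ => inv H end.
match goal with H : eval_guard _ = _ |- _ => move: H end => /= -[/eqP[->]].
rewrite eqxx /=.
by case: eqP => [/vbool_inj|_ [-> ->]] //; rewrite switch_set.
Qed.

(* E0 is a test node whose only communication is observed by obs w, which turns
   it into E1 w; it then reports on the actuator a iff w = v. *)
Lemma test_run a v (E0 E2 : net S) (E1 : value S -> net S)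
    (obs : value S -> net S -> net S -> Prop) :
  (forall X Z, ntrans tau (NPar X E0) Z ->
     (exists2 X', Z = NPar X' E0 & ntrans tau X X') \/
     (exists w X', Z = NPar X' (E1 w) /\ obs w X X')) ->
  (forall Z, ~ ntrans (NAct a) E0 Z) ->
  (forall w l Z, ntrans l (E1 w) Z -> [/\ w = v, l = NAct a & Z = E2]) ->
  (forall l Z, ~ ntrans l E2 Z) ->
  forall X Z1 Z2 Z3, (forall X' E', taus (NPar X E0) (NPar X' E') ->
     forall Y, ~ ntrans (NAct a) X' Y) ->
  taus (NPar X E0) Z1 -> ntrans (NAct a) Z1 Z2 -> taus Z2 Z3 ->
  exists X1 X2 X3, [/\ taus X X1, obs v X1 X2, taus X2 X3 & Z3 = NPar X3 E2].
Proof.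
move=> hE0 hE0a hE1 hE2 X Z1 Z2 Z3 na t1 t2 t3.
have inv1 : (exists2 X', Z1 = NPar X' E0 & taus X X') \/
    (exists w X1 X2 X', [/\ Z1 = NPar X' (E1 w), taus X X1, obs w X1 X2 & taus X2 X']).
  elim/taus_ind_r: Z1 / t1 {t2}; first by left; exists X => //; apply: taus_refl.
  move=> A B _ [[X1 -> s1]|[w [X1 [X2 [X' [-> s1 o s2]]]]]] t.
    have [[X2 -> s2]|[w [X2 [-> o]]]] := hE0 _ _ t.
      by left; exists X2 => //; apply: taus_trans s1 (taus_step s2).
    by right; exists w, X1, X2, X2; split=> //; apply: taus_refl.
  have hT l Y : ntrans l (E1 w) Y -> l = NAct a by case/hE1.
  have [[Y -> sY]|[]//] := par_act_inv hT t.
  by right; exists w, X1, X2, Y; split=> //; apply: taus_trans s2 (taus_step sY).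
case: inv1 => [[X' E s]|[w [X1 [X2 [X' [E s1 o s2]]]]]]; subst Z1.
  by inv t2; [case: (na _ _ t1 _ H3)|case: (hE0a _ H3)].
have hT l Y : ntrans l (E1 w) Y -> l = NAct a by case/hE1.
have [[Y _ /(na _ _ t1)]//|[_ [E' E /hE1[Ew _ EE]]]] := par_act_inv hT t2; subst.
have [X3 E s3] := taus_par_quiet hE2 t3; subst Z3.
by exists X1, X2, X3; split=> //; apply: taus_trans s2 s3.
Qed.

Lemma sender_tau n a c v k X Z : ntrans tau (NPar X (sender n a c v k)) Z ->
  (exists2 X', Z = NPar X' (sender n a c v k) & ntrans tau X X') \/
  (exists w X', Z = NPar X' (reporting n a k) /\ (w = v /\ etrans (EIn c v k) X X')).
Proof.
move=> t; inversion t; subst;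
  match goal with H : ntrans _ (sender _ _ _ _ _) _ |- _ =>
    have [El EX] := sender_inv H | _ => idtac end; try discriminate El.
- case: El => ? ? ?; subst; right; exists v, N'; split=> //; split=> //.
  apply: et_in; first by eassumption.
  by rewrite dist_sym.
- by left; exists M'.
Qed.

Lemma receiver_tau n a c v k X Z : ntrans tau (NPar X (receiver n a c v k)) Z ->
  (exists2 X', Z = NPar X' (receiver n a c v k) & ntrans tau X X') \/
  (exists w X', Z = NPar X' (received n a v w k) /\ etrans (EOut c w k) X X').
Proof.
move=> t; inversion t; subst;
  match goal with H : ntrans _ (receiver _ _ _ _ _) _ |- _ =>
    have [w [El EX]] := receiver_inv H | _ => idtac end; try discriminate El.
- case: El => ? ? ?; subst; right; exists w, M'; split=> //.
  apply: et_out; first by eassumption.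
  by rewrite dist_sym.
- by left; exists M'.
Qed.

Definition observed (R : net S -> net S -> Prop) M N : Prop :=
  exists2 G, inert G & timed R (NPar M G) (NPar N G).

(** * The clauses of the bisimulation, label by label *)

Section Bisimulation.

Variable R : net S -> net S -> Prop.
Hypothesis gR : game R.

Notation wit := (observed R).

Lemma no_act_fresh m a X E0 : wf (NPar X E0) -> fresh m a X ->
  forall X' E', taus (NPar X E0) (NPar X' E') -> nkeys X' = nkeys X ->
  forall Y, ~ ntrans (NAct a) X' Y.
Proof.
move=> w /andP[_ /allP f] X' E' t kX Y tY.
have := taus_wf t w; rewrite wf_par => /and3P[wX' _ _].
have [x xX ax] := act_key tY wX'; rewrite kX in xX.
by case/negP: (f x xX).
Qed.

Lemma taus_keys X E0 X' E' : taus (NPar X E0) (NPar X' E') -> wf (NPar X E0) ->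
  nkeys X' = nkeys X.
Proof.
move=> t w; suff : exists A B, NPar X' E' = NPar A B /\ nkeys A = nkeys X.
  by case=> A [B [[-> _] ->]].
elim/taus_ind_r: (NPar X' E') / t; first by exists X, E0.
move=> A B tA [A1 [A2 [EA kA]]] t; subst A.
have := taus_wf tA w; rewrite wf_par => /and3P[w1 _ _].
by inv t; do 2!eexists; (split; first by []); rewrite // -kA; apply: ntrans_keys; eauto.
Qed.

Lemma bisim_tau M N M' : wit M N -> ntrans tau M M' ->
  exists2 N', taus N N' & wit M' N'.
Proof.
move=> [G iG r] t; have [Z tZ r'] := timed_tau gR r (nt_parl G t).
have [N' E tN] := taus_par_quiet (inert_quiet iG) tZ; subst Z.
by exists N' => //; exists G.
Qed.

Lemma bisim_sigma M N M' : wit M N -> ntrans_sigma M M' ->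
  exists2 N', weak_etrans (ESigma S) N N' & wit M' N'.
Proof.
move=> [G iG r] t.
have ts : ntrans_sigma (NPar M G) (NPar M' G).
  constructor=> //; first exact: inert_sigma.
  case=> X /(par_quiet_inv (inert_quiet iG))[X' _ tX].
  by apply: (nsigma_notau t); exists X'.
have [Z [A [B [tA tB tZ]]] r'] := timed_sigma gR r ts.
have [N1 E t1] := taus_par_quiet (inert_quiet iG) tA; subst A.
have [N2 [G' [E t2 /(inert_sigma_eq iG) EG _]]] := nsigma_parE tB; subst B G'.
have [N3 E t3] := taus_par_quiet (inert_quiet iG) tZ; subst Z.
exists N3; last by exists G.
by exists N1, N2; split=> //; constructor.
Qed.

Lemma bisim_act M N a M' : wit M N -> ntrans (NAct a) M M' ->
  exists2 N', weak_etrans (EAct a) N N' & wit M' N'.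
Proof.
move=> [G iG r] t; have [Z [A [B [tA tB tZ]]] r'] := timed_act gR r (nt_parl G t).
have [N1 E t1] := taus_par_quiet (inert_quiet iG) tA; subst A.
have [N2 E t2] := par_quiet_inv (inert_quiet iG) tB; subst B.
have [N3 E t3] := taus_par_quiet (inert_quiet iG) tZ; subst Z.
exists N3; last by exists G.
by exists N1, N2; split=> //; constructor.
Qed.

Lemma bisim_update M N s h v : sensor_dom s v -> wit M N ->
  wit (sensor_update s h v M) (sensor_update s h v N).
Proof.
move=> sv [G iG r]; exists G => //.
by have := timed_update gR h sv r; rewrite /= !(inert_update iG).
Qed.

Lemma bisim_barb M N a v h : wit M N -> barb a v h M -> barb a v h N.
Proof.
move=> [G iG r]; have [wM wN] := timed_wf gR r.
have := wM; rewrite wf_par => /and3P[wM1 _ _].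
have := wN; rewrite wf_par => /and3P[wN1 _ _].
move=> /(barbP _ _ _ wM1) hM; apply/barbP => //.
have hMG : hasact a v h (NPar M G) by rewrite /= hM.
have /orP[//|hG] := timed_hasact gR r hMG.
have [x xM ax] := hasact_key hM; have [y yG ay] := hasact_key hG.
by case: (wf_par_act wM xM yG ax ay).
Qed.

Lemma timed_finish M N G E : inert G -> inert E ->
  timed R (NPar (NPar M G) E) (NPar (NPar N G) E) -> wit M N.
Proof.
move=> iG iE r; exists (NPar G E); first exact: inert_par.
have [w1 w2] := timed_wf gR r.
by apply: timed_scong gR _ _ _ _ _ _ r; apply: scong_assoc.
Qed.

(** Two moves are played, the communication with the test and then its report. The answer to the
    first may leave the test untouched; only the report forces the partner to have sent [v]. The two
    answers are therefore concatenated before [test_run] extracts the output. *)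
Lemma bisim_out M N c v k M' : wit M N -> etrans (EOut c v k) M M' ->
  exists2 N', weak_etrans (EOut c v k) N N' & wit M' N'.
Proof.
move=> [G iG r] t; have [m [a [_ fN ctx]]] := timed_ctx gR r.
have r0 := ctx false _ k (wf_receiver m a c v k).
have [_ wN0] := timed_wf gR r0.
inversion t as [| | |c0 v0 h k0 M0 M1 tO rg| | |]; subst.
have tT : ntrans tau (NPar (NPar M G) (receiver m a c v k))
                     (NPar (NPar M' G) (received m a v v k)).
  apply: (@nt_glbcoml S c v k h).
  - exact: nt_parl.
  - by apply: receiver_in; apply: in_range_ge0 rg.
  - by rewrite dist_sym.
have [Z1 t1 r1] := timed_tau gR r0 tT.
have tA : ntrans (NAct a) (NPar (NPar M' G) (received m a v v k))
                          (NPar (NPar M' G) (reported m a k)).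
  apply: nt_parr; apply: report_act; apply: pt_true; last by constructor.
  by rewrite /= eqxx.
have [Z3 [A [B [tA1 tB tZ]]] r2] := timed_act gR r1 tA.
have qE2 := inert_quiet (inert_dev m a true k).
have [|||||X1 [X2 [X3 [s1 o s3 E]]]] :=
  @test_run a v (receiver m a c v k) (reported m a k)
    (fun w => received m a v w k) (fun w => etrans (EOut c w k)) _ _ _ _
    (NPar N G) A B Z3 _ (taus_trans t1 tA1) tB tZ => //.
- by move=> X Z; apply: receiver_tau.
- by move=> Z /receiver_inv[w []].
- by move=> w l Z /received_inv.
- by move=> X' E' t'; apply: no_act_fresh (wN0) fN _ _ t' (taus_keys t' wN0).
subst Z3.
have [N1 E s1'] := taus_par_quiet (inert_quiet iG) s1; subst X1.
inversion o as [| | |c0 v0 h0 k0 M0 M1 tO' rg'| | |]; subst.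
have [N2 E tN2] := par_quiet_inv (inert_quiet iG) tO'; subst X2.
have [N3 E s3'] := taus_par_quiet (inert_quiet iG) s3; subst X3.
exists N3; last exact: timed_finish iG (inert_dev _ _ _ _) r2.
by exists N1, N2; split=> //; apply: et_out tN2 rg'.
Qed.

Lemma bisim_in M N c v k M' : wit M N -> etrans (EIn c v k) M M' ->
  exists2 N', weak_etrans (EIn c v k) N N' & wit M' N'.
Proof.
move=> [G iG r] t; have [m [a [_ fN ctx]]] := timed_ctx gR r.
have r0 := ctx false _ k (wf_sender m a c v k).
have [_ wN0] := timed_wf gR r0.
inversion t as [| | | |c0 v0 h k0 M0 M1 tO rg| |]; subst.
have tT : ntrans tau (NPar (NPar M G) (sender m a c v k))
                     (NPar (NPar M' G) (reporting m a k)).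
  apply: (@nt_glbcomr S c v h k).
  - by apply: sender_out; apply: in_range_ge0 rg.
  - exact: nt_parl.
  - by rewrite dist_sym.
have [Z1 t1 r1] := timed_tau gR r0 tT.
have tA : ntrans (NAct a) (NPar (NPar M' G) (reporting m a k))
                          (NPar (NPar M' G) (reported m a k)).
  by apply: nt_parr; apply: report_act; constructor.
have [Z3 [A [B [tA1 tB tZ]]] r2] := timed_act gR r1 tA.
have qE2 := inert_quiet (inert_dev m a true k).
(* The sender itself fixes the value, so only [w = v] arises; for other [w] a silent node is put in,
   because [test_run] asks that no report follow a different value. *)
pose E1 w : net S := if w == v then reporting m a k else reported m a k.
have [|||||X1 [X2 [X3 [s1 o s3 E]]]] :=
  @test_run a v (sender m a c v k) (reported m a k) E1
    (fun w X Y => w = v /\ etrans (EIn c v k) X Y) _ _ _ _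
    (NPar N G) A B Z3 _ (taus_trans t1 tA1) tB tZ => //.
- move=> X Z /sender_tau[|[w [X' [-> [Ew tX]]]]]; first by left.
  by right; exists w, X'; split=> //; rewrite /E1 Ew eqxx.
- by move=> Z /sender_inv[].
- by rewrite /E1 => w l Z; case: eqP => [-> /reporting_inv[-> ->]|_ /qE2].
- by move=> X' E' t'; apply: no_act_fresh (wN0) fN _ _ t' (taus_keys t' wN0).
subst Z3.
have [N1 E s1'] := taus_par_quiet (inert_quiet iG) s1; subst X1.
case: o => _ o; inversion o as [| | | |c0 v0 h0 k0 M0 M1 tO' rg'| |]; subst.
have [N2 E tN2] := par_quiet_inv (inert_quiet iG) tO'; subst X2.
have [N3 E s3'] := taus_par_quiet (inert_quiet iG) s3; subst X3.
exists N3; last exact: timed_finish iG (inert_dev _ _ _ _) r2.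
by exists N1, N2; split=> //; apply: et_in tN2 rg'.
Qed.

Lemma observed_bisimulation : bisimulation wit.
Proof.
split.
- move=> M N [G iG r]; have [wM wN] := timed_wf gR r.
  by move: wM wN; rewrite !wf_par => /and3P[-> _ _] /and3P[-> _ _].
- by move=> M N [G iG r]; exists G => //; apply: timed_sym.
move=> M N r l M' t; case: l t => [| |a|c v k|c v k|s v h|a v h] t /=.
- by inversion t; subst; apply: bisim_tau r _.
- by inversion t; subst; apply: bisim_sigma r _.
- by inversion t; subst; apply: bisim_act r _.
- exact: bisim_out r t.
- exact: bisim_in r t.
- inversion t; subst; exists (sensor_update s h v N); last exact: bisim_update.
  exists N, (sensor_update s h v N); split; try exact: taus_refl.
  by constructor.
- inversion t; subst; exists N => //; exists N, N; split; try exact: taus_refl.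
  by constructor; apply: bisim_barb r _.
Qed.

(** The location [h] is where the timer is placed; no test has been used yet, so the inert network
    is [Zero]. *)
Lemma game_observed (h : loc S) M N : R M N -> wit M N.
Proof.
move=> r; have [wM wN] := game_wf gR r; exists (Zero S); first exact: inert_zero.
have [n [a]] := exists_fresh (NPar M N); rewrite fresh_par => /andP[fM fN].
have [ctx _ _] := game_ctx gR r.
have w1 := wf_par_dev wM fM (wf_idle n a h false).
have w2 := wf_par_dev wN fN (wf_idle n a h false).
exists n, a, h, false; apply: (game_scong gR _ (ctx _ w1 w2)); apply: scong_parl => //;
  by apply: scong_sym; apply: scong_unit.
Qed.

End Bisimulation.

(** Internal steps and actions need a node, and every remaining label except [ESigma] mentions a
    location; so only time can pass, and every network lets it pass. *)
Lemma no_loc_bisimulation : (loc S -> False) ->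
  bisimulation (fun M N : net S => wf M /\ wf N).
Proof.
move=> nl; have nt l M M' : ~ ntrans l M M'.
  by elim=> // n J *; apply: nl.
have ns M : ntrans_sigma M M.
  elim: M => [|n J P mu h|M IM N IN|c M IM]; try by constructor.
    by case: (nl h).
  by constructor=> //; case=> X /nt.
split=> // [M N []//|M N [wM wN] l M' t]; case: t wM => {M M'}.
- by move=> M M' /nt.
- move=> M M' t wM; exists N; last by split=> //; apply: sigma_wf t wM.
  by exists N, N; split; [apply: taus_refl|constructor|apply: taus_refl].
- by move=> a M M' /nt.
- by move=> c v h k M M' /nt.
- by move=> c v h k M M' /nt.
- by move=> s v h; case: (nl h).
- by move=> a v h; case: (nl h).
Qed.

End Observations.

Theorem theorem5 (S : cait_sig) (M N : net S) (wfM : wf M) (wfN : wf N) :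
  barbed_cong M N -> bisimilar M N.
Proof.
move=> /barbed_game[R gR r].
(* [loc S] is only known to have decidable equality, so whether it is inhabited is settled by
   excluded middle. *)
case: (classic (exists h : loc S, True)) => [[h _]|nh].
  exists (observed R); first exact: observed_bisimulation.
  exact: game_observed.
exists (fun M N => wf M /\ wf N) => //.
by apply: no_loc_bisimulation => h; apply: nh; exists h.
Qed.
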